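(* Let $\tau\in(0,1)$, $n_0>0$ and $0<D<n_0^\tau$, and let $\mu$ be the probability measure on the unit circle $\partial\mathbb{D}$ with Verblunsky coefficients $$\alpha_n=-\frac{D}{(n+n_0)^\tau},\qquad n=0,1,2,\dots$$ Let $w$ be the density of the absolutely continuous part of $\mu$ with respect to $\frac{d\theta}{2\pi}$, continuous on $(0,2\pi)$ and extended $2\pi$-periodically. Then, as $\theta\to0$, $$\log w(\theta)=-\sum_{n=0}^{L-1}P_n\left|\sin\frac\theta2\right|^{-\frac1\tau+1+2n}+O(\log|\theta|)$$ with $L=\left\lceil\frac1{2\tau}-\frac12\right\rceil$ and $$P_n=D^{\frac1\tau}\frac{\Gamma\left(n+\frac12\right)}{\Gamma\left(\frac1{2\tau}\right)}\sum_{l=0}^n\frac{\Gamma\left(\frac1{2\tau}-l-\frac12\right)}{(n-l)!}.$$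
   Context: $\mathbb{D}$ is the open unit disk. The orthonormal polynomials $\varphi_n$ of a nontrivial (not finitely supported) probability measure $\mu$ on $\partial\mathbb{D}$, obtained by Gram–Schmidt from $1,z,z^2,\dots$ in $L^2(\mu)$, obey $\varphi_{n+1}(z)=\frac{z\varphi_n(z)-\bar\alpha_nz^n\overline{\varphi_n(1/\bar z)}}{\sqrt{1-|\alpha_n|^2}}$, which defines the Verblunsky coefficients $\alpha_n\in\mathbb{D}$; every sequence in $\mathbb{D}^\infty$ arises from a unique such $\mu$. Write $d\mu=w(\theta)\frac{d\theta}{2\pi}+d\mu_{\rm s}$ for the Lebesgue decomposition. For the coefficients considered it is known that $w$ is continuous and strictly positive on $(0,2\pi)$ and $\operatorname{supp}\mu_{\rm s}\subset\{1\}$. $\Gamma$ denotes the Gamma function. *)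

(* Defs.v *)
From HB Require Import structures.
From mathcomp Require Import all_boot all_order all_algebra.
From mathcomp Require Import all_classical all_reals all_analysis.
From mathcomp Require Import complex.

Set Implicit Arguments.
Unset Strict Implicit.
Unset Printing Implicit Defensive.
Import Order.TTheory GRing.Theory Num.Theory.
Import numFieldNormedType.Exports.
Local Open Scope classical_set_scope.
Local Open Scope ring_scope.
Local Open Scope complex_scope.

Section CirclePolynomials.
Variable R : realType.

(* [R[i]^o] carries the topology of the modulus; the plane is equipped with
   its Borel sigma-algebra. *)
Definition plane := g_sigma_algebraType (@open (R[i]^o)).

Definition unit_circle : set plane := [set z : R[i] | `|z| = 1].

Definition expi (theta : R) : plane := cos theta +i* sin theta.

Variable mu : {measure set plane -> \bar R}.

(* Inner product of L^2(mu), conjugate-linear on the left. *)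
Definition inner (f g : {poly R[i]}) : R[i] :=
  let h (z : plane) : R[i] := (f.[z])^* * g.[z] in
  (\int[mu]_(z in unit_circle) complex.Re (h z)) +i*
  (\int[mu]_(z in unit_circle) complex.Im (h z)).

Definition normalize (p : {poly R[i]}) : {poly R[i]} :=
  (sqrtC (inner p p))^-1 *: p.

Definition gs_step (s : seq {poly R[i]}) (p : {poly R[i]}) : {poly R[i]} :=
  normalize (p - \sum_(f <- s) inner f p *: f).

Fixpoint gram_schmidt (n : nat) : seq {poly R[i]} :=
  if n is m.+1 then
    rcons (gram_schmidt m) (gs_step (gram_schmidt m) 'X^m)
  else [::].

Definition orthonormal_poly (n : nat) : {poly R[i]} :=
  gs_step (gram_schmidt n) 'X^n.

Definition nontrivial_measure : Prop :=
  forall F : set plane, finite_set F -> mu (~` F) != 0%E.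

Definition verblunsky_coefficients (alpha : nat -> R[i]) : Prop :=
  [/\ nontrivial_measure,
      forall n, `|alpha n| < 1 &
      forall n (z : R[i]), z != 0 ->
        (orthonormal_poly n.+1).[z] =
          (z * (orthonormal_poly n).[z]
           - (alpha n)^* * (z ^+ n * ((orthonormal_poly n).[(z^*)^-1])^*))
          / sqrtC (1 - `|alpha n| ^+ 2)].

(* [w] is the density, with respect to dtheta / 2pi, of the absolutely
   continuous part in the Lebesgue decomposition of [mu], the circle being
   parametrized by [0, 2pi[. *)
Definition ac_density (w : R -> R) : Prop :=
  [/\ measurable_fun (`[0, 2 * pi[ : set R) w,
      (forall theta : R, theta \in `[0, 2 * pi[ -> 0 <= w theta) &
      exists mus : {measure set plane -> \bar R},
        (exists N : set plane, [/\ measurable N, mus (~` N) = 0%E &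
           lebesgue_measure (`[0, 2 * pi[ `&` expi @^-1` N) = 0%E]) /\
        (forall A : set plane, measurable A ->
           mu A = (\int[@lebesgue_measure R]_(theta in
                       `[0%R, (2 * pi)%R[ `&` expi @^-1` A)
                     (w theta / (2 * pi))%:E + mus A)%E)].

End CirclePolynomials.

(* Euler's integral: only meaningful for [0 < x]. *)
Definition Gamma (R : realType) (x : R) : R :=
  \int[@lebesgue_measure R]_(t in `]0, +oo[) (t `^ (x - 1) * expR (- t)).

(* Main.v *)
Require Import Defs.
From HB Require Import structures.
From mathcomp Require Import all_boot all_order all_algebra.
From mathcomp Require Import all_classical all_reals all_analysis.
From mathcomp Require Import complex.
From mathcomp Require Import measurable_realfun.
From mathcomp Require Import ring lra zify.
Set Implicit Arguments.
Unset Strict Implicit.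
Unset Printing Implicit Defensive.
Import Order.TTheory GRing.Theory Num.Theory.
Import numFieldNormedType.Exports.
Local Open Scope classical_set_scope.
Local Open Scope ring_scope.

(** Put [a n = D / (n + n0) `^ tau], which decreases to 0. At the point
    [cexp theta] of the circle let [s] be the absolute value of the sine of half
    the angle and [c] that of its cosine. In the coordinates of [szego_circle]
    the Szego recursion is a product of real matrices of determinant 1, hyperbolic
    as long as [a n >= s] and elliptic afterwards. So the squared modulus of the
    [n]-th orthonormal polynomial grows like the square of the product of the
    larger eigenvalues [growth j] over the indices with [a j >= s], and then
    stays within constant factors. The monotonicity of [a] gives this without
    error terms that accumulate: in the hyperbolic regime a cone and a covector
    are monotone along the orbit, in the elliptic one the invariant quadratic
    forms are ([energy_bounds]). The losses at the transition are powers of [s],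
    which cost [O(ln s)] in the logarithm.

    The sum of [2 * ln (growth j)] is the integral of [2 * arsinh (sqrt q)]
    against a counting measure. The counting function is, up to a bounded error,
    [D `^ tau^-1 * ((1 + q) / (q + s ^+ 2)) `^ (1 / (2 * tau))]; after the
    expansion of a power of [1 + q] in powers of [q] the sum becomes a combination
    of Beta integrals, whose values are the terms of the theorem, and [L] is the
    number of terms after which the remainder is only logarithmic
    ([sum_asymptotics]). Together these give
    [energy_asymptotics], uniformly in [n] beyond a constant multiple of
    [s `^ (- tau^-1)].

    It remains to pass from the orthonormal polynomials to the density. By
    [bernstein_szego] the measure with density the inverse squared modulus of
    the [N]-th orthonormal polynomial has the same moments as [mu] up to order
    [N]. Polynomial bumps that approximate indicators of arcs turn two-sided
    bounds on these densities, valid for all large [N], into bounds on the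
    [mu]-measure of arcs ([arc_upper], [arc_lower]). These first show that the
    singular part does not charge arcs away from 1 ([singular_arc]), and then
    that the continuous density [w] satisfies the same bounds
    ([density_bounds]); the latter come from [energy_asymptotics]. Angles
    [theta < 0] are reached by periodicity. *)

(** * Dynamics of the transfer matrices *)

Section Transfer.
Variable R : realType.
Variables (a : nat -> R) (c s : R).

Definition rho (n : nat) : R := Num.sqrt (1 - a n ^+ 2).

(** The Szego recursion in real form: at the point [(c +i* s) ^+ 2] of the
    circle the [n]-th orthonormal polynomial is [(c +i* s) ^+ n] times the
    complex number whose coordinates are [transfer n]; see [szego_circle].
    Here [a n] is minus the [n]-th Verblunsky coefficient. *)
Fixpoint transfer (n : nat) : R * R :=
  if n is m.+1 then
    let u := transfer m in
    ((1 + a m) / rho m * (c * u.1 - s * u.2),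
     (1 - a m) / rho m * (s * u.1 + c * u.2))
  else (1, 0).

Definition energy (n : nat) : R := (transfer n).1 ^+ 2 + (transfer n).2 ^+ 2.

(** For [s <= a n], the eigenvalue of modulus at least 1 of the [n]-th transfer
    matrix, whose determinant is 1 and whose trace is [2 * c / rho n]. *)
Definition growth (n : nat) : R := (c + Num.sqrt (a n ^+ 2 - s ^+ 2)) / rho n.

Hypothesis a01 : forall n, 0 < a n < 1.
Hypothesis a_decr : forall m n, (m <= n)%N -> a n <= a m.
Hypothesis s0 : 0 < s.
Hypothesis c0 : 0 < c.
Hypothesis cs1 : c ^+ 2 + s ^+ 2 = 1.

Let a0 n : 0 < a n. Proof. by case/andP: (a01 n). Qed.
Let a1 n : a n < 1. Proof. by case/andP: (a01 n). Qed.

Lemma one_sub_sqr_gt0 n : 0 < 1 - a n ^+ 2.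
Proof. have := a0 n; have := a1 n; nra. Qed.

Lemma c_le1 : c <= 1.
Proof. by rewrite -(@expr_le1 _ 2) ?(ltW c0)// -cs1 lerDl sqr_ge0. Qed.

Lemma s_le1 : s <= 1.
Proof. by rewrite -(@expr_le1 _ 2) ?(ltW s0)// -cs1 lerDr sqr_ge0. Qed.

Lemma rho_gt0 n : 0 < rho n.
Proof. by rewrite sqrtr_gt0 one_sub_sqr_gt0. Qed.

Lemma rho_sqr n : rho n ^+ 2 = 1 - a n ^+ 2.
Proof. by rewrite sqr_sqrtr// ltW// one_sub_sqr_gt0. Qed.

Lemma energy_ge0 n : 0 <= energy n.
Proof. by rewrite addr_ge0// sqr_ge0. Qed.

Lemma transfer_inv n :
  let u := transfer n in let v := transfer n.+1 in
  u.1 = (c * v.1 * (1 - a n) + s * v.2 * (1 + a n)) / rho n /\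
  u.2 = (- s * v.1 * (1 - a n) + c * v.2 * (1 + a n)) / rho n.
Proof.
move=> u v; rewrite /v /= -/u; have r0 := lt0r_neq0 (rho_gt0 n).
have e : 1 - a n ^+ 2 = rho n ^+ 2 by rewrite rho_sqr.
have e2 : s ^+ 2 = 1 - c ^+ 2 by rewrite -cs1; ring.
have h : (1 - a n) * (1 + a n) / rho n / rho n = 1.
  have -> : (1 - a n) * (1 + a n) = rho n ^+ 2 by rewrite -e; ring.
  by field.
split.
  transitivity ((1 - a n) * (1 + a n) / rho n / rho n * (c ^+ 2 + s ^+ 2) * u.1).
    by rewrite h cs1 !mul1r.
  by field.
transitivity ((1 - a n) * (1 + a n) / rho n / rho n * (c ^+ 2 + s ^+ 2) * u.2).
  by rewrite h cs1 !mul1r.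
by field.
Qed.

Lemma energy_gt0 n : 0 < energy n.
Proof.
elim: n => [|n ih]; first by rewrite /energy/= expr0n/= addr0 expr1n ltr01.
rewrite lt0r energy_ge0 andbT; apply/eqP => e.
have /eqP : (transfer n.+1).1 ^+ 2 + (transfer n.+1).2 ^+ 2 = 0 by [].
rewrite paddr_eq0 ?sqr_ge0// !sqrf_eq0 => /andP[/eqP e1 /eqP e2].
have [h1 h2] := transfer_inv n; move: ih.
by rewrite /energy h1 h2 e1 e2 !mulr0 !mul0r addr0 mul0r expr0n/= addr0 ltxx.
Qed.

(** Each transfer matrix is a rotation followed by a diagonal matrix; [R0]
    bounds the squares of the diagonal entries and of their inverses, so that
    finitely many steps are harmless. *)
Let R0 : R := (1 + a 0) / (1 - a 0).

Lemma step_ratio n : (1 + a n) ^+ 2 / rho n ^+ 2 <= R0 /\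
  (1 - a n) ^+ 2 / rho n ^+ 2 <= R0.
Proof.
have an := a0 n; have an1 := a1 n; have a00 := a0 0; have a01' := a1 0.
have d := a_decr (leq0n n).
have n1 : 0 < 1 - a n by lra.
have n2 : 0 < 1 + a n by lra.
have n3 : 0 < 1 - a 0 by lra.
have -> : rho n ^+ 2 = (1 - a n) * (1 + a n) by rewrite rho_sqr; ring.
split.
  have -> : (1 + a n) ^+ 2 / ((1 - a n) * (1 + a n)) = (1 + a n) / (1 - a n).
    by field; rewrite !lt0r_neq0.
  rewrite ler_pdivrMr// mulrAC ler_pdivlMr//; nra.
have -> : (1 - a n) ^+ 2 / ((1 - a n) * (1 + a n)) = (1 - a n) / (1 + a n).
  by field; rewrite !lt0r_neq0.
rewrite ler_pdivrMr// mulrAC ler_pdivlMr//; nra.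
Qed.

Lemma energy_step_le n : energy n.+1 <= R0 * energy n.
Proof.
have [h1 h2] := step_ratio n.
rewrite /energy /=; set u := transfer n.
have -> : ((1 + a n) / rho n * (c * u.1 - s * u.2)) ^+ 2 +
   ((1 - a n) / rho n * (s * u.1 + c * u.2)) ^+ 2 =
   (1 + a n) ^+ 2 / rho n ^+ 2 * (c * u.1 - s * u.2) ^+ 2 +
   (1 - a n) ^+ 2 / rho n ^+ 2 * (s * u.1 + c * u.2) ^+ 2.
  by field; rewrite lt0r_neq0// rho_gt0.
have -> : u.1 ^+ 2 + u.2 ^+ 2 = (c * u.1 - s * u.2) ^+ 2 + (s * u.1 + c * u.2) ^+ 2.
  by rewrite -[LHS]mul1r -cs1; ring.
by rewrite mulrDr lerD// ler_wpM2r// sqr_ge0.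
Qed.

Lemma energy_step_ge n : energy n <= R0 * energy n.+1.
Proof.
have [h1 h2] := step_ratio n.
have [e1 e2] := transfer_inv n.
rewrite {1}/energy e1 e2; set v := transfer n.+1.
have -> : ((c * v.1 * (1 - a n) + s * v.2 * (1 + a n)) / rho n) ^+ 2 +
   ((- s * v.1 * (1 - a n) + c * v.2 * (1 + a n)) / rho n) ^+ 2 =
   (c ^+ 2 + s ^+ 2) * ((1 - a n) ^+ 2 / rho n ^+ 2 * v.1 ^+ 2 +
   (1 + a n) ^+ 2 / rho n ^+ 2 * v.2 ^+ 2).
  by field; rewrite lt0r_neq0// rho_gt0.
by rewrite cs1 mul1r /energy -/v mulrDr lerD// ler_wpM2r// sqr_ge0.
Qed.

(** [Q (a n)] is the quadratic form left invariant by the [n]-th transfer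
    matrix, a multiple of [u |-> det (u, T u)]. Since [refl] is the form of a
    reflection, [Q (a n)] is definite exactly when [a n < s]: this is the elliptic regime,
    in which the matrices are conjugate to rotations. *)
Let refl (u : R * R) : R := s * (u.1 ^+ 2 - u.2 ^+ 2) + 2 * c * u.1 * u.2.
Let Q (t : R) (u : R * R) : R := s * (u.1 ^+ 2 + u.2 ^+ 2) - t * refl u.

Lemma refl_bound u : `|refl u| <= u.1 ^+ 2 + u.2 ^+ 2.
Proof.
rewrite ler_norml; apply/andP; split; rewrite -subr_ge0 /refl.
  have -> : s * (u.1 ^+ 2 - u.2 ^+ 2) + 2 * c * u.1 * u.2 - - (u.1 ^+ 2 + u.2 ^+ 2)
    = ((1 + s) * u.1 + c * u.2) ^+ 2 / (1 + s).
    have -> : ((1 + s) * u.1 + c * u.2) ^+ 2 = (1 + s) ^+ 2 * u.1 ^+ 2 +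
       2 * (1 + s) * c * u.1 * u.2 + (c ^+ 2 + s ^+ 2 - s ^+ 2) * u.2 ^+ 2 by ring.
    by rewrite cs1; field; rewrite lt0r_neq0// ltr_wpDl.
  by rewrite divr_ge0 ?sqr_ge0// addr_ge0// ltW.
have -> : u.1 ^+ 2 + u.2 ^+ 2 - (s * (u.1 ^+ 2 - u.2 ^+ 2) + 2 * c * u.1 * u.2)
    = ((1 + s) * u.2 - c * u.1) ^+ 2 / (1 + s).
    have -> : ((1 + s) * u.2 - c * u.1) ^+ 2 = (1 + s) ^+ 2 * u.2 ^+ 2 -
       2 * (1 + s) * c * u.1 * u.2 + (c ^+ 2 + s ^+ 2 - s ^+ 2) * u.1 ^+ 2 by ring.
    by rewrite cs1; field; rewrite lt0r_neq0// ltr_wpDl.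
by rewrite divr_ge0 ?sqr_ge0// addr_ge0// ltW.
Qed.

Lemma Q_invariant n : Q (a n) (transfer n.+1) = Q (a n) (transfer n).
Proof.
rewrite /Q /refl /=; set u := transfer n.
have r0 := lt0r_neq0 (rho_gt0 n).
set p := 1 + a n; set q := 1 - a n.
have rpq : rho n ^+ 2 = p * q by rewrite rho_sqr /p /q; ring.
have p0 : p != 0 by rewrite lt0r_neq0// /p; have := a0 n; lra.
have q0 : q != 0 by rewrite lt0r_neq0// /q; have := a1 n; lra.
set X := c * u.1 - s * u.2; set Y := s * u.1 + c * u.2.
have -> : s * ((p / rho n * X) ^+ 2 + (q / rho n * Y) ^+ 2) -
  a n * (s * ((p / rho n * X) ^+ 2 - (q / rho n * Y) ^+ 2) +
   2 * c * (p / rho n * X) * (q / rho n * Y)) =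
   (s * (p ^+ 2 * X ^+ 2 + q ^+ 2 * Y ^+ 2) - a n * (s * (p ^+ 2 * X ^+ 2 - q ^+ 2 * Y ^+ 2)
   + 2 * c * p * q * X * Y)) / rho n ^+ 2 by field.
rewrite rpq.
have -> : (s * (p ^+ 2 * X ^+ 2 + q ^+ 2 * Y ^+ 2) - a n * (s * (p ^+ 2 * X ^+ 2 - q ^+ 2 * Y ^+ 2)
   + 2 * c * p * q * X * Y)) = (p * q) * (s * (p * X ^+ 2 + q * Y ^+ 2) - a n * (2 * c * X * Y)).
  rewrite /p /q; ring.
rewrite mulrAC divff ?mulf_neq0// mul1r.
have -> : s * (u.1 ^+ 2 + u.2 ^+ 2) - a n * (s * (u.1 ^+ 2 - u.2 ^+ 2) + 2 * c * u.1 * u.2) =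
   (c ^+ 2 + s ^+ 2) * (s * (u.1 ^+ 2 + u.2 ^+ 2)) -
   a n * ((c ^+ 2 + s ^+ 2) * (s * (u.1 ^+ 2 - u.2 ^+ 2) + 2 * c * u.1 * u.2)).
  by rewrite cs1 !mul1r.
rewrite /X /Y /p /q; ring.
Qed.

Lemma cross_trans1 (q Qn Q' pm pn p' : R) : 0 < pn -> 0 <= p' -> 0 <= pm ->
  Qn * pm <= q * pn -> pn * Q' <= p' * Qn -> Q' * pm <= q * p'.
Proof.
move=> pn0 p'0 pm0 h1 h2; rewrite -(ler_pM2l pn0) mulrA.
apply: (le_trans (ler_wpM2r pm0 h2)).
by rewrite -mulrA [leRHS]mulrA [leRHS]mulrC [pn * q]mulrC ler_wpM2l.
Qed.

Lemma cross_trans2 (q Qn Q' rm rn r' : R) : 0 < rn -> 0 <= r' -> 0 <= rm ->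
  q * rn <= Qn * rm -> r' * Qn <= rn * Q' -> q * r' <= Q' * rm.
Proof.
move=> rn0 r'0 rm0 h1 h2; rewrite -(ler_pM2l rn0) [leRHS]mulrA.
apply: le_trans (ler_wpM2r rm0 h2).
by rewrite -[leRHS]mulrA [leLHS]mulrA [leLHS]mulrC [rn * q]mulrC ler_wpM2l.
Qed.

(** For [t < s], replacing [t] by a smaller [t'] makes [Q t u / (s - t)] decrease and
    [Q t u / (s + t)] increase. *)
Lemma Q_step (t t' : R) u : t' <= t ->
  (s - t) * Q t' u <= (s - t') * Q t u /\ (s + t') * Q t u <= (s + t) * Q t' u.
Proof.
move=> tt; have := refl_bound u; rewrite ler_norml /Q => /andP[].
set E := _ ^+ 2 + _; set w := refl u => l1 l2.
have h : 0 <= s * (t - t') by rewrite mulr_ge0 ?subr_ge0// ltW.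
split; rewrite -subr_ge0.
  have -> : (s - t') * (s * E - t * w) - (s - t) * (s * E - t' * w) =
            s * (t - t') * (E - w) by ring.
  by rewrite mulr_ge0// subr_ge0.
have -> : (s + t) * (s * E - t' * w) - (s + t') * (s * E - t * w) =
            s * (t - t') * (E + w) by ring.
by rewrite mulr_ge0//; lra.
Qed.

Lemma Q_bound t u : 0 <= t ->
  (s - t) * (u.1 ^+ 2 + u.2 ^+ 2) <= Q t u <= (s + t) * (u.1 ^+ 2 + u.2 ^+ 2).
Proof.
move=> t0; have := refl_bound u; rewrite ler_norml /Q => /andP[].
set E := _ ^+ 2 + _; set w := refl u => l1 l2.
by rewrite mulrBl mulrDl lerD2l lerN2 lerD2l -mulrN !ler_wpM2l//; lra.
Qed.

(** The monotonicity of [a] makes the distortions of all the steps telescope: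
    [Q (a n) / (s - a n)] decreases and [Q (a n) / (s + a n)] increases along
    the orbit, so that the only loss is the one of the comparison of the form
    with the energy at the first step. *)
Lemma elliptic_comparison m n : a m < s -> (m <= n)%N ->
  (s - a m) * energy n <= (s + a m) * energy m /\
  (s - a m) * energy m <= (s + a m) * energy n.
Proof.
move=> ams mn.
have [k1 k2] : Q (a n) (transfer n) * (s - a m) <= Q (a m) (transfer m) * (s - a n) /\
  Q (a m) (transfer m) * (s + a n) <= Q (a n) (transfer n) * (s + a m).
  elim: n mn => [|n ih]; first by rewrite leqn0 => /eqP ->; split; rewrite lexx.
  rewrite leq_eqVlt => /predU1P[<-|]; first by split; rewrite lexx.
  rewrite ltnS => mn; have [] := ih mn.
  have am := a0 m; have an := a0 n; have an1 := a0 n.+1.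
  have d1 := a_decr mn; have d2 := a_decr (leqnSn n).
  rewrite -Q_invariant => h1 h2; have [g1 g2] := Q_step (transfer n.+1) d2.
  split.
    by apply: cross_trans1 h1 g1; lra.
  by apply: cross_trans2 h2 g2; lra.
have am := a0 m; have an := a0 n; have d := a_decr mn.
have /andP[m1 m2] := Q_bound (transfer m) (ltW am).
have /andP[n1 n2] := Q_bound (transfer n) (ltW an).
rewrite -!/(energy _) in m1 m2 n1 n2.
have sm : 0 <= s - a m by lra.
have sm' : 0 <= s + a m by lra.
have sn : 0 < s - a n by lra.
have sn' : 0 < s + a n by lra.
split.
  rewrite -(ler_pM2l sn) mulrCA mulrC; apply: le_trans (ler_wpM2r sm n1) _.
  by apply: (le_trans k1); rewrite mulrC ler_wpM2l// ltW.
rewrite -(ler_pM2l sn') mulrC; apply: le_trans (ler_wpM2r (ltW sn') m1) _.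
by apply: (le_trans k2); rewrite mulrC [leRHS]mulrCA ler_wpM2l.
Qed.

(** When [s <= a n] the eigenvalues are real: [kexp n] is the slope of the
    eigenvector of [growth n], and [(kcon n, - s)] is the covector of the same
    eigenvalue. *)
Let disc (n : nat) : R := Num.sqrt (a n ^+ 2 - s ^+ 2).
Let kexp (n : nat) : R := s * (1 - a n) / (a n * c + disc n).
Let kcon (n : nat) : R := (a n * c + disc n) / (1 + a n).

Lemma disc_sqr n : s <= a n -> disc n ^+ 2 = a n ^+ 2 - s ^+ 2.
Proof.
move=> h; rewrite sqr_sqrtr// subr_ge0; apply: lerXn2r => //.
  by rewrite nnegrE ltW.
by rewrite nnegrE ltW.
Qed.

Lemma disc_decr m n : (m <= n)%N -> disc n <= disc m.
Proof.
by move=> mn; rewrite ler_wsqrtr// lerD2r; apply: lerXn2r; rewrite ?nnegrE ?(ltW (a0 _)) ?a_decr.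
Qed.

Lemma disc_ge0 n : 0 <= disc n. Proof. exact: sqrtr_ge0. Qed.

Lemma growth_gt0 n : 0 < growth n.
Proof. by rewrite divr_gt0 ?rho_gt0// ltr_pwDl// disc_ge0. Qed.

Lemma acd_gt0 n : 0 < a n * c + disc n.
Proof. by rewrite ltr_pwDl ?disc_ge0// mulr_gt0. Qed.

Lemma kexp_incr m n : (m <= n)%N -> kexp m <= kexp n.
Proof.
move=> mn; have d := a_decr mn; have a1m := a1 m; have a1n := a1 n.
rewrite /kexp ler_pdivrMr ?acd_gt0// mulrAC ler_pdivlMr ?acd_gt0//.
rewrite ler_pM//.
- by rewrite mulr_ge0// ?ltW// subr_gt0.
- exact/ltW/acd_gt0.
- by rewrite ler_pM2l// lerD2l lerN2.
- by rewrite lerD ?disc_decr// ler_wpM2r// ltW.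
Qed.

Lemma kcon_decr m n : (m <= n)%N -> s <= a n -> kcon n <= kcon m.
Proof.
move=> mn sn; have d := a_decr mn; have am := a0 m; have an := a0 n.
have sm : s <= a m := le_trans sn d.
have p1 : 0 < 1 + a m by lra.
have p2 : 0 < 1 + a n by lra.
rewrite /kcon ler_pdivrMr// mulrAC ler_pdivlMr//.
have e : disc n * (1 + a m) <= disc m * (1 + a n).
  have q1 : 0 <= disc n * (1 + a m) by rewrite mulr_ge0 ?disc_ge0//; lra.
  have q2 : 0 <= disc m * (1 + a n) by rewrite mulr_ge0 ?disc_ge0//; lra.
  rewrite -(@ler_pXn2r _ 2)//.
  rewrite !exprMn !disc_sqr// -subr_ge0.
  have -> : (a m ^+ 2 - s ^+ 2) * (1 + a n) ^+ 2 - (a n ^+ 2 - s ^+ 2) * (1 + a m) ^+ 2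
    = (a m - a n) * ((a m + a n + 2 * a m * a n) + s ^+ 2 * (2 + a m + a n)) by ring.
  rewrite mulr_ge0 ?subr_ge0//; have := sqr_ge0 s; nra.
have : 0 <= c * (a m - a n) by rewrite mulr_ge0 ?subr_ge0// ltW.
lra.
Qed.

Lemma kexp_le1 n : s <= a n -> kexp n <= 1.
Proof.
move=> sn; rewrite /kexp ler_pdivrMr ?acd_gt0// mul1r.
have dn := disc_ge0 n; have d2 := disc_sqr sn; have an := a0 n; have an1 := a1 n.
have p := acd_gt0 n.
have q : 0 <= s * (1 - a n) by rewrite mulr_ge0// ?subr_ge0 ltW.
rewrite -(@ler_pXn2r _ 2) ?nnegrE ?(ltW p)//.
apply: (@le_trans _ _ (s ^+ 2 * (1 - a n ^+ 2))).
  rewrite exprMn ler_wpM2l ?sqr_ge0//.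
  have : 0 <= a n * (1 - a n) by rewrite mulr_ge0// ?subr_ge0 ltW.
  lra.
have -> : s ^+ 2 * (1 - a n ^+ 2) = (a n * c - disc n) * (a n * c + disc n).
  have -> : (a n * c - disc n) * (a n * c + disc n) = a n ^+ 2 * c ^+ 2 - disc n ^+ 2 by ring.
  by rewrite disc_sqr// (_ : c ^+ 2 = 1 - s ^+ 2); [ring|rewrite -cs1; ring].
rewrite expr2 ler_wpM2r ?(ltW p)//; lra.
Qed.

Lemma kexpE n : s <= a n -> s * kexp n * (1 + a n) = a n * c - disc n.
Proof.
move=> sn; have h := lt0r_neq0 (acd_gt0 n); rewrite /kexp.
apply: (mulIf h).
have -> : (a n * c - disc n) * (a n * c + disc n) = a n ^+ 2 * c ^+ 2 - disc n ^+ 2 by ring.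
rewrite disc_sqr// (_ : c ^+ 2 = 1 - s ^+ 2); last by rewrite -cs1; ring.
by field.
Qed.

Lemma kexp_ge0 n : 0 <= kexp n.
Proof. by rewrite /kexp divr_ge0 ?mulr_ge0// ?ltW ?acd_gt0// subr_gt0. Qed.

Lemma growth_ge1 n : s <= a n -> 1 <= growth n.
Proof.
move=> sn; rewrite ler_pdivlMr ?rho_gt0// mul1r.
apply: (@le_trans _ _ c); last by rewrite lerDl disc_ge0.
rewrite -(@ler_pXn2r _ 2) ?nnegrE ?(ltW c0)//; last exact/ltW/rho_gt0.
rewrite rho_sqr (_ : c ^+ 2 = 1 - s ^+ 2); last by rewrite -cs1; ring.
by rewrite lerD2l lerN2; apply: lerXn2r => //; rewrite nnegrE ltW.
Qed.

Lemma prod_growth_gt0 n : 0 < \prod_(0 <= j < n) growth j.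
Proof. by rewrite prodr_gt0// => i _; exact: growth_gt0. Qed.

(** The orbit starts on the horizontal axis and stays below the expanding
    direction, which moves up since [a] decreases. Below that direction one step
    multiplies the first coordinate by at least the eigenvalue. *)
Lemma hyperbolic_lower n : (forall j, (j < n)%N -> s <= a j) ->
  [/\ 0 <= (transfer n).2, \prod_(0 <= j < n) growth j <= (transfer n).1 &
      (transfer n).2 <= kexp n * (transfer n).1].
Proof.
elim: n => [_|n ih sn].
  by rewrite big_geq//= mulr1 kexp_ge0.
have [y0 x0 yx] : [/\ 0 <= (transfer n).2,
    \prod_(0 <= j < n) growth j <= (transfer n).1 &
      (transfer n).2 <= kexp n * (transfer n).1].
  by apply: ih => j jn; apply: sn; exact: ltnW.
have {}sn : s <= a n by exact: sn.
have E := kexpE sn; have an := a0 n; have an1 := a1 n; have r0 := rho_gt0 n.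
have x0' : 0 < (transfer n).1 := lt_le_trans (prod_growth_gt0 n) x0.
have k0 := kexp_ge0 n; have d0 := disc_ge0 n.
have E2 : (1 - a n) * s = kexp n * (a n * c + disc n).
  by rewrite /kexp divfK ?lt0r_neq0 ?acd_gt0// mulrC.
have x1 : growth n * (transfer n).1 <= (transfer n.+1).1.
  rewrite /= /growth -/(disc n) [leLHS]mulrAC [leRHS]mulrAC.
  rewrite ler_wpM2r ?invr_ge0 ?(ltW r0)//.
  have -> : c + disc n = (1 + a n) * (c - s * kexp n).
    have -> : (1 + a n) * (c - s * kexp n) = c + a n * c - s * kexp n * (1 + a n) by ring.
    by rewrite E; ring.
  rewrite -mulrA ler_pM2l; last lra.
  by rewrite mulrBl lerD2l lerN2 -mulrA ler_wpM2l// ltW.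
split.
- rewrite /= mulr_ge0// ?divr_ge0 ?(ltW r0)//; first lra.
  by rewrite addr_ge0// mulr_ge0// ltW.
- rewrite big_nat_recr//= mulrC; apply: le_trans x1.
  by rewrite ler_wpM2l// ltW// growth_gt0.
apply: (@le_trans _ _ (kexp n * (transfer n.+1).1)); last first.
  rewrite ler_wpM2r ?kexp_incr//; apply: le_trans x1.
  by rewrite mulr_ge0// ltW// growth_gt0.
rewrite /= mulrAC [leRHS]mulrA [kexp n * _]mulrA [leRHS]mulrAC.
rewrite ler_wpM2r ?invr_ge0 ?(ltW r0)//.
set x := (transfer n).1 in x0' yx *; set y := (transfer n).2 in y0 yx *.
rewrite -subr_ge0.
have -> : kexp n * (1 + a n) * (c * x - s * y) - (1 - a n) * (s * x + c * y) =
  x * (kexp n * (c + a n * c)) - (1 - a n) * s * x - y * (s * kexp n * (1 + a n) + (1 - a n) * c)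
  by ring.
rewrite E E2.
have -> : x * (kexp n * (c + a n * c)) - kexp n * (a n * c + disc n) * x -
   y * (a n * c - disc n + (1 - a n) * c) = (kexp n * x - y) * (c - disc n) by ring.
rewrite mulr_ge0 ?subr_ge0//.
rewrite -(@ler_pXn2r _ 2) ?nnegrE ?(ltW c0)// disc_sqr//.
rewrite (_ : c ^+ 2 = 1 - s ^+ 2); last by rewrite -cs1; ring.
by rewrite lerD2r expr_le1// ltW.
Qed.

(** The [n]-th covector is multiplied by exactly [growth n], and passing to the
    next covector only lowers the pairing because [kcon] decreases. *)
Lemma hyperbolic_covector n : (forall j, (j <= n)%N -> s <= a j) ->
  kcon n * (transfer n).1 - s * (transfer n).2 <= \prod_(0 <= j < n) growth j.
Proof.
elim: n => [|n ih] sn.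
  rewrite big_geq//= mulr1 mulr0 subr0 /kcon ler_pdivrMr ?addr_gt0// mul1r.
  have d1 : disc 0 <= 1.
    rewrite -(@ler_pXn2r _ 2) ?nnegrE ?disc_ge0// disc_sqr ?sn//.
    have := one_sub_sqr_gt0 0; have := sqr_ge0 s; rewrite expr1n; lra.
  have : a 0 * c <= a 0 by rewrite ler_piMr ?c_le1// ltW.
  lra.
have {}ih := ih (fun j jn => sn j (leqW jn)).
have [_ x0 _] := hyperbolic_lower (fun j jn => sn j (ltnW jn)).
have x0' := lt_le_trans (prod_growth_gt0 n.+1) x0.
have sn0 : s <= a n by exact: sn.
apply: (@le_trans _ _ (kcon n * (transfer n.+1).1 - s * (transfer n.+1).2)).
  by rewrite lerD2r ler_wpM2r ?(ltW x0')// kcon_decr// sn.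
rewrite big_nat_recr//= [leRHS]mulrC.
apply: le_trans (ler_wpM2l (ltW (growth_gt0 n)) ih).
set x := (transfer n).1; set y := (transfer n).2.
have E : (a n * c + disc n) * (a n * c - disc n) = s ^+ 2 * (1 - a n ^+ 2).
  have -> : (a n * c + disc n) * (a n * c - disc n) = a n ^+ 2 * c ^+ 2 - disc n ^+ 2 by ring.
  by rewrite disc_sqr// (_ : c ^+ 2 = 1 - s ^+ 2); [ring|rewrite -cs1; ring].
have E' : (1 + a n) * ((a n * c + disc n) * c - s ^+ 2 * (1 - a n)) =
   (c + disc n) * (a n * c + disc n).
  have -> : (1 + a n) * ((a n * c + disc n) * c - s ^+ 2 * (1 - a n)) =
   (1 + a n) * (a n * c + disc n) * c - s ^+ 2 * (1 - a n ^+ 2) by ring.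
  by rewrite -E; ring.
have an := a0 n; have p0 : 1 + a n != 0 by rewrite lt0r_neq0// addr_gt0.
have r0 := lt0r_neq0 (rho_gt0 n).
rewrite le_eqVlt; apply/orP; left; apply/eqP.
rewrite /growth /kcon -/(disc n).
transitivity ((((1 + a n) * ((a n * c + disc n) * c - s ^+ 2 * (1 - a n))) / (1 + a n) * x
   - (c + disc n) * s * y) / rho n); last by rewrite E'; field; rewrite p0 r0.
by field; rewrite p0 r0.
Qed.

(** Below the expanding direction the covector controls the first coordinate
    with the factor [kcon n - s * kexp n], which is [2 * disc n / (1 + a n)]. *)
Lemma hyperbolic_upper n : (forall j, (j <= n)%N -> s <= a j) ->
  (a n - s) * (transfer n).1 <= \prod_(0 <= j < n) growth j.
Proof.
move=> sn; have sn0 : s <= a n by exact: sn.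
have [_ x0 yx] := hyperbolic_lower (fun j jn => sn j (ltnW jn)).
have x0' := lt_le_trans (prod_growth_gt0 n) x0.
apply: le_trans (hyperbolic_covector sn).
apply: (@le_trans _ _ ((kcon n - s * kexp n) * (transfer n).1)); last first.
  by rewrite mulrBl lerD2l lerN2 -mulrA ler_wpM2l// ltW.
rewrite ler_pM2r//.
have an := a0 n; have an1 := a1 n; have p0 : 0 < 1 + a n by rewrite addr_gt0.
rewrite -(ler_pM2r p0) [leRHS]mulrBl kexpE// /kcon divfK ?lt0r_neq0//.
have -> : a n * c + disc n - (a n * c - disc n) = 2 * disc n by ring.
have : a n - s <= disc n.
  have h : 0 <= s * (a n - s) by rewrite mulr_ge0 ?subr_ge0// ltW.
  rewrite -(@ler_pXn2r _ 2) ?nnegrE ?disc_ge0 ?subr_ge0// disc_sqr//; lra.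
move=> h; rewrite [leRHS]mulrC ler_pM ?subr_ge0//; lra.
Qed.

(** The hyperbolic bounds are used before the crossing of [a j] with [s], the
    elliptic ones from time [m.+3] on. The few steps in between, where both
    degenerate, cost bounded factors; [g] measures the distance to the crossing
    on either side. *)
Lemma energy_bounds (m n : nat) (g : R) : (forall j, (j < m.+2)%N -> s <= a j) ->
  a m.+2 < s -> 0 < g -> g <= a m - s -> g <= s - a m.+3 -> (m.+3 <= n)%N ->
  g / (2 * R0) * (\prod_(0 <= j < m.+2) growth j) ^+ 2 <= energy n <=
  4 * R0 ^+ 3 / g ^+ 3 * (\prod_(0 <= j < m.+2) growth j) ^+ 2.
Proof.
move=> sm ams g0 gm gm3 mn; set E := (_ ^+ 2 in X in X <= _ <= _).
have R1 : 1 <= R0.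
  have := a0 0; have a10 := a1 0 => a00.
  by rewrite ler_pdivlMr ?subr_gt0// mul1r; lra.
have RR0 : 0 < R0 by apply: lt_le_trans R1.
have s1 := s_le1.
have am3 : a m.+3 < s by apply: le_lt_trans ams; exact: a_decr.
have am3' := a0 m.+3.
have [e1 e2] := elliptic_comparison am3 mn.
have [y0 x0 yx] := hyperbolic_lower sm.
have [y0' x0' yx'] := hyperbolic_lower (fun j (jm : (j < m)%N) => sm j (leqW (leqW jm))).
have h := @hyperbolic_upper m (fun j jm => sm j (leqW jm)).
have xm := lt_le_trans (prod_growth_gt0 m) x0'.
have pm := prod_growth_gt0 m; have pm2 := prod_growth_gt0 m.+2.
apply/andP; split.
  rewrite mulrAC ler_pdivrMr; last lra.
  have E1 : E <= energy m.+2.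
    rewrite /energy; apply: (@le_trans _ _ ((transfer m.+2).1 ^+ 2)).
      by apply: lerXn2r => //; rewrite nnegrE ltW// (lt_le_trans pm2).
    by rewrite lerDl sqr_ge0.
  have E2 := energy_step_ge m.+2; rewrite -/R0 in E2.
  have E3 : g * energy m.+3 <= 2 * energy n.
    apply: (@le_trans _ _ ((s - a m.+3) * energy m.+3)).
      by rewrite ler_wpM2r// energy_ge0.
    by apply: (le_trans e2); rewrite ler_wpM2r ?energy_ge0//; lra.
  apply: (@le_trans _ _ (g * (R0 * energy m.+3))).
    by rewrite ler_pM2l// (le_trans E1).
  rewrite mulrCA (_ : energy n * (2 * R0) = R0 * (2 * energy n)); last by ring.
  by rewrite ler_pM2l.
have E1 : energy m <= 2 * (transfer m).1 ^+ 2.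
  rewrite /energy mulr_natl mulr2n lerD2l; apply: lerXn2r; rewrite ?nnegrE ?(ltW xm)//.
  by apply: (le_trans yx'); rewrite ler_piMl ?(ltW xm)// kexp_le1// sm.
have E2 : energy m.+3 <= R0 ^+ 3 * energy m.
  apply: (le_trans (energy_step_le m.+2)); rewrite exprS -mulrA ler_pM2l//.
  apply: (le_trans (energy_step_le m.+1)); rewrite exprS -mulrA ler_pM2l//.
  by apply: (le_trans (energy_step_le m)); rewrite expr1.
have E3 : g * energy n <= 2 * energy m.+3.
  apply: (@le_trans _ _ ((s - a m.+3) * energy n)).
    by rewrite ler_wpM2r// energy_ge0.
  by apply: (le_trans e1); rewrite ler_wpM2r ?energy_ge0//; lra.
have E4 : g * (transfer m).1 <= \prod_(0 <= j < m.+2) growth j.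
  apply: (@le_trans _ _ (\prod_(0 <= j < m) growth j)).
    by apply: le_trans h; rewrite ler_wpM2r// ltW.
  rewrite !big_nat_recr//= -mulrA ler_peMr ?(ltW pm)//.
  by rewrite mulr_ege1// growth_ge1// sm.
have E5 : g ^+ 2 * (transfer m).1 ^+ 2 <= E.
  rewrite -exprMn; apply: lerXn2r => //; rewrite nnegrE ?ltW//.
  by rewrite mulr_gt0.
have R3 : 0 < R0 ^+ 3 by rewrite exprn_gt0.
have g3 : 0 < g ^+ 3 by rewrite exprn_gt0.
rewrite mulrAC ler_pdivlMr//.
apply: (@le_trans _ _ (g ^+ 2 * (g * energy n))); first by rewrite exprS; lra.
apply: (@le_trans _ _ (g ^+ 2 * (2 * (R0 ^+ 3 * (2 * (transfer m).1 ^+ 2))))).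
  rewrite ler_pM2l ?exprn_gt0//; apply: (le_trans E3); rewrite ler_pM2l//.
  by apply: (le_trans E2); rewrite ler_pM2l.
have -> : g ^+ 2 * (2 * (R0 ^+ 3 * (2 * (transfer m).1 ^+ 2))) =
   4 * R0 ^+ 3 * (g ^+ 2 * (transfer m).1 ^+ 2) by ring.
by rewrite ler_pM2l// mulr_gt0.
Qed.

End Transfer.

(** * Integrals up to a singular endpoint *)
Section Improper.
Variable R : realType.
Local Notation mu := (@lebesgue_measure R).

Lemma itv0b_bigcup (b : R) : 0 < b ->
  `]0, b]%classic = \bigcup_k `[b / k.+2%:R, b]%classic.
Proof.
move=> b0; apply/seteqP; split => x /=.
  rewrite in_itv/= => /andP[x0 xb].
  exists (Num.truncn (b / x)) => //=; rewrite in_itv/= xb andbT.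
  rewrite ler_pdivrMr// mulrC -ler_pdivrMr//.
  apply/ltW/(lt_le_trans (truncnS_gt _)).
  by rewrite ler_nat.
move=> [k _] /=; rewrite !in_itv/= => /andP[h ->]; rewrite andbT.
by apply: lt_le_trans h; rewrite divr_gt0.
Qed.

Lemma itv0y_bigcup :
  `]0, +oo[%classic = \bigcup_k `[k.+1%:R^-1, +oo[%classic :> set R.
Proof.
apply/seteqP; split => x /=.
  rewrite in_itv/= andbT => x0.
  exists (Num.truncn x^-1) => //=; rewrite in_itv/= andbT.
  rewrite -[leRHS]invrK lef_pV2 ?posrE ?invr_gt0//.
  exact/ltW/truncnS_gt.
move=> [k _] /=; rewrite !in_itv/= !andbT => h.
by apply: lt_le_trans h; rewrite invr_gt0.
Qed.

Lemma cont_gt0_measurable (f : R -> R) (D : set R) : measurable D ->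
  (forall x, D x -> 0 < x) ->
  {in `]0, +oo[, continuous f} -> measurable_fun D f.
Proof.
move=> mD D0 cf.
have H : measurable_fun (`]0, +oo[ : set R) f.
  by apply: open_continuous_measurable_fun => // x; rewrite inE => ?; exact: cf.
by apply: measurable_funS H => // x /D0; rewrite /= in_itv/= andbT.
Qed.

(** The integrand may blow up at [0]: the fundamental theorem is applied on
    [[b / k.+2, b]], and the integrals pass to the limit by monotone
    convergence. *)
Lemma ge0_FTC2_oc (f F : R -> R) (b : R) : 0 < b ->
  (forall x : R, 0 < x -> 0 <= f x) -> {in `]0, +oo[, continuous f} ->
  (forall x : R, 0 < x -> is_derive x 1 F (f x)) -> F x @[x --> (0:R)^'+] --> F 0 ->
  (\int[mu]_(x in `]0%R, b]) (f x)%:E = (F b - F 0)%:E)%E.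
Proof.
move=> b0 f0 cf dF F0.
have cF x : 0 < x -> {for x, continuous F}.
  move=> x0; apply: differentiable_continuous; apply/derivable1_diffP.
  by have /@ex_derive := dF _ x0.
rewrite itv0b_bigcup//.
have h k : (\int[mu]_(x in `[(b / k.+2%:R)%R, b]%classic) (f x)%:E = (F b - F (b / k.+2%:R))%:E)%E.
  have bk : 0 < b / k.+2%:R by rewrite divr_gt0.
  have bkb : b / k.+2%:R < b by rewrite ltr_pdivrMr// ltr_pMr// ltr1n.
  rewrite (@continuous_FTC2 _ f F)//.
  - apply: continuous_in_subspaceT => x; rewrite inE/= in_itv/= => /andP[h _].
    by apply: cf; rewrite in_itv/= andbT (lt_le_trans bk).
  - split.
    + move=> x; rewrite in_itv/= => /andP[h _].
      by have /@ex_derive := dF _ (lt_trans bk h).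
    + by apply: cvg_at_right_filter; exact: cF.
    + by apply: cvg_at_left_filter; exact: cF.
  - move=> x; rewrite in_itv/= => /andP[h _]; rewrite derive1E.
    by have /@derive_val := dF _ (lt_trans bk h).
have H : (\int[mu]_(x in `[(b / i.+2%:R)%R, b]%classic) (f x)%:E @[i --> \oo] -->
   \int[mu]_(x in \bigcup_k `[(b / k.+2%:R)%R, b]%classic) (f x)%:E)%E.
  apply: ge0_nondecreasing_set_cvg_integral => //.
  - apply/nondecreasing_seqP => n; rewrite subsetEset => x/=.
    rewrite !in_itv/= => /andP[h' ->]; rewrite andbT; apply: le_trans h'.
    by rewrite ler_pM2l// lef_pV2 ?posrE// ler_nat.
  - move=> i; apply/measurable_EFinP; apply: cont_gt0_measurable => //=.
    by move=> x/=; rewrite in_itv/= => /andP[h' _]; apply: lt_le_trans h'; rewrite divr_gt0.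
  - move=> i x/=; rewrite in_itv/= => /andP[h' _]; rewrite lee_fin f0//.
    by apply: lt_le_trans h'; rewrite divr_gt0.
rewrite -(cvg_lim _ H)//; apply/cvg_lim => //.
under eq_fun do rewrite h.
apply: cvg_EFin; first by near=> k.
apply: cvgB; first exact: cvg_cst.
move/cvg_at_rightP : F0; apply; split; first by move=> n; rewrite divr_gt0.
rewrite -(mulr0 b); apply: cvgM; first exact: cvg_cst.
by have := @cvg_harmonic R; rewrite -(cvg_shiftS (@harmonic R)).
Unshelve. all: by end_near. Qed.

(** The half-line is exhausted by the intervals [[k.+1%:R^-1, +oo[], on which
    the integrand has no singularity and can be substituted. *)
Lemma scale_integral (f : R -> R) (l : R) : 0 < l ->
  (forall x : R, 0 < x -> 0 <= f x) -> {in `]0, +oo[, continuous f} ->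
  (\int[mu]_(x in `]0%R, +oo[) (f (l * x) * l)%:E = \int[mu]_(x in `]0%R, +oo[) (f x)%:E)%E.
Proof.
move=> l0 f0 cf.
have cfl : {in `]0, +oo[, continuous (fun x => f (l * x))}.
  move=> x; rewrite in_itv/= andbT => x0.
  apply: (@continuous_comp _ _ _ (fun x => l * x) f).
    exact: mulrl_continuous.
  by apply: cf; rewrite in_itv/= andbT mulr_gt0.
rewrite itv0y_bigcup.
have H1 : (\int[mu]_(x in `[(i.+1%:R^-1)%R, +oo[%classic) (f (l * x) * l)%:E @[i --> \oo] -->
   \int[mu]_(x in \bigcup_k `[(k.+1%:R^-1)%R, +oo[%classic) (f (l * x) * l)%:E)%E.
  apply: ge0_nondecreasing_set_cvg_integral => //.
  - apply/nondecreasing_seqP => n; rewrite subsetEset => x/=.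
    rewrite !in_itv/= !andbT; apply: le_trans.
    by rewrite lef_pV2 ?posrE// ler_nat.
  - move=> i; apply/measurable_EFinP; apply: measurable_funM => //.
    apply: cont_gt0_measurable => //.
    by move=> x/=; rewrite in_itv/= andbT; apply: lt_le_trans.
  - move=> i x/=; rewrite in_itv/= andbT => h; rewrite lee_fin mulr_ge0 ?(ltW l0)//.
    by apply: f0; rewrite mulr_gt0//; apply: lt_le_trans h; rewrite invr_gt0.
have lb : `]0, +oo[%classic = \bigcup_k `[(l / k.+1%:R)%R, +oo[%classic.
  apply/seteqP; split => x /=.
    rewrite in_itv/= andbT => x0.
    have : `]0, +oo[%classic (x / l) by rewrite /= in_itv/= andbT divr_gt0.
    rewrite itv0y_bigcup => -[k _]; rewrite /= in_itv/= andbT ler_pdivlMr// => h.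
    by exists k => //=; rewrite in_itv/= andbT mulrC.
  move=> [k _] /=; rewrite !in_itv/= !andbT => h.
  by apply: lt_le_trans h; rewrite divr_gt0.
have H2 : (\int[mu]_(x in `[(l / i.+1%:R)%R, +oo[%classic) (f x)%:E @[i --> \oo] -->
   \int[mu]_(x in \bigcup_k `[(l / k.+1%:R)%R, +oo[%classic) (f x)%:E)%E.
  apply: ge0_nondecreasing_set_cvg_integral => //.
  - apply/nondecreasing_seqP => n; rewrite subsetEset => x/=.
    rewrite !in_itv/= !andbT; apply: le_trans.
    by rewrite ler_pM2l// lef_pV2 ?posrE// ler_nat.
  - move=> i; apply/measurable_EFinP; apply: cont_gt0_measurable => //=.
    by move=> x/=; rewrite in_itv/= andbT; apply: lt_le_trans; rewrite divr_gt0.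
  - move=> i x/=; rewrite in_itv/= andbT => h; rewrite lee_fin.
    by apply: f0; apply: lt_le_trans h; rewrite divr_gt0.
have D : derive1 (fun x : R => l * x) = cst l.
  by apply/funext => x; rewrite derive1E deriveM// derive_cst derive_id scaler0 addr0 /GRing.scale/= mulr1.
have E k : (\int[mu]_(x in `[(l / k.+1%:R)%R, +oo[%classic) (f x)%:E =
   \int[mu]_(x in `[(k.+1%:R^-1)%R, +oo[%classic) (f (l * x) * l)%:E)%E.
  rewrite (@increasing_ge0_integration_by_substitutiony _ (fun x => l * x) f) ?D//.
  - by move=> x y _ _; rewrite ltr_pM2l.
  - by move=> x _; exact: cst_continuous.
  - exact: is_cvg_cst.
  - exact: is_cvg_cst.
  - split; first by move=> x _; apply: derivableM.
    by apply: cvg_at_right_filter; exact: mulrl_continuous.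
  - by apply: gt0_cvgMry.
  - apply: continuous_in_subspaceT => x; rewrite inE/= in_itv/= andbT => h.
    by apply: cf; rewrite in_itv/= andbT; apply: lt_le_trans h; rewrite divr_gt0.
  - move=> x; rewrite in_itv/= andbT => h.
    by apply: f0; apply: lt_trans h; rewrite divr_gt0.
move: H2; under eq_fun do rewrite E; move=> H2.
rewrite -itv0y_bigcup [in RHS]lb -(cvg_lim _ H2)// itv0y_bigcup.
by apply/esym; rewrite (cvg_lim _ H1).
Qed.
End Improper.

(** * Euler's Gamma and Beta integrals *)

Section GammaIntegral.
Variable R : realType.
Local Notation mu := (@lebesgue_measure R).

Lemma powR_continuous (y : R) : {in `]0, +oo[, continuous (fun t : R => t `^ y)}.
Proof.
move=> t t0; apply: differentiable_continuous; apply/derivable1_diffP.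
exact: derivable_powR.
Qed.

Lemma gamma_integrand_continuous (y l : R) :
  {in `]0, +oo[, continuous (fun t : R => t `^ y * expR (- (l * t)))}.
Proof.
move=> t t0.
apply: (@continuousM R R (fun t => t `^ y) (fun t => expR (- (l * t)))).
  exact: powR_continuous.
apply: (@continuous_comp _ _ _ (fun t => - (l * t)) expR).
  by apply: continuousN; exact: mulrl_continuous.
exact: continuous_expR.
Qed.

(** The extended-real version allows Tonelli's theorem to be used before the
    finiteness of the integral is known. *)
Definition eGamma (x : R) : \bar R :=
  (\int[mu]_(t in `]0%R, +oo[) (t `^ (x - 1) * expR (- t))%:E)%E.

Lemma eGamma_ge0 x : (0 <= eGamma x)%E.
Proof. by apply: integral_ge0 => t _; rewrite lee_fin mulr_ge0 ?powR_ge0 ?expR_ge0. Qed.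

Lemma GammaE x : Gamma x = fine (eGamma x).
Proof. by []. Qed.

Lemma eGamma_scale x l : 0 < l ->
  (\int[mu]_(t in `]0%R, +oo[) (t `^ (x - 1) * expR (- (l * t)))%:E =
   eGamma x * (l `^ (- x))%:E)%E.
Proof.
move=> l0; rewrite /eGamma -(@scale_integral _ (fun t => t `^ (x - 1) * expR (- t)) l)//; last 2 first.
- by move=> t t0; rewrite mulr_ge0 ?powR_ge0 ?expR_ge0.
- move=> t t0.
  have := @gamma_integrand_continuous (x - 1) 1 t t0.
  by under eq_fun do rewrite mul1r.
rewrite muleC -ge0_integralZl//; last 3 first.
- apply/measurable_EFinP; apply: cont_gt0_measurable => //=.
    by move=> t; rewrite in_itv/= andbT.
  move=> t t0.
  apply: (@continuousM R R (fun t => (l * t) `^ (x - 1) * expR (- (l * t))) (cst l)); last exact: cst_continuous.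
  have H : {in `]0, +oo[, continuous (fun t : R => t `^ (x-1) * expR (- t))}.
    move=> u u0; have := @gamma_integrand_continuous (x - 1) 1 u u0.
    by under eq_fun do rewrite mul1r.
  apply: (@continuous_comp _ _ _ (fun t => l * t) (fun t : R => t `^ (x-1) * expR (- t))).
    exact: mulrl_continuous.
  by apply: H; move: t0; rewrite !in_itv/= !andbT => t0; rewrite mulr_gt0.
- by move=> t _; rewrite lee_fin !mulr_ge0 ?powR_ge0 ?expR_ge0 ?ltW.
- by rewrite lee_fin powR_ge0.
apply: eq_integral => t; rewrite inE/= in_itv/= andbT => t0.
rewrite -EFinM; congr EFin.
rewrite powRM ?ltW//.
transitivity ((l `^ (- x) * l `^ (x - 1) * l) * (t `^ (x - 1) * expR (- (l * t)))); last by ring.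
rewrite -powRD; last by rewrite lt0r_neq0// implybT.
have -> : - x + (x - 1) = -1 by ring.
by rewrite powR_inv1 ?ltW// mulVf ?lt0r_neq0// mul1r.
Qed.

Let D : set R := `]0, +oo[%classic.

(** Write [(q + sg) `^ (- A) * eGamma A] as the integral of
    [t `^ (A - 1) * expR (- (t * (q + sg)))] and exchange the integrals. *)
Lemma beta_tonelli (x A sg : R) : 0 < sg ->
  ((\int[mu]_(q in `]0%R, +oo[) (q `^ (x - 1) * (q + sg) `^ (- A))%:E) * eGamma A =
   eGamma x * eGamma (A - x) * (sg `^ (- (A - x)))%:E)%E.
Proof.
move=> sg0.
pose f (z : R * R) : \bar R :=
  (\1_D z.1 * \1_D z.2 * (z.1 `^ (x - 1) * (z.2 `^ (A - 1) * expR (- (z.2 * (z.1 + sg))))))%:E.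
have mD : measurable D by exact: measurable_itv.
have mf : measurable_fun setT f.
  apply/measurable_EFinP; apply: measurable_funM.
    by apply: measurable_funM; apply: measurableT_comp => //.
  apply: measurable_funM.
    exact: (measurableT_comp (measurable_powR _) measurable_fst).
  apply: measurable_funM.
    exact: (measurableT_comp (measurable_powR _) measurable_snd).
  apply: measurableT_comp => //; apply: measurableT_comp => //.
  apply: measurable_funM => //; exact: measurable_funD.
have f0 z : (0 <= f z)%E.
  by rewrite lee_fin !mulr_ge0 ?powR_ge0 ?expR_ge0.
have mpow y : measurable_fun D (fun t : R => t `^ y).
  by apply: measurable_funTS; exact: measurable_powR.
have mexp y l : measurable_fun D (fun t : R => (t `^ y * expR (- (l * t)))%:E).
  apply/measurable_EFinP; apply: measurable_funM; first exact: mpow.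
  by apply: measurable_funTS; apply: measurableT_comp => //; exact: measurableT_comp.
have H := @fubini_tonelli _ _ _ _ R mu mu f mf f0.
transitivity (\int[mu]_q \int[mu]_t f (q, t))%E.
  have [k kE] : exists k, k = eGamma A by exists (eGamma A).
  have k0 : (0 <= k)%E by rewrite kE eGamma_ge0.
  have mg : measurable_fun D (fun q => (q `^ (x - 1) * (q + sg) `^ (- A))%:E).
    apply/measurable_EFinP; apply: measurable_funM; first exact: mpow.
    apply: measurable_funTS; apply: (measurableT_comp (measurable_powR _)).
    exact: measurable_funD.
  rewrite -kE muleC.
  rewrite -(@ge0_integralZl _ _ _ mu D mD _ mg k _ k0); last first.
    by move=> q _; rewrite lee_fin mulr_ge0 ?powR_ge0.
  rewrite integral_mkcond; apply: eq_integral => q _; rewrite patchE.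
  case: ifPn => qD; last first.
    apply/esym/integral0_eq => t _; rewrite /f/= indicE (negbTE qD).
    by rewrite !mul0r.
  have q0 : 0 < q by move: qD; rewrite inE /D/= in_itv/= andbT.
  rewrite EFinM muleCA kE.
  rewrite -eGamma_scale; last by rewrite addr_gt0.
  rewrite -(@ge0_integralZl _ _ _ mu D mD _ (mexp _ _)); last 2 first.
  - by move=> t _; rewrite lee_fin mulr_ge0 ?powR_ge0 ?expR_ge0.
  - by rewrite lee_fin powR_ge0.
  rewrite integral_mkcond; apply: eq_integral => t _; rewrite patchE /f/= !indicE qD mul1r.
  case: ifPn => _; last by rewrite !mul0r.
  by rewrite mul1r -EFinM [(q + sg) * t]mulrC.
rewrite {}H -muleA -eGamma_scale//.
rewrite -(@ge0_integralZl _ _ _ mu D mD _ (mexp _ _)); last 2 first.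
- by move=> t _; rewrite lee_fin mulr_ge0 ?powR_ge0 ?expR_ge0.
- exact: eGamma_ge0.
rewrite [in RHS]integral_mkcond; apply: eq_integral => t _; rewrite patchE.
case: ifPn => tD; last first.
  apply/integral0_eq => q _; rewrite /f/= [X in _ * X * _]indicE (negbTE tD).
  by rewrite mulr0 mul0r.
have t0 : 0 < t by move: tD; rewrite inE /D/= in_itv/= andbT.
transitivity ((t `^ (A - 1) * expR (- (sg * t)))%:E * (eGamma x * (t `^ (- x))%:E))%E; last first.
  rewrite muleCA; congr (_ * _)%E; rewrite -EFinM; congr EFin.
  rewrite mulrAC -powRD; last by rewrite lt0r_neq0// implybT.
  by congr (t `^ _ * _); ring.
rewrite -eGamma_scale// -(@ge0_integralZl _ _ _ mu D mD _ (mexp _ _)); last 2 first.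
- by move=> q _; rewrite lee_fin mulr_ge0 ?powR_ge0 ?expR_ge0.
- by rewrite lee_fin mulr_ge0 ?powR_ge0 ?expR_ge0.
rewrite [in RHS]integral_mkcond; apply: eq_integral => q _; rewrite patchE /f/= !indicE tD.
case: ifPn => _; last by rewrite !mul0r.
rewrite !mul1r -EFinM; congr EFin.
rewrite mulrDr opprD expRD; rewrite [t * sg]mulrC; ring.
Qed.

Lemma eGamma1 : eGamma 1 = 1%E.
Proof.
rewrite /eGamma; under eq_integral do rewrite subrr powRr0 mul1r.
rewrite integral_itv_obnd_cbnd; last by apply/measurable_EFinP; apply: measurableT_comp.
rewrite (@ge0_continuous_FTC2y _ _ (fun t => - expR (- t)) 0 0)//.
- by rewrite oppr0 expR0 -EFinB sub0r opprK.
- apply: continuous_subspaceT => t; apply: continuous_comp; last exact: continuous_expR.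
  exact: opp_continuous.
- by rewrite -[X in _ --> X]oppr0; apply: cvgN; exact: cvgr_expR.
- apply: cvg_at_right_filter; apply: cvgN; apply: continuous_comp.
    exact: opp_continuous.
  exact: continuous_expR.
- by move=> t ?; rewrite derive1E derive_val; ring.
Qed.
End GammaIntegral.

Section GammaValues.
Variable R : realType.
Local Notation mu := (@lebesgue_measure R).

Lemma powRN_anti (x u v : R) : 0 <= x -> 0 < u -> u <= v -> v `^ (- x) <= u `^ (- x).
Proof.
move=> x0 u0 uv; have v0 := lt_le_trans u0 uv.
rewrite !powRN lef_pV2 ?posrE ?powR_gt0//.
by apply: ge0_ler_powR => //; rewrite nnegrE ltW.
Qed.

Lemma powRN_cvgy (x : R) : 0 < x -> (q + 1) `^ (- x) @[q --> +oo] --> (0:R).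
Proof.
move=> x0; apply/cvgrPdist_le => e e0; near=> q.
rewrite sub0r normrN ger0_norm ?powR_ge0//.
have p0 : 0 < e `^ (- x^-1) by rewrite powR_gt0.
apply: (@le_trans _ _ ((e `^ (- x^-1)) `^ (- x))).
  apply: powRN_anti => //; first exact: ltW.
  near: q; exists (e `^ (- x^-1)); split; first exact: num_real.
  by move=> q /= h; rewrite ltW// (lt_trans h)// ltrDl.
by rewrite -powRrM mulrNN mulVf ?gt_eqF// powRr1// ltW.
Unshelve. all: by end_near. Qed.

Lemma integral_powR_shift (x : R) : 0 < x ->
  (\int[mu]_(q in `]0%R, +oo[) ((q + 1) `^ (- (x + 1)))%:E = (x^-1)%:E)%E.
Proof.
move=> x0.
have m1 : measurable_fun setT (fun q : R => (q + 1) `^ (- (x + 1))).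
  apply: (measurableT_comp (measurable_powR _)); exact: measurable_funD.
have d (q : R) : 0 <= q -> is_derive q 1 (fun q => - (q + 1) `^ (- x) / x) ((q + 1) `^ (- (x + 1))).
  move=> q0; have q1 : 0 < q + 1 by rewrite ltr_wpDl.
  have d1 : is_derive (q + 1) 1 (fun u : R => u `^ (- x)) (- x * (q + 1) `^ (- x - 1)).
    split; first by apply: derivable_powR; rewrite in_itv/= andbT.
    by rewrite -derive1E powR_derive1// in_itv/= andbT.
  have dq : is_derive q (1:R) (fun q => q + 1 : R) 1.
    by apply: is_derive_eq; rewrite addr0.
  have d2 := @is_derive1_comp R (fun u : R => u `^ (- x)) (fun q => q + 1) q _ _ d1 dq.
  have d3 : is_derive q 1 (fun q : R => - (q + 1) `^ (- x) / x) (- ((- x * (q + 1) `^ (- x - 1)) * 1) / x).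
    have -> : (fun q : R => - (q + 1) `^ (- x) / x) = (- x^-1) \*: ((fun u : R => u `^ (- x)) \o (fun q => q + 1)).
      by apply/funext => u /=; rewrite /GRing.scale/= mulNr mulrC -mulNr.
    apply: (is_derive_eq (is_deriveZ (- x^-1) d2)).
    by rewrite /GRing.scale/=; ring.
  apply: (is_derive_eq d3).
  have -> : - (x + 1) = - x - 1 by ring.
  by field; rewrite lt0r_neq0.
rewrite integral_itv_obnd_cbnd; last by apply/measurable_EFinP; apply: measurable_funTS.
rewrite (@ge0_continuous_FTC2y _ _ (fun q : R => - (q + 1) `^ (- x) / x) 0 0)//.
- by rewrite -EFinB [0 + 1]add0r powR1 sub0r mulNr opprK mul1r.
- by move=> q ?; exact: powR_ge0.
- apply: continuous_in_subspaceT => q; rewrite inE/= in_itv/= andbT => q0.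
  apply: (@continuous_comp R R R (fun q : R => q + 1) (fun u : R => u `^ (- (x + 1))) q).
    by apply: (@continuousD R R R id (cst 1) q); [exact: cvg_id|exact: cst_continuous].
  by apply: powR_continuous; rewrite in_itv/= andbT ltr_wpDl.
- have H : (- (q + 1) `^ (- x) / x) @[q --> +oo] --> (- 0 / x : R).
    apply: cvgM; last exact: cvg_cst.
    by apply: cvgN; exact: powRN_cvgy.
  by rewrite oppr0 mul0r in H.
- by move=> q q0; have /@ex_derive := d q (ltW q0).
- have C : {for 0, continuous (fun q : R => - (q + 1) `^ (- x) / x)}.
    apply: differentiable_continuous; apply/derivable1_diffP.
    by have /@ex_derive := d 0 (lexx _).
  exact: cvg_at_right_filter.
- by move=> q; rewrite in_itv/= andbT => q0; rewrite derive1E; have /@derive_val := d q (ltW q0).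
Qed.

(** The case [x = 1] of [beta_tonelli], whose integrand has an elementary
    primitive. *)
Lemma eGammaS (x : R) : 0 < x -> eGamma (x + 1) = (x%:E * eGamma x)%E.
Proof.
move=> x0; have := @beta_tonelli R 1 (x + 1) 1 ltr01.
under eq_integral do rewrite subrr powRr0 mul1r.
rewrite integral_powR_shift// eGamma1 mul1e addrK powR1 mule1 => <-.
by rewrite muleA -EFinM divff ?mul1e// gt_eqF.
Qed.

Lemma eGamma_nat (n : nat) : (eGamma (n.+1%:R : R) < +oo)%E.
Proof.
elim: n => [|n ih]; first by rewrite eGamma1 ltry.
by rewrite -natr1 eGammaS// lte_mul_pinfty.
Qed.

(** For [1 <= x] the integrand is at most the sum of those of [1] and of a
    larger integer, for which the functional equation gives finiteness. *)
Lemma eGamma_ge1_lty (x : R) : 1 <= x -> (eGamma x < +oo)%E.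
Proof.
move=> x1; set n := (Num.truncn x).
have xn : x <= n.+1%:R by exact/ltW/truncnS_gt.
apply: (@le_lt_trans _ _ (eGamma 1 + eGamma n.+1%:R)%E); last first.
  apply: lte_add_pinfty; last exact: eGamma_nat.
  by rewrite eGamma1 ltry.
have mg y : measurable_fun (`]0, +oo[ : set R) (fun t => (t `^ (y - 1) * expR (- t))%:E).
  apply/measurable_EFinP; apply: cont_gt0_measurable => //=.
    by move=> t; rewrite in_itv/= andbT.
  move=> t t0; have := @gamma_integrand_continuous R (y - 1) 1 t t0.
  by under eq_fun do rewrite mul1r.
have g0 y t : (0 <= (t `^ (y - 1) * expR (- t))%:E :> \bar R)%E.
  by rewrite lee_fin mulr_ge0 ?powR_ge0 ?expR_ge0.
rewrite /eGamma -ge0_integralD//; last 2 first.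
- exact: mg.
- exact: mg.
apply: ge0_le_integral => //.
- exact: mg.
- by apply: emeasurable_funD; exact: mg.
move=> t _; rewrite -EFinD lee_fin -mulrDl ler_wpM2r ?expR_ge0// subrr powRr0.
have [t1|t1] := leP t 1.
  case: (leP t 0) => [t0|t0].
    move: t0; rewrite le_eqVlt => /predU1P[->|t0]; last by rewrite lt0_powR1// lerDl powR_ge0.
    case: (eqVneq (x - 1) 0) => [->|x0]; first by rewrite powRr0 lerDl powR_ge0.
    by rewrite powR0// addr_ge0 ?powR_ge0.
  apply: (@le_trans _ _ (t `^ 0)); last by rewrite powRr0 lerDl powR_ge0.
  by rewrite ger_powR ?t0// subr_ge0.
apply: (@le_trans _ _ (t `^ (n.+1%:R - 1))); last by rewrite lerDr.
by rewrite ler_powR ?(ltW t1)// lerD2r.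
Qed.

Lemma eGamma_lty (x : R) : 0 < x -> (eGamma x < +oo)%E.
Proof.
move=> x0; have := @eGamma_ge1_lty (x + 1); rewrite eGammaS// lerDr ltW// => /(_ isT).
have := eGamma_ge0 x; case: (eGamma x) => [r _ _| |]//=; first by rewrite ltry.
by rewrite gt0_muley.
Qed.

Lemma eGammaE (x : R) : 0 < x -> eGamma x = (Gamma x)%:E.
Proof.
by move=> x0; rewrite GammaE fineK// ge0_fin_numE ?eGamma_ge0// eGamma_lty.
Qed.

Lemma Gamma_gt0 (x : R) : 0 < x -> 0 < Gamma x.
Proof.
move=> x0; rewrite -lte_fin -eGammaE//.
pose m : R := Num.min 1 (2 `^ (x - 1)) * expR (- 2).
have m0 : 0 < m by rewrite mulr_gt0 ?expR_gt0// lt_min ltr01 powR_gt0.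
have mg : measurable_fun (`]0, +oo[ : set R) (fun t => (t `^ (x - 1) * expR (- t))%:E).
  apply/measurable_EFinP; apply: cont_gt0_measurable => //=.
    by move=> t; rewrite in_itv/= andbT.
  move=> t t0; have := @gamma_integrand_continuous R (x - 1) 1 t t0.
  by under eq_fun do rewrite mul1r.
have sub : (`[1, 2] : set R) `<=` `]0, +oo[.
  by move=> t/=; rewrite !in_itv/= andbT => /andP[t1 _]; rewrite (lt_le_trans ltr01).
apply: (@lt_le_trans _ _ (\int[mu]_(t in `[1%R, 2%R]) m%:E)%E).
  rewrite integral_cst//= lebesgue_measure_itv/= lte_fin ltrDl ltr01.
  by rewrite -EFinB -EFinM lte_fin mulr_gt0// subr_gt0 ltrDl.
apply: (@le_trans _ _ (\int[mu]_(t in `[1%R, 2%R]) (t `^ (x - 1) * expR (- t))%:E)%E).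
  apply: ge0_le_integral => //.
  - by move=> t _; rewrite lee_fin ltW.
  - exact: measurable_funS mg.
  move=> t; rewrite /= in_itv/= => /andP[t1 t2].
  rewrite lee_fin /m ler_pM ?expR_ge0//.
  - rewrite ge_min; have [x1|x1] := leP 1 x.
      by rewrite -[leLHS](powRr0 t) ler_powR// subr_ge0.
    apply/orP; right; rewrite -[x - 1]opprK; apply: powRN_anti => //.
      by rewrite opprB subr_ge0 ltW.
    exact: lt_le_trans t1.
  - by rewrite ler_expR lerN2.
apply: ge0_subset_integral => //.
by move=> t _; rewrite lee_fin mulr_ge0 ?powR_ge0 ?expR_ge0.
Qed.

Local Opaque Gamma eGamma.

Lemma GammaS (x : R) : 0 < x -> Gamma (x + 1) = x * Gamma x.
Proof.
move=> x0; apply: EFin_inj; rewrite EFinM -!eGammaE ?eGammaS//.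
by rewrite addr_gt0.
Qed.

Lemma beta_integral (x A sg : R) : 0 < sg -> 0 < x < A ->
  (\int[mu]_(q in `]0%R, +oo[) (q `^ (x - 1) * (q + sg) `^ (- A))%:E =
   (Gamma x * Gamma (A - x) / Gamma A * sg `^ (- (A - x)))%:E)%E.
Proof.
move=> sg0 /andP[x0 xA]; have A0 := lt_trans x0 xA.
have := @beta_tonelli R x A sg sg0.
rewrite !eGammaE ?subr_gt0// => /(congr1 (fun z => z * ((Gamma A)^-1)%:E)%E).
have GA := Gamma_gt0 A0.
rewrite -muleA -EFinM (divff (lt0r_neq0 GA)) mule1 => ->.
rewrite -!EFinM; congr EFin.
by move: (Gamma x) (Gamma (A - x)) (Gamma A)^-1 => u v t; ring.
Qed.

Definition falling (b : R) (n : nat) : R := \prod_(i < n) (b - i%:R).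

Lemma fallingSl b n : falling b n.+1 = b * falling (b - 1) n.
Proof.
rewrite /falling big_ord_recl subr0; congr (_ * _).
by apply: eq_bigr => i _; rewrite /= /bump/= natrD opprD addrA.
Qed.

Lemma fallingSr b n : falling b n.+1 = falling b n * (b - n%:R).
Proof. by rewrite /falling big_ord_recr. Qed.

Lemma Gamma_falling (b : R) (m : nat) : m%:R < b ->
  Gamma b = falling (b - 1) m * Gamma (b - m%:R).
Proof.
elim: m b => [|m ih] b mb; first by rewrite /falling big_ord0 mul1r subr0.
rewrite fallingSl -mulrA.
have b1 : m%:R < b - 1 by rewrite ltrBrDr natr1.
rewrite -[in LHS](subrK 1 b) GammaS; last by apply: le_lt_trans b1.
have e : b - 1 - m%:R = b - m.+1%:R by rewrite -natr1; ring.
by rewrite (ih _ b1) e mulrA.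
Qed.

(** The left side comes from the [n]-th coefficient of the binomial series of
    exponent [b], the right side is the sum that defines the coefficients of the
    expansion of the density. In the induction the terms [0 < l] form the same
    sum for [b - 1] and [n - 1]. *)
Lemma Gamma_sum_identity (b : R) (n : nat) : n%:R < b ->
  falling b n / n`!%:R * Gamma (b - n%:R) =
  \sum_(0 <= l < n.+1) Gamma (b - l%:R) / (n - l)`!%:R.
Proof.
elim: n b => [|n ih] b nb.
  by rewrite big_nat1 /falling big_ord0 subr0 subnn fact0 !divr1 mul1r.
have b1 : n%:R < b - 1 by rewrite ltrBrDr natr1.
have e : b - 1 - n%:R = b - n.+1%:R by rewrite -natr1; ring.
rewrite big_nat_recl// subr0 subn0.
rewrite (eq_big_nat _ _ (F2 := fun l => Gamma (b - 1 - l%:R) / (n - l)`!%:R)); last first.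
  move=> l _; have e' : b - l.+1%:R = b - 1 - l%:R by rewrite -natr1; ring.
  by rewrite subSS e'.
rewrite -ih// e (Gamma_falling nb) fallingSl fallingSr e.
rewrite factS natrM -natr1.
have f0 : n`!%:R != 0 :> R by rewrite pnatr_eq0 -lt0n fact_gt0.
have n0 : n%:R + 1 != 0 :> R by rewrite natr1 pnatr_eq0.
set G := Gamma _; set F := falling _ _.
by field; rewrite f0 n0.
Qed.

End GammaValues.

(** * The binomial series, the weight of arsinh, and counting *)
Section BinomialTaylor.
Variable R : realType.

Lemma is_derive_addl (x u : R) : is_derive u 1 (fun q => x + q) 1.
Proof.
have -> : (fun q => x + q) = (fun q => q + x) by apply/funext => q; rewrite addrC.
by apply: is_derive_eq; rewrite addr0.
Qed.

Lemma deriv_taylor_poly (b : R) (L : nat) :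
  (\poly_(i < L.+1) (falling b i / i`!%:R))^`() =
  b *: \poly_(i < L) (falling (b - 1) i / i`!%:R).
Proof.
apply/polyP => i; rewrite coef_deriv coefZ !coef_poly ltnS.
case: ltnP => _; last by rewrite mul0rn mulr0.
rewrite fallingSl factS natrM -[_ *+ i.+1]mulr_natr.
have f0 : i`!%:R != 0 :> R by rewrite pnatr_eq0 -lt0n fact_gt0.
have i0 : i.+1%:R != 0 :> R by rewrite pnatr_eq0.
set F := falling _ _; move: f0 i0; move: (i`!%:R) (i.+1%:R) => u v u0 v0.
by field; rewrite u0 v0.
Qed.

Lemma is_derive_powR1D (b u : R) : -1 < u ->
  is_derive u 1 (fun u => (1 + u) `^ b) (b * (1 + u) `^ (b - 1)).
Proof.
move=> u1; have u0 : 0 < 1 + u by rewrite -ltrBlDl sub0r.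
have d1 : is_derive (1 + u) 1 (fun u : R => u `^ b) (b * (1 + u) `^ (b - 1)).
  split; first by apply: derivable_powR; rewrite in_itv/= andbT.
  by rewrite -derive1E powR_derive1// in_itv/= andbT.
have dq := is_derive_addl 1 u.
have d2 := @is_derive1_comp R (fun u : R => u `^ b) (fun q => 1 + q) u _ _ d1 dq.
by apply: (is_derive_eq d2); rewrite mulr1.
Qed.

(** The binomial series: by induction on the order, since differentiating the
    remainder lowers both the exponent and the order by one. *)
Lemma binomial_taylor (L : nat) (b V : R) : 0 <= V ->
  exists2 C, 0 <= C & forall y, 0 <= y <= V ->
  `|(1 + y) `^ b - \sum_(i < L) falling b i / i`!%:R * y ^+ i| <= C * y ^+ L.
Proof.
move=> V0; elim: L b => [|L ih] b.
  exists ((1 + V) `^ `|b|); first exact: powR_ge0.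
  move=> y /andP[y0 yV]; rewrite big_ord0 subr0 expr0 mulr1 ger0_norm ?powR_ge0//.
  apply: (@le_trans _ _ ((1 + y) `^ `|b|)).
    by rewrite ler_powR ?lerDl// ler_norm.
  have p1 : 0 <= 1 + y by rewrite addr_ge0.
  have p2 : 0 <= 1 + V by rewrite addr_ge0.
  by apply: ge0_ler_powR; rewrite ?nnegrE// lerD2l.
have [C C0 hC] := ih (b - 1).
exists (`|b| * C); first by rewrite mulr_ge0.
move=> y /andP[y0 yV].
pose f u : R := (1 + u) `^ b - (\poly_(i < L.+1) (falling b i / i`!%:R)).[u].
pose df u : R := b * ((1 + u) `^ (b - 1) - \sum_(i < L) falling (b - 1) i / i`!%:R * u ^+ i).
have fd (u : R) : 0 <= u -> is_derive u 1 f (df u).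
  move=> u0; rewrite /f /df -(horner_poly L (fun i => falling (b - 1) i / i`!%:R) u) mulrBr -hornerZ -deriv_taylor_poly.
  apply: is_deriveB.
  by apply: is_derive_powR1D; apply: lt_le_trans u0; rewrite ltrN10.
have f00 : f 0 = 0.
  rewrite /f horner_poly addr0 powR1 big_ord_recl big1 ?addr0.
    by rewrite expr0 /falling big_ord0 fact0 divr1 mulr1 subrr.
  by move=> i _; rewrite expr0n mulr0.
have -> : (1 + y) `^ b - \sum_(i < L.+1) falling b i / i`!%:R * y ^+ i = f y - f 0.
  by rewrite f00 subr0 /f horner_poly.
have [||c + ->] := @MVT_segment _ f df 0 y y0.
- by move=> u; rewrite in_itv/= => /andP[u0 _]; apply: fd; exact: ltW.
- apply: derivable_within_continuous => u; rewrite in_itv/= => /andP[u0 _].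
  by have /@ex_derive := fd _ u0.
rewrite in_itv/= => /andP[c0 cy]; rewrite subr0 normrM (ger0_norm y0) exprSr mulrA.
rewrite ler_wpM2r// /df normrM -mulrA ler_wpM2l//.
apply: (le_trans (hC c _)); first by rewrite c0 (le_trans cy).
by rewrite ler_wpM2l// lerXn2r.
Qed.

End BinomialTaylor.

Section Arsinh.
Variable R : realType.
Local Notation mu := (@lebesgue_measure R).

(** The derivative of [fun q => 2 * arsinh (sqrt q)]. *)
Definition arsinh_weight (q : R) : R := (Num.sqrt q * Num.sqrt (1 + q))^-1.

Lemma arsinh_weight_continuous : {in `]0, +oo[, continuous arsinh_weight}.
Proof.
move=> q; rewrite in_itv/= andbT => q0.
have q1 : 0 < 1 + q by rewrite addr_gt0.
apply: (@continuousV R R (fun q => Num.sqrt q * Num.sqrt (1 + q)) q).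
  by rewrite mulf_neq0// gt_eqF// sqrtr_gt0.
apply: (@continuousM R R Num.sqrt (fun q => Num.sqrt (1 + q)) q).
  exact: sqrt_continuous.
apply: (@continuous_comp R R R (fun q => 1 + q) Num.sqrt q).
  by apply: (@continuousD R R R (cst 1) id q); [exact: cst_continuous|exact: cvg_id].
exact: sqrt_continuous.
Qed.

Lemma arsinh_weight_ge0 q : 0 <= arsinh_weight q.
Proof. by rewrite invr_ge0 mulr_ge0// sqrtr_ge0. Qed.

Lemma integral_arsinh_weight (b : R) : 0 < b ->
  (\int[mu]_(q in `]0%R, b]) (arsinh_weight q)%:E =
   (2 * ln (Num.sqrt b + Num.sqrt (1 + b)))%:E)%E.
Proof.
move=> b0; pose F q : R := 2 * ln (Num.sqrt q + Num.sqrt (1 + q)).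
have F0 : F 0 = 0 by rewrite /F sqrtr0 add0r addr0 sqrtr1 ln1 mulr0.
transitivity ((F b - F 0)%:E); last by rewrite F0 subr0.
apply: ge0_FTC2_oc => //.
- by move=> q _; exact: arsinh_weight_ge0.
- exact: arsinh_weight_continuous.
- move=> q q0; have q1 : 0 < 1 + q by rewrite addr_gt0.
  have s0 : 0 < Num.sqrt q by rewrite sqrtr_gt0.
  have s1 : 0 < Num.sqrt (1 + q) by rewrite sqrtr_gt0.
  have dq := is_derive_addl 1 q.
  have d1 := @is_derive1_comp R Num.sqrt (fun q => 1 + q) q _ _ (is_derive1_sqrt q1) dq.
  have d2 := is_deriveD (is_derive1_sqrt q0) d1.
  have p : 0 < Num.sqrt q + Num.sqrt (1 + q) by rewrite addr_gt0.
  have d3 := @is_derive1_comp R (@ln R) (fun q => Num.sqrt q + Num.sqrt (1 + q)) q _ _ (is_derive1_ln p) d2.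
  apply: (is_derive_eq (is_deriveZ 2 d3)).
  rewrite /GRing.scale/= /arsinh_weight; field.
  by rewrite !gt_eqF.
- suff CF : {for 0, continuous F} by exact: cvg_at_right_filter.
  have c0 : {for 0, continuous (fun q : R => Num.sqrt q + Num.sqrt (1 + q))}.
    apply: (@continuousD R R R Num.sqrt (fun q => Num.sqrt (1 + q)) 0).
      exact: sqrt_continuous.
    apply: (@continuous_comp R R R (fun q => 1 + q) Num.sqrt 0).
      by apply: (@continuousD R R R (cst 1) id 0); [exact: cst_continuous|exact: cvg_id].
    exact: sqrt_continuous.
  apply: (@continuousM R R (cst 2) (fun q : R => ln (Num.sqrt q + Num.sqrt (1 + q))) 0).
    exact: cst_continuous.
  apply: (@continuous_comp R R R (fun q : R => Num.sqrt q + Num.sqrt (1 + q)) (@ln R) 0 c0).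
  by apply: continuous_ln; rewrite sqrtr0 add0r addr0 sqrtr1.
Qed.

Lemma integral_inv_shift (V sg : R) : 0 < V -> 0 < sg ->
  (\int[mu]_(q in `]0%R, V]) ((q + sg)^-1)%:E = (ln (V + sg) - ln sg)%:E)%E.
Proof.
move=> V0 sg0; pose F (q : R) : R := ln (q + sg).
transitivity ((F V - F 0)%:E); last by rewrite /F add0r.
apply: ge0_FTC2_oc => //.
- by move=> q q0; rewrite invr_ge0 ltW// addr_gt0.
- move=> q; rewrite in_itv/= andbT => q0.
  apply: (@continuousV R R (fun q => q + sg) q); first by rewrite gt_eqF// addr_gt0.
  by apply: (@continuousD R R R id (cst sg) q); [exact: cvg_id|exact: cst_continuous].
- move=> q q0; have p : 0 < q + sg by rewrite addr_gt0.
  have dq : is_derive q (1:R) (fun q => q + sg : R) 1.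
    by apply: is_derive_eq; rewrite addr0.
  have d3 := @is_derive1_comp R (@ln R) (fun q => q + sg) q _ _ (is_derive1_ln p) dq.
  by apply: (is_derive_eq d3); rewrite mulr1.
- suff CF : {for 0, continuous F} by exact: cvg_at_right_filter.
  apply: (@continuous_comp R R R (fun q : R => q + sg) (@ln R) 0).
    by apply: (@continuousD R R R id (cst sg) 0); [exact: cvg_id|exact: cst_continuous].
  by apply: continuous_ln; rewrite add0r.
Qed.

End Arsinh.

Section Counting.
Variable R : realType.

Lemma sum_ltn_minn (m t : nat) : (\sum_(0 <= j < m) (j < t) = minn m t)%N.
Proof.
elim: m => [|m ih]; first by rewrite big_geq// min0n.
rewrite big_nat_recr//= ih; case: ltnP => h /=; lia.
Qed.

(** For [n0 <= X] the sum is [minn m t] with [t] the integer part of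
    [X - n0 + 1]; the hypothesis [X <= m%:R + n0] makes the truncation at [m]
    harmless. *)
Lemma count_bounds (m : nat) (n0 X : R) : 0 < n0 -> 0 <= X -> X <= m%:R + n0 ->
  let N : R := \sum_(0 <= j < m) (j%:R + n0 <= X)%R%:R in
  N <= X + 1 /\ X <= N + n0.
Proof.
move=> n00 X0 Xm N.
have [Xn|nX] := ltP X n0.
  have -> : N = 0.
    rewrite /N big1// => j _; rewrite leNgt (lt_le_trans Xn)//.
    by rewrite lerDr.
  by split; [rewrite addr_ge0|rewrite add0r ltW].
have x0 : 0 <= X - n0 by rewrite subr_ge0.
pose t := (Num.truncn (X - n0)).+1.
have -> : N = (minn m t)%:R.
  rewrite -sum_ltn_minn natr_sum; apply: eq_bigr => j _.
  by rewrite -lerBrDr /t ltnS truncn_ge_nat.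
have t1 : t%:R <= X - n0 + 1 by rewrite /t -natr1 lerD2r truncn_le.
have t2 : X - n0 < t%:R by exact: truncnS_gt.
split.
  by apply: (@le_trans _ _ t%:R); [rewrite ler_nat geq_minr|lra].
by rewrite -lerBlDr /minn; case: ifP => _; [rewrite lerBlDr|exact: ltW].
Qed.

End Counting.

(** * Asymptotics of the sum of the growth exponents *)
Section HasIntegral.
Variable R : realType.
Local Notation mu := (@lebesgue_measure R).
Variable E : set R.
Hypothesis mE : measurable E.

(** With nonnegativity built in, identities and inequalities between integrals
    need no further integrability argument. *)
Definition has_int (f : R -> R) (r : R) : Prop :=
  [/\ measurable_fun E f, (forall x, E x -> 0 <= f x) &
      (\int[mu]_(x in E) (f x)%:E = r%:E)%E].

Lemma has_intD f g r t : has_int f r -> has_int g t ->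
  has_int (fun x => f x + g x) (r + t).
Proof.
move=> [mf f0 If] [mg g0 Ig]; split.
- exact: measurable_funD.
- by move=> x Ex; rewrite addr_ge0 ?f0 ?g0.
- under eq_integral do rewrite EFinD.
  rewrite ge0_integralD ?If ?Ig//;
    (try exact/measurable_EFinP); by move=> x Ex; rewrite lee_fin ?f0 ?g0.
Qed.

Lemma has_intZ k f r : 0 <= k -> has_int f r -> has_int (fun x => k * f x) (k * r).
Proof.
move=> k0 [mf f0 If]; split.
- exact: measurable_funM.
- by move=> x Ex; rewrite mulr_ge0 ?f0.
- under eq_integral do rewrite EFinM.
  rewrite ge0_integralZl_EFin ?If//;
    (try exact/measurable_EFinP); by move=> x Ex; rewrite lee_fin f0.
Qed.

Lemma has_int_sum (n : nat) (f : nat -> R -> R) (r : nat -> R) :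
  (forall i, (i < n)%N -> has_int (f i) (r i)) ->
  has_int (fun x => \sum_(0 <= i < n) f i x) (\sum_(0 <= i < n) r i).
Proof.
elim: n => [|n ih] h.
  have -> : (fun x => \sum_(0 <= i < 0) f i x) = (fun x => 0).
    by apply/funext => x; rewrite big_geq.
  by rewrite big_geq//; split => //; rewrite integral0.
have -> : (fun x => \sum_(0 <= i < n.+1) f i x) = (fun x => \sum_(0 <= i < n) f i x + f n x).
  by apply/funext => x; rewrite big_nat_recr.
rewrite big_nat_recr//=; apply: has_intD; last exact: h.
by apply: ih => i ni; apply: h; exact: ltnW.
Qed.

Lemma has_int_le f g r t : has_int f r -> has_int g t ->
  (forall x, E x -> f x <= g x) -> r <= t.
Proof.
move=> [mf f0 If] [mg g0 Ig] fg; rewrite -lee_fin -If -Ig.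
apply: ge0_le_integral => //; try (by move=> x Ex; rewrite lee_fin ?f0 ?g0 ?fg).
- exact/measurable_EFinP.
- exact/measurable_EFinP.
Qed.

End HasIntegral.

Section BetaTruncated.
Variable R : realType.
Local Notation mu := (@lebesgue_measure R).
Local Opaque Gamma eGamma.

Definition beta_kernel (x A sg q : R) : R := q `^ (x - 1) * (q + sg) `^ (- A).
Definition beta_value (x A sg : R) : R :=
  Gamma x * Gamma (A - x) / Gamma A * sg `^ (- (A - x)).

Lemma measurable_beta_kernel x A sg (E : set R) : measurable_fun E (beta_kernel x A sg).
Proof.
apply: measurable_funTS; apply: measurable_funM; first exact: measurable_powR.
apply: (measurableT_comp (measurable_powR _)); exact: measurable_funD.
Qed.

Lemma beta_kernel_ge0 x A sg q : 0 <= beta_kernel x A sg q.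
Proof. by rewrite mulr_ge0 ?powR_ge0. Qed.

(** Cutting the Beta integral at [V] changes it by an amount bounded uniformly
    in [sg]: on [[V, +oo[] the kernel is at most a constant times the kernel for
    [sg = 1]. *)
Lemma beta_truncated (x A V : R) : 0 < V -> 0 < x < A ->
  exists M : R, forall sg, 0 < sg <= 1 ->
  exists2 I, has_int `]0, V]%classic (beta_kernel x A sg) I &
    beta_value x A sg - M <= I <= beta_value x A sg.
Proof.
move=> V0 xA; have /andP[x0 xA'] := xA; have A0 : 0 < A by exact: lt_trans xA'.
pose c := ((V + 1) / V) `^ A.
exists (c * beta_value x A 1) => sg /andP[sg0 sg1].
have ge0k u : forall q, (0 <= (beta_kernel x A u q)%:E :> \bar R)%E.
  by move=> q; rewrite lee_fin beta_kernel_ge0.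
have mk u (F : set R) : measurable_fun F (EFin \o beta_kernel x A u).
  by apply/measurable_EFinP; exact: measurable_beta_kernel.
have U : (`]0, V]%classic `|` `]V, +oo[%classic : set R) = `]0, +oo[%classic.
  rewrite -itv_bndbnd_setU// bnd_simp; exact: ltW.
have dj : [disjoint (`]0, V]%classic : set R) & `]V, +oo[%classic].
  rewrite disj_set2E; apply/eqP; rewrite -subset0 => q [] /=.
  rewrite !in_itv/= andbT => /andP[_ qV] Vq.
  by move: (le_lt_trans qV Vq); rewrite ltxx.
have := @beta_integral R x A sg sg0 xA; rewrite -/(beta_value _ _ _).
rewrite -[X in integral _ X _]U ge0_integral_setU//; last 2 first.
- exact: (mk sg).
- by move=> q _; exact: (ge0k sg q).
set a := (X in (X + _)%E); set b := (X in (_ + X)%E) => ab.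
have a0 : (0 <= a)%E by apply: integral_ge0 => q _; exact: ge0k.
have b0 : (0 <= b)%E by apply: integral_ge0 => q _; exact: ge0k.
have bM : (b <= (c * beta_value x A 1)%:E)%E.
  rewrite EFinM /beta_value -(@beta_integral R x A 1 ltr01 xA).
  apply: (@le_trans _ _ (c%:E * \int[mu]_(q in `]V, +oo[) (beta_kernel x A 1 q)%:E)%E).
    rewrite -ge0_integralZl_EFin ?powR_ge0//; last exact: mk.
    apply: ge0_le_integral => //.
    - by move=> q _; exact: (ge0k sg q).
    - exact: (mk sg).
    - by apply: emeasurable_funM => //; exact: (mk 1).
    move=> q; rewrite /= in_itv/= andbT => Vq; rewrite -EFinM lee_fin.
    have q0 := lt_trans V0 Vq.
    rewrite /beta_kernel mulrCA ler_wpM2l ?powR_ge0//.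
    apply: (@le_trans _ _ (q `^ (- A))).
      by apply: powRN_anti => //; rewrite ?lerDl ltW.
    have c0 : 0 < (V + 1) / V by rewrite divr_gt0// addr_gt0.
    have -> : q `^ (- A) = c * (q * ((V + 1) / V)) `^ (- A).
      have ck : c * ((V + 1) / V) `^ (- A) = 1 by rewrite /c powRN divff// gt_eqF// powR_gt0.
      by rewrite powRM ?(ltW q0) ?(ltW c0)// mulrCA ck mulr1.
    rewrite ler_wpM2l ?powR_ge0//; apply: powRN_anti.
    - exact: ltW.
    - by rewrite addr_gt0.
    rewrite mulrA ler_pdivlMr// mulrDl mulrDr lerD2l mul1r mulr1 ltW//.
  apply: lee_wpmul2l; first by rewrite lee_fin powR_ge0.
  apply: ge0_subset_integral => //; first exact: (mk 1).
  by rewrite -U; exact: subsetUr.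
have : exists I, a = I%:E.
  by move: ab a0; case: a => [I| |]//; [exists I|rewrite addye// gt_eqF// (lt_le_trans _ b0)].
move=> [I aI]; have : exists J, b = J%:E.
  by move: ab b0; rewrite aI; case: b {bM} => [J| |]//; exists J.
move=> [J bJ]; move: ab bM b0; rewrite aI bJ !lee_fin -EFinD => -[] abE JM J0.
exists I; first by split => //; [exact: measurable_beta_kernel|by move=> q _; exact: beta_kernel_ge0].
by apply/andP; split; rewrite -abE; lra.
Qed.

End BetaTruncated.

Section SumAsymptotics.
Variable R : realType.
Local Notation mu := (@lebesgue_measure R).
Local Opaque Gamma eGamma.
Variables (D tau n0 : R).
Hypotheses (tau0 : 0 < tau) (tau1 : tau < 1) (n00 : 0 < n0)
  (D0 : 0 < D) (Dn0 : D < n0 `^ tau).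

Definition coef (n : nat) : R := D / (n%:R + n0) `^ tau.

Definition main_coef (n : nat) : R :=
  D `^ tau^-1 * (Gamma (n%:R + 2^-1) / Gamma (2 * tau)^-1)
  * \sum_(0 <= l < n.+1) Gamma ((2 * tau)^-1 - l%:R - 2^-1) / ((n - l)`!)%:R.

Let A : R := (2 * tau)^-1.
Let b : R := A - 2^-1.
Let L : nat := `|Num.ceil b|%N.

Lemma powRD_gt0 (x r s : R) : 0 < x -> x `^ (r + s) = x `^ r * x `^ s.
Proof. by move=> x0; rewrite powRD// (gt_eqF x0) implybT. Qed.

Lemma base_gt0 n : 0 < n%:R + n0.
Proof. by rewrite ltr_wpDl. Qed.

Lemma coef_gt0 n : 0 < coef n.
Proof. by rewrite divr_gt0// powR_gt0// base_gt0. Qed.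

Lemma coef_decr m n : (m <= n)%N -> coef n <= coef m.
Proof.
move=> mn; rewrite ler_pM2l// lef_pV2 ?posrE ?powR_gt0 ?base_gt0//.
by apply: ge0_ler_powR; rewrite ?nnegrE ?lerD2r ?ler_nat// ltW// base_gt0.
Qed.

Lemma coef_lt1 n : coef n < 1.
Proof.
apply: (le_lt_trans (coef_decr (leq0n n))).
by rewrite /coef add0r ltr_pdivrMr ?mul1r// powR_gt0.
Qed.

Lemma coef01 n : 0 < coef n < 1.
Proof. by rewrite coef_gt0 coef_lt1. Qed.

Lemma powR_le_root (x y p : R) : 0 < x -> 0 < y -> 0 < p ->
  (x `^ p <= y) = (x <= y `^ p^-1).
Proof.
move=> x0 y0 p0; have pi0 : 0 < p^-1 by rewrite invr_gt0.
have e : x = (x `^ p) `^ p^-1 by rewrite -powRrM mulfV ?gt_eqF// powRr1// ltW.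
have e' : y = (y `^ p^-1) `^ p by rewrite -powRrM mulVf ?gt_eqF// powRr1// ltW.
apply/idP/idP => h.
  rewrite [leLHS]e; apply: ge0_ler_powR => //; rewrite ?nnegrE ?powR_ge0// ltW//.
rewrite [leRHS]e'; apply: ge0_ler_powR => //; rewrite ?nnegrE ?powR_ge0// ltW//.
Qed.

Lemma A_gt0 : 0 < A.
Proof. by rewrite invr_gt0 mulr_gt0. Qed.

Lemma b_gt0 : 0 < b.
Proof. by rewrite subr_gt0 ltf_pV2 ?posrE ?mulr_gt0// gtr_pMr. Qed.

Lemma invtau : tau^-1 = 2 * A.
Proof. by rewrite /A invfM mulrA divff ?mul1r. Qed.

Lemma ltn_L i : (i < L)%N = (i%:R < b).
Proof.
have c0 : 0 <= Num.ceil b by rewrite ltW// ceil_gt0 b_gt0.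
rewrite /L -(ltz_nat i) gez0_abs// ceil_gt_int.
by rewrite -pmulrn.
Qed.

Lemma L_ge : b <= L%:R.
Proof. by rewrite leNgt -ltn_L ltnn. Qed.

Lemma L_ge1 : 1 <= L%:R :> R.
Proof. by rewrite ler1n ltn_L b_gt0. Qed.

(** The inverse of [qcoef sg] as a function of [n%:R + n0], in the sense of
    [level_qcoef]. *)
Definition level (sg q : R) : R := (D ^+ 2 * (1 + q) / (q + sg)) `^ A.

(** The logarithm of [growth] is [arsinh (sqrt q)] for [q] the [qcoef] of
    [s ^+ 2]; see [growth_coef]. *)
Definition qcoef (sg : R) (n : nat) : R := (coef n ^+ 2 - sg) / (1 - coef n ^+ 2).

Lemma coef_sqr_lt1 n : 0 < 1 - coef n ^+ 2.
Proof.
by rewrite subr_gt0 expr_lt1//; [exact: coef_lt1|rewrite ltW// coef_gt0].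
Qed.

Lemma level_qcoef sg q n : 0 < sg -> 0 < q ->
  (q <= qcoef sg n) = (n%:R + n0 <= level sg q).
Proof.
move=> sg0 q0; have x0 := base_gt0 n.
have q1 : 0 < q + sg by rewrite addr_gt0.
have q2 : 0 < 1 + q by rewrite addr_gt0.
have Y0 : 0 < D ^+ 2 * (1 + q) / (q + sg) by rewrite divr_gt0// mulr_gt0// exprn_gt0.
have t0 : 0 < 2 * tau by rewrite mulr_gt0.
rewrite /level -powR_le_root// /qcoef ler_pdivlMr ?coef_sqr_lt1//.
have -> : (n%:R + n0) `^ (2 * tau) = ((n%:R + n0) `^ tau) ^+ 2.
  by rewrite mulrC powRrM powR_mulrn ?powR_ge0.
rewrite /coef expr_div_n; have : 0 < (n%:R + n0) `^ tau by rewrite powR_gt0.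
move: (_ `^ tau) => u u0; have u2 : 0 < u ^+ 2 by rewrite exprn_gt0.
rewrite ler_pdivlMr//.
have un : u != 0 by rewrite gt_eqF.
rewrite -(ler_pM2r u2).
have -> : q * (1 - D ^+ 2 / u ^+ 2) * u ^+ 2 = q * u ^+ 2 - q * D ^+ 2 by field.
have -> : (D ^+ 2 / u ^+ 2 - sg) * u ^+ 2 = D ^+ 2 - sg * u ^+ 2 by field.
by rewrite -subr_ge0 -[in RHS]subr_ge0; congr (0 <= _); ring.
Qed.

Lemma level_le sg q : 0 < sg < 1 -> 0 < q -> level sg q <= (D ^+ 2 / sg) `^ A.
Proof.
move=> /andP[sg0 sg1] q0; have q1 : 0 < q + sg by rewrite addr_gt0.
have q2 : 0 < 1 + q by rewrite addr_gt0.
apply: ge0_ler_powR; rewrite ?nnegrE ?(ltW A_gt0)//.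
- by rewrite divr_ge0 ?mulr_ge0 ?sqr_ge0 ?ltW.
- by rewrite divr_ge0 ?sqr_ge0 ?ltW.
rewrite ler_pdivrMr// [leRHS]mulrAC ler_pdivlMr// -[leLHS]mulrA ler_wpM2l ?sqr_ge0//.
by rewrite mulrDl mul1r addrC lerD2r ler_piMr ?(ltW q0) ?(ltW sg1).
Qed.

(** Only the factor [(1 + q) `^ b] separates the integrand from a Beta kernel;
    expanding it in powers of [q] produces the terms of [main_term]. *)
Lemma level_weight sg q : 0 < sg -> 0 < q ->
  level sg q * arsinh_weight q =
  D `^ tau^-1 * ((1 + q) `^ b * beta_kernel 2^-1 A sg q).
Proof.
move=> sg0 q0; have q1 : 0 < q + sg by rewrite addr_gt0.
have q2 : 0 < 1 + q by rewrite addr_gt0.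
rewrite /level /arsinh_weight /beta_kernel invtau.
rewrite powRM ?invr_ge0 ?mulr_ge0 ?sqr_ge0 ?ltW// powRM ?sqr_ge0 ?ltW//.
have -> : (D ^+ 2) `^ A = D `^ (2 * A) by rewrite -powR_mulrn ?ltW// powRrM.
have -> : (q + sg)^-1 `^ A = (q + sg) `^ (- A).
  by rewrite -powR_inv1 ?ltW// -powRrM mulN1r.
rewrite -!powR12_sqrt ?ltW// invfM -!powRN.
have -> : 2^-1 - 1 = - 2^-1 :> R by field.
have -> : (1 + q) `^ b = (1 + q) `^ A * (1 + q) `^ (- 2^-1).
  by rewrite -powRD_gt0.
ring.
Qed.

Lemma beta_kernel_shift sg q (i : nat) : 0 < q ->
  q ^+ i * beta_kernel 2^-1 A sg q = beta_kernel (i%:R + 2^-1) A sg q.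
Proof.
move=> q0; rewrite /beta_kernel mulrA -powR_mulrn ?ltW// -powRD_gt0//.
by rewrite addrA.
Qed.

(** The order [L] is the first one for which the Taylor remainder is no worse
    than [(q + sg)^-1], whose integral is logarithmic in [sg]. *)
Lemma remainder_kernel sg q V : 0 < sg < 1 -> 0 < q <= V ->
  q ^+ L * beta_kernel 2^-1 A sg q <= (V + 1) `^ (L%:R - b) * (q + sg)^-1.
Proof.
move=> /andP[sg0 sg1] /andP[q0 qV]; have q1 : 0 < q + sg by rewrite addr_gt0.
rewrite beta_kernel_shift// /beta_kernel.
have e1 : q `^ (L%:R + 2^-1 - 1) <= (q + sg) `^ (L%:R + 2^-1 - 1).
  apply: ge0_ler_powR; rewrite ?nnegrE ?(ltW q0) ?(ltW q1) ?lerDl ?(ltW sg0)//.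
  have := L_ge1; lra.
apply: (le_trans (ler_wpM2r (powR_ge0 _ _) e1)).
rewrite -powRD_gt0//.
have -> : L%:R + 2^-1 - 1 + - A = (L%:R - b) + (- 1).
  by rewrite /b; field.
rewrite powRD_gt0//.
rewrite powR_inv1 ?(ltW q1)// ler_wpM2r ?invr_ge0 ?(ltW q1)//.
apply: ge0_ler_powR; rewrite ?nnegrE ?(ltW q1)//.
- by rewrite subr_ge0 L_ge.
- by rewrite addr_ge0// (le_trans (ltW q0)).
- by rewrite lerD// ltW.
Qed.

Lemma falling_coef_ge0 i : (i < L)%N -> 0 <= falling b i / i`!%:R.
Proof.
rewrite ltn_L => ib; rewrite divr_ge0// prodr_ge0// => j _.
rewrite subr_ge0 ltW// (le_lt_trans _ ib)// ler_nat ltnW//.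
Qed.

Lemma main_coef_beta s i : 0 < s -> (i < L)%N ->
  D `^ tau^-1 * (falling b i / i`!%:R * beta_value (i%:R + 2^-1) A (s ^+ 2)) =
  main_coef i * s `^ (- tau^-1 + 1 + 2 * i%:R).
Proof.
move=> s0 iL; rewrite /main_coef -/A /beta_value.
have -> : A - (i%:R + 2^-1) = b - i%:R by rewrite /b; ring.
rewrite (eq_bigr (fun l => Gamma (b - l%:R) / (i - l)`!%:R)); last first.
  by move=> l _; rewrite /b addrAC.
rewrite -Gamma_sum_identity -?ltn_L//.
have -> : (s ^+ 2) `^ (- (b - i%:R)) = s `^ (- tau^-1 + 1 + 2 * i%:R).
  rewrite -powR_mulrn ?ltW// -powRrM; congr (_ `^ _).
  by rewrite invtau /b; field.
ring.
Qed.

End SumAsymptotics.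

Section SumAsymptoticsMain.
Variable R : realType.
Local Notation mu := (@lebesgue_measure R).
Local Opaque Gamma eGamma.

Lemma has_int_arsinh_step (V q0 : R) : 0 <= q0 <= V ->
  has_int `]0, V]%classic (fun q => \1_(`]-oo, q0]%classic) q * arsinh_weight q)
    (2 * ln (Num.sqrt q0 + Num.sqrt (1 + q0))).
Proof.
move=> /andP[q00 qV]; split.
- apply: measurable_funM; first exact: measurable_indic.
  apply: cont_gt0_measurable => //; last exact: arsinh_weight_continuous.
  by move=> x /=; rewrite in_itv/= => /andP[].
- by move=> x _; rewrite mulr_ge0 ?arsinh_weight_ge0.
have [->|q0n] := eqVneq q0 0.
  rewrite sqrtr0 add0r addr0 sqrtr1 ln1 mulr0; apply: integral0_eq => q /=.
  rewrite in_itv/= => /andP[p _]; rewrite indicE memNset ?mul0r//=.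
  by rewrite in_itv/= leNgt p.
have q0p : 0 < q0 by rewrite lt0r q0n.
rewrite -integral_arsinh_weight// integral_mkcond [RHS]integral_mkcond.
apply: eq_integral => q _; rewrite !patchE !mem_setE indicE mem_setE !in_itv/=.
have [p|p] := ltP 0 q => //=.
have [h|h] := leP q q0; first by rewrite (le_trans h qV) mul1r.
by rewrite mul0r; case: ifP.
Qed.

Variables (D tau n0 : R).
Hypotheses (tau0 : 0 < tau) (tau1 : tau < 1) (n00 : 0 < n0)
  (D0 : 0 < D) (Dn0 : D < n0 `^ tau).
Let a := coef D tau n0.

Lemma growth_coef c s n : 0 < c -> c ^+ 2 + s ^+ 2 = 1 -> 0 < s -> s <= a n ->
  growth a c s n = Num.sqrt (qcoef D tau n0 (s ^+ 2) n) +
                   Num.sqrt (1 + qcoef D tau n0 (s ^+ 2) n).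
Proof.
move=> c0 cs s0 sa; rewrite /growth /rho /qcoef -/a.
have p := coef_sqr_lt1 tau0 n00 D0 Dn0 n; rewrite -/a in p.
have e : 0 <= a n ^+ 2 - s ^+ 2.
  by rewrite subr_ge0; apply: lerXn2r => //; rewrite nnegrE ltW// (lt_le_trans s0).
rewrite sqrtrM// (_ : 1 + _ / _ = c ^+ 2 / (1 - a n ^+ 2)); last first.
  rewrite (_ : c ^+ 2 = 1 - s ^+ 2); last by rewrite -cs; ring.
  by field; rewrite gt_eqF.
by rewrite sqrtrM ?sqr_ge0// sqrtr_sqr (gtr0_norm c0) sqrtrV ?(ltW p)// -mulrDl addrC.
Qed.

Local Notation A := (2 * tau)^-1.
Local Notation b := ((2 * tau)^-1 - 2^-1).
Local Notation L := `|Num.ceil b|%N.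
Definition main_term (s : R) : R :=
  \sum_(0 <= n < L) main_coef D tau n * s `^ (- tau^-1 + 1 + 2 * n%:R).

Let V : R := a 0 ^+ 2 / (1 - a 0 ^+ 2).
Let E : set R := `]0, V]%classic.
Let mE : measurable E. Proof. exact: measurable_itv. Qed.
Let Dt : R := D `^ tau^-1.
Let beta i : R := falling b i / i`!%:R.

Lemma V_gt0 : 0 < V.
Proof. by rewrite divr_gt0 ?coef_sqr_lt1// exprn_gt0// coef_gt0. Qed.

Lemma qcoef_le_V s n : s <= a n -> 0 < s -> 0 <= qcoef D tau n0 (s ^+ 2) n <= V.
Proof.
move=> sa s0; have p := coef_sqr_lt1 tau0 n00 D0 Dn0 n.
have p0 := coef_sqr_lt1 tau0 n00 D0 Dn0 0.
apply/andP; split.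
  rewrite divr_ge0 ?(ltW p)// subr_ge0; apply: lerXn2r => //; rewrite nnegrE ltW//.
  exact: lt_le_trans sa.
have d : coef D tau n0 n ^+ 2 <= coef D tau n0 0 ^+ 2.
  by apply: lerXn2r; rewrite ?nnegrE ?(ltW (coef_gt0 _ _ _ _))// coef_decr.
rewrite ler_pM ?invr_ge0 ?(ltW p)//.
- by rewrite subr_ge0; apply: lerXn2r => //; rewrite nnegrE ltW// (lt_le_trans s0).
- by apply: le_trans d; rewrite gerBl sqr_ge0.
- by rewrite lef_pV2 ?posrE// lerD2l lerN2.
Qed.

(** The [j]-th term is the integral of the arsinh weight from [0] to
    [qcoef D tau n0 (s ^+ 2) j], so that the sum is the integral of the weight
    times the number of [j] for which [x] is below this bound. This number is [level] up to a bounded error. Replacing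
    [(1 + x) `^ b] by its Taylor polynomial gives Beta integrals truncated at
    [V], and an error of the order of the integral of [(x + sg)^-1]. *)
Lemma sum_asymptotics : exists K s1, 0 < s1 < 1 /\
  forall s c m, 0 < s < s1 -> 0 < c -> c ^+ 2 + s ^+ 2 = 1 ->
    (forall j, (j < m)%N -> s <= a j) -> a m < s ->
    `|\sum_(0 <= j < m) 2 * ln (growth a c s j) - main_term s| <= K * ln s^-1.
Proof.
have [C C0 hC] := binomial_taylor L b (ltW V_gt0).
have bp := b_gt0 tau0 tau1; have Ap := A_gt0 tau0.
have hM i : exists M, (i < L)%N -> forall sg, 0 < sg <= 1 ->
  exists2 I, has_int E (beta_kernel (i%:R + 2^-1) A sg) I &
    beta_value (i%:R + 2^-1) A sg - M <= I <= beta_value (i%:R + 2^-1) A sg.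
  case: (ltnP i L) => iL; last by exists 0.
  have [|M hM] := @beta_truncated _ (i%:R + 2^-1) A V V_gt0; last by exists M.
  by rewrite ltr_wpDl//= -ltrBrDr; move: iL; rewrite (ltn_L tau0 tau1).
have {hM}[M hM] := choice hM.
pose H : R := 2 * ln (Num.sqrt V + Num.sqrt (1 + V)).
have Hw : has_int E (@arsinh_weight R) H.
  split; first apply: (cont_gt0_measurable mE).
  - by move=> x; rewrite /E/= in_itv/= => /andP[].
  - exact: arsinh_weight_continuous.
  - by move=> x _; exact: arsinh_weight_ge0.
  - by apply: integral_arsinh_weight; exact: V_gt0.
have H0 : 0 <= H.
  by case: Hw => _ w0 e; rewrite -lee_fin -e; apply: integral_ge0 => x Ex; rewrite lee_fin w0.
have Dt0 : 0 <= Dt by exact: powR_ge0.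
pose C2 : R := (V + 1) `^ (L%:R - b).
have C20 : 0 <= C2 by exact: powR_ge0.
pose Cr := Dt * C * C2.
have Cr0 : 0 <= Cr by rewrite !mulr_ge0.
pose MM := \sum_(0 <= i < L) Dt * (beta i * `|M i|).
have beta0 i : (i < L)%N -> 0 <= beta i by exact: (falling_coef_ge0 tau0 tau1).
have MM0 : 0 <= MM.
  rewrite /MM big_nat_cond; apply: sumr_ge0 => i /andP[/andP[_ iL] _].
  by rewrite mulr_ge0// mulr_ge0// beta0.
have V1 : 0 <= ln (V + 1) by rewrite ln_ge0// lerDr ltW// V_gt0.
(* below exp (-1) the logarithm of 1/s exceeds 1 and absorbs the constants *)
exists (Cr * (ln (V + 1) + 2) + H + n0 * H + MM), (expR (- 1)).
split; first by rewrite expR_gt0 expR_lt1 oppr_lt0 ltr01.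
move=> s c m /andP[s0 s1] c0 cs sm ams.
have ell : 1 <= ln s^-1.
  rewrite lnV ?posrE// lerNr -(@expRK R (- 1)).
  by rewrite ler_ln ?posrE ?expR_gt0// ltW.
have s1' : s < 1 by apply: lt_trans s1 _; rewrite expR_lt1 oppr_lt0 ltr01.
pose sg := s ^+ 2.
have sg0 : 0 < sg by rewrite exprn_gt0.
have sg1 : sg < 1 by rewrite expr_lt1// ltW.
have sg01 : 0 < sg <= 1 by rewrite sg0 ltW.
have hI i : exists I, (i < L)%N -> has_int E (beta_kernel (i%:R + 2^-1) A sg) I /\
    beta_value (i%:R + 2^-1) A sg - M i <= I <= beta_value (i%:R + 2^-1) A sg.
  case: (ltnP i L) => iL; last by exists 0.
  by have [I I1 I2] := hM i iL sg sg01; exists I.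
have {hI}[I hI] := choice hI.
pose T : R := ln (V + sg) - ln sg.
have Hr : has_int E (fun q => (q + sg)^-1) T.
  split.
  - apply: (cont_gt0_measurable mE); first by move=> x; rewrite /E/= in_itv/= => /andP[].
    move=> q; rewrite in_itv/= andbT => q0.
    apply: (@continuousV R R (fun q => q + sg) q); first by rewrite gt_eqF// addr_gt0.
    by apply: (@continuousD R R R id (cst sg) q); [exact: cvg_id|exact: cst_continuous].
  - move=> x; rewrite /E/= in_itv/= => /andP[x0 _]; rewrite invr_ge0 ltW// addr_gt0//.
  - by apply: integral_inv_shift => //; exact: V_gt0.
have TL : T <= (ln (V + 1) + 2) * ln s^-1.
  rewrite /T /sg lnXn// -mulNrn -lnV ?posrE// mulr2n mulrDl.
  have : ln (V + s ^+ 2) <= ln (V + 1).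
    rewrite ler_ln ?posrE ?addr_gt0 ?V_gt0// ?lerD2l//; exact: ltW.
  have : ln (V + 1) * 1 <= ln (V + 1) * ln s^-1 by rewrite ler_wpM2l.
  lra.
pose q j := qcoef D tau n0 sg j.
pose N x := \sum_(0 <= j < m) (\1_(`]-oo, q j]%classic) x * arsinh_weight x).
pose S := \sum_(0 <= j < m) 2 * ln (growth a c s j).
have HN : has_int E N S.
  apply: (@has_int_sum R E mE m (fun j x => \1_(`]-oo, q j]%classic) x * arsinh_weight x)
     (fun j => 2 * ln (growth a c s j))) => j jm.
  rewrite (growth_coef c0 cs s0 (sm j jm)); apply: has_int_arsinh_step.
  by apply: qcoef_le_V => //; exact: sm.
pose G x := \sum_(0 <= i < L) Dt * (beta i * beta_kernel (i%:R + 2^-1) A sg x).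
have HG : has_int E G (\sum_(0 <= i < L) Dt * (beta i * I i)).
  apply: (@has_int_sum R E mE L (fun i x => Dt * (beta i * beta_kernel (i%:R + 2^-1) A sg x))
     (fun i => Dt * (beta i * I i))) => i iL.
  by apply: (has_intZ mE) => //; apply: (has_intZ mE); [exact: beta0|case: (hI i iL)].
have main : main_term s = \sum_(0 <= i < L) Dt * (beta i * beta_value (i%:R + 2^-1) A sg).
  rewrite /main_term big_nat_cond [RHS]big_nat_cond; apply: eq_bigr => i /andP[/andP[_ iL] _].
  by rewrite -(main_coef_beta D tau0 tau1 s0 iL).
have count x : E x -> N x <= level D tau sg x * arsinh_weight x + arsinh_weight x /\
   level D tau sg x * arsinh_weight x <= N x + n0 * arsinh_weight x.
  rewrite /E/= in_itv/= => /andP[x0 xV].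
  have -> : N x = (\sum_(0 <= j < m) (j%:R + n0 <= level D tau sg x)%R%:R) * arsinh_weight x.
    rewrite /N mulr_suml; apply: eq_bigr => j _; congr (_ * _).
    by rewrite indicE mem_setE in_itv/= (level_qcoef tau0 n00 D0 Dn0).
  have lev0 : 0 <= level D tau sg x by exact: powR_ge0.
  have levm : level D tau sg x <= m%:R + n0.
    apply: (@le_trans _ _ ((D ^+ 2 / sg) `^ A)).
      by apply: (level_le tau0) => //; rewrite sg0.
    have x0' : 0 < m%:R + n0 by rewrite ltr_wpDl.
    have t0 : 0 < 2 * tau by rewrite mulr_gt0.
    have Y0 : 0 < D ^+ 2 / sg by rewrite divr_gt0// exprn_gt0.
    rewrite leNgt; apply/negP => h.
    have : (m%:R + n0) `^ (2 * tau) <= D ^+ 2 / sg by rewrite powR_le_root// ltW.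
    rewrite mulrC powRrM powR_mulrn ?powR_ge0// /sg -expr_div_n.
    rewrite ler_pXn2r ?nnegrE ?powR_ge0 ?divr_ge0 ?(ltW D0) ?(ltW s0)//.
    rewrite ler_pdivlMr// mulrC -ler_pdivlMr ?powR_gt0//.
    by rewrite leNgt ams.
  have [c1 c2] := count_bounds n00 lev0 levm.
  have w0 := arsinh_weight_ge0 x.
  split.
    by apply: (le_trans (ler_wpM2r w0 c1)); rewrite mulrDl mul1r.
  by apply: (le_trans (ler_wpM2r w0 c2)); rewrite mulrDl.
have taylor x : E x -> `|level D tau sg x * arsinh_weight x - G x| <= Cr * (x + sg)^-1.
  rewrite /E/= in_itv/= => /andP[x0 xV].
  rewrite level_weight// -/Dt.
  have -> : G x = Dt * ((\sum_(i < L) beta i * x ^+ i) * beta_kernel 2^-1 A sg x).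
    rewrite /G big_mkord mulr_suml mulr_sumr; apply: eq_bigr => i _.
    by rewrite -(beta_kernel_shift tau sg i x0) [beta i * (_ * _)]mulrA.
  rewrite -mulrBr -mulrBl normrM (ger0_norm Dt0) normrM (ger0_norm (beta_kernel_ge0 _ _ _ _)).
  rewrite /Cr -!mulrA ler_wpM2l//.
  apply: (@le_trans _ _ (C * x ^+ L * beta_kernel 2^-1 A sg x)).
    by rewrite ler_wpM2r ?beta_kernel_ge0// hC// ltW.
  rewrite -mulrA ler_wpM2l//.
  by apply: (remainder_kernel tau0 tau1); rewrite ?sg0 ?x0.
have up : S <= \sum_(0 <= i < L) Dt * (beta i * I i) + Cr * T + H.
  apply: (has_int_le mE HN (has_intD mE (has_intD mE HG (has_intZ mE Cr0 Hr)) Hw)) => // x Ex.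
  have [c1 _] := count x Ex; apply: (le_trans c1).
  rewrite lerD2r -lerBlDl; apply: le_trans (taylor x Ex); exact: ler_norm.
have lo : \sum_(0 <= i < L) Dt * (beta i * I i) <= S + n0 * H + Cr * T.
  apply: (has_int_le mE HG (has_intD mE (has_intD mE HN (has_intZ mE (ltW n00) Hw)) (has_intZ mE Cr0 Hr))) => // x Ex.
  have [_ c2] := count x Ex.
  have := taylor x Ex; rewrite ler_norml => /andP[t1 t2]; lra.
have i1 : \sum_(0 <= i < L) Dt * (beta i * I i) <= main_term s.
  rewrite main big_nat_cond [leRHS]big_nat_cond; apply: ler_sum => i /andP[/andP[_ iL] _].
  have [_ /andP[_ h]] := hI i iL.
  by rewrite ler_wpM2l// ler_wpM2l// beta0.
have i2 : main_term s <= \sum_(0 <= i < L) Dt * (beta i * I i) + MM.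
  rewrite main /MM -big_split/= big_nat_cond [leRHS]big_nat_cond.
  apply: ler_sum => i /andP[/andP[_ iL] _].
  have [_ /andP[h _]] := hI i iL.
  rewrite -mulrDr -mulrDr ler_wpM2l// ler_wpM2l// ?beta0//.
  have := ler_norm (M i); lra.
have CT : Cr * T <= Cr * (ln (V + 1) + 2) * ln s^-1 by rewrite -mulrA ler_wpM2l.
have HH : H <= H * ln s^-1 by rewrite ler_peMr.
have nH0 : 0 <= n0 * H by rewrite mulr_ge0// ltW.
have nH : n0 * H <= n0 * H * ln s^-1 by rewrite ler_peMr// mulr_ge0// ltW.
have MH : MM <= MM * ln s^-1 by rewrite ler_peMr.
rewrite -/S !mulrDl ler_norml.
clear -up lo i1 i2 CT HH H0 nH0 nH MH MM0.
apply/andP; split; lra.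
Qed.

End SumAsymptoticsMain.

(** * Asymptotics of the energy *)
Section EnergyAsymptotics.
Variable R : realType.
Local Opaque Gamma eGamma.
Variables (D tau n0 : R).
Hypotheses (tau0 : 0 < tau) (tau1 : tau < 1) (n00 : 0 < n0)
  (D0 : 0 < D) (Dn0 : D < n0 `^ tau).
Let a := coef D tau n0.

Lemma coef_ge s j : 0 < s -> (s <= a j) = (j%:R + n0 <= (D / s) `^ tau^-1).
Proof.
move=> s0; have x0 := base_gt0 n00 j.
rewrite -powR_le_root ?divr_gt0// /a /coef ler_pdivlMr ?powR_gt0//.
by rewrite ler_pdivlMr// mulrC.
Qed.

Lemma coef_gap j : tau * a j.+1 / (j.+1%:R + n0) <= a j - a j.+1.
Proof.
have x0 := base_gt0 n00 j; have x1 := base_gt0 n00 j.+1.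
rewrite /a /coef; set x := j%:R + n0; set y := j.+1%:R + n0.
have yx : y = x + 1 by rewrite /x /y -natr1; ring.
have py : 0 < y `^ tau by rewrite powR_gt0.
have px : 0 < x `^ tau by rewrite powR_gt0.
have -> : D / x `^ tau - D / y `^ tau = D / y `^ tau * ((y / x) `^ tau - 1).
  rewrite powRM ?invr_ge0 ?(ltW x1) ?(ltW x0)// -[x^-1]powR_inv1 ?(ltW x0)// -powRrM mulN1r powRN.
  by field; rewrite !gt_eqF.
have -> : tau * (D / y `^ tau) / y = D / y `^ tau * (tau / y) by rewrite mulrAC mulrC.
rewrite ler_wpM2l ?divr_ge0 ?(ltW D0) ?(ltW py)//.
have yx0 : 0 < y / x by rewrite divr_gt0.
have e : tau * ln (y / x) <= (y / x) `^ tau - 1.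
  rewrite lerBrDl /powR gt_eqF//; exact: expR_ge1Dx.
apply: le_trans e; rewrite ler_pM2l//.
have h : ln (1 + (x / y - 1)) <= x / y - 1.
  by apply: le_ln1Dx; rewrite ltrBrDr addNr divr_gt0.
move: h; rewrite addrCA subrr addr0.
have -> : ln (x / y) = - ln (y / x) by rewrite -lnV ?posrE// invf_div.
have -> : x / y - 1 = - (1 / y) by rewrite yx; field; rewrite -yx gt_eqF.
by rewrite lerN2 div1r.
Qed.

Lemma ln_prod_growth c s n : 0 < c -> c ^+ 2 + s ^+ 2 = 1 -> 0 < s ->
  ln ((\prod_(0 <= j < n) growth a c s j) ^+ 2) =
  \sum_(0 <= j < n) 2 * ln (growth a c s j).
Proof.
move=> c0 cs s0; have g0 j : 0 < growth a c s j.
  by apply: growth_gt0 => //; exact: coef01.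
elim: n => [|n ih]; first by rewrite !big_geq// expr1n ln1.
have p0 : 0 < \prod_(0 <= j < n) growth a c s j by apply: prodr_gt0.
by rewrite !big_nat_recr//= exprMn lnM ?posrE ?exprn_gt0// ih lnXn// mulr_natl.
Qed.

(** The coefficients cross [s] between the two integers around [X - n0], where
    [X] is [(D / s) `^ tau^-1]. By [coef_gap] the distance to the crossing is at
    least a power of [s], so that the factors in [energy_bounds] contribute
    only a multiple of [ln s^-1]. *)
Lemma energy_asymptotics : exists K s1, 0 < s1 < 1 /\
  forall s c n, 0 < s < s1 -> 0 < c -> c ^+ 2 + s ^+ 2 = 1 ->
    (D / s) `^ tau^-1 + 3 <= n%:R ->
    `|ln (energy a c s n) - main_term D tau s| <= K * ln s^-1.
Proof.
have n0p : 0 < n0 by exact: n00.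
have [K [s1 [/andP[s10 s11] hK]]] := sum_asymptotics tau0 tau1 n00 D0 Dn0.
pose s2 := Num.min (Num.min s1 (expR (- 1))) (D / (n0 + 2) `^ tau).
pose R0 := (1 + a 0) / (1 - a 0).
have a00 := coef_gt0 tau n00 D0 0; have a01 := coef_lt1 tau0 n00 D0 Dn0 0.
rewrite -/a in a00 a01.
have R0p : 0 < R0 by rewrite divr_gt0// ?subr_gt0// addr_gt0.
pose Kc := `|ln (2 * R0)| + `|ln (4 * R0 ^+ 3)|.
pose Kg := `|ln (4 / tau)| + tau^-1 * (`|ln D| + 1) + 1.
exists (K + Kc + 3 * Kg), s2; split.
  apply/andP; split.
    by rewrite !lt_min s10 expR_gt0 divr_gt0// powR_gt0// addr_gt0.
  by rewrite !gt_min s11.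
move=> s c n /andP[s0]; rewrite !lt_min => /andP[/andP[ss1 se] sD] c0 cs nX.
set X := (D / s) `^ tau^-1 in nX.
have X2 : n0 + 2 <= X.
  rewrite /X -powR_le_root ?divr_gt0 ?addr_gt0//.
  by rewrite ler_pdivlMr// mulrC -ler_pdivlMr ?powR_gt0 ?addr_gt0// ltW.
have Xn0 : 0 <= X - n0 by rewrite subr_ge0 (le_trans _ X2)// lerDl.
have X0 : 0 < X by apply: lt_le_trans X2; rewrite addr_gt0.
have [k kX] : exists k : nat, k.+1%:R <= X - n0 < k.+2%:R.
  have t1 : (0 < Num.truncn (X - n0))%N by rewrite truncn_gt0 lerBrDl; lra.
  exists (Num.truncn (X - n0)).-1; rewrite prednK//; exact: truncn_itv.
have /andP[kX1 kX2] := kX.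
have sm j : (j < k.+2)%N -> s <= a j.
  move=> jk; rewrite coef_ge// -/X; have : j%:R <= k.+1%:R :> R by rewrite ler_nat.
  lra.
have am : a k.+2 < s.
  by rewrite ltNge coef_ge// -/X -ltNge -ltrBlDr.
pose g := tau * s / (4 * X).
have g0 : 0 < g by rewrite divr_gt0 ?mulr_gt0.
have g1 : g <= a k - s.
  have h := coef_gap k; have sk : s <= a k.+1 by exact: sm.
  apply: (@le_trans _ _ (a k - a k.+1)); last by rewrite lerD2l lerN2.
  apply: le_trans h; rewrite /g ler_pM ?invr_ge0 ?mulr_ge0 ?(ltW tau0) ?(ltW s0) ?(ltW X0)//.
    by rewrite ler_pM2l.
  rewrite lef_pV2 ?posrE ?mulr_gt0//; last by rewrite (base_gt0 n00).
  have := base_gt0 n00 k.+1; lra.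
have g2 : g <= s - a k.+3.
  have h := coef_gap k.+2.
  apply: (@le_trans _ _ (a k.+2 - a k.+3)); last by rewrite lerD2r ltW.
  apply: le_trans h; have b3 := base_gt0 n00 k.+3.
  have x3 : k.+3%:R + n0 <= 2 * X.
    have : k.+3%:R = k.+1%:R + 2 :> R by rewrite -[k.+3]addn2 natrD.
    lra.
  have a3 : s / 2 <= a k.+3.
    rewrite /a /coef; apply: (@le_trans _ _ (D / (2 * X) `^ tau)); last first.
      rewrite ler_pM2l// lef_pV2 ?posrE ?powR_gt0 ?mulr_gt0//.
      apply: ge0_ler_powR; rewrite ?nnegrE//; [exact: ltW|exact: ltW|].
      by rewrite mulr_ge0// ltW.
    rewrite powRM ?(ltW X0)// /X -powRrM mulVf ?gt_eqF// powRr1 ?divr_ge0 ?(ltW D0) ?(ltW s0)//.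
    have -> : D / (2 `^ tau * (D / s)) = s / 2 `^ tau.
      by field; rewrite !gt_eqF// powR_gt0.
    rewrite ler_pM2l// lef_pV2 ?posrE ?powR_gt0//.
    by rewrite -[leRHS](@powRr1 R 2)// ler_powR ?ltW// ltr1n.
  have -> : g = tau * (s / 2) / (2 * X) by rewrite /g; field; rewrite gt_eqF.
  rewrite ler_pM ?invr_ge0 ?mulr_ge0 ?(ltW tau0) ?(ltW s0) ?(ltW X0)//.
    by rewrite ler_pM2l.
  by rewrite lef_pV2 ?posrE ?mulr_gt0.
have kn : (k.+3 <= n)%N.
  rewrite -(ler_nat R); apply: le_trans nX.
  have : k.+3%:R = k.+1%:R + 2 :> R by rewrite -[k.+3]addn2 natrD.
  lra.
have /andP[e1 e2] := energy_bounds (coef01 tau0 n00 D0 Dn0) (coef_decr tau0 n00 D0) s0 c0 cs sm am g0 g1 g2 kn.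
have hs := hK s c k.+2 (introT andP (conj s0 ss1)) c0 cs sm am.
rewrite -/a in e1 e2 hs.
have Pp : 0 < (\prod_(0 <= j < k.+2) growth a c s j) ^+ 2.
  by rewrite exprn_gt0// prodr_gt0// => j _; apply: growth_gt0 => //; exact: coef01.
have En0 : 0 < energy a c s n.
  by apply: energy_gt0 => //; exact: coef01.
have ell : 1 <= ln s^-1.
  rewrite lnV ?posrE// lerNr -(@expRK R (- 1)).
  by rewrite ler_ln ?posrE ?expR_gt0// ltW.
have lg : - ln g <= Kg * ln s^-1.
  have -> : - ln g = ln (4 / tau) + tau^-1 * (ln D + ln s^-1) + ln s^-1.
    rewrite /g /X ln_div ?posrE ?mulr_gt0 ?powR_gt0 ?divr_gt0//.
    rewrite !lnM ?posrE ?powR_gt0 ?divr_gt0 ?invr_gt0// ln_powR lnM ?posrE ?invr_gt0//.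
    by rewrite !lnV ?posrE//; ring.
  rewrite /Kg; have n1 := ler_norm (ln (4 / tau)); have n2 := ler_norm (ln D).
  have m1 : `|ln (4 / tau)| <= `|ln (4 / tau)| * ln s^-1 by rewrite ler_peMr.
  have m2 : `|ln D| <= `|ln D| * ln s^-1 by rewrite ler_peMr.
  have m3 : tau^-1 * (ln D + ln s^-1) <= tau^-1 * ((`|ln D| + 1) * ln s^-1).
    by rewrite ler_pM2l ?invr_gt0//; lra.
  lra.
have lg0 : 0 <= - ln g.
  rewrite oppr_ge0 ln_le0//; apply: (le_trans g1).
  have := coef_lt1 tau0 n00 D0 Dn0 k; rewrite -/a; lra.
have Kc1 : Kc <= Kc * ln s^-1 by rewrite ler_peMr// addr_ge0.
have f1 : ln (g / (2 * R0)) + ln ((\prod_(0 <= j < k.+2) growth a c s j) ^+ 2) <= ln (energy a c s n).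
  have u0 : 0 < g / (2 * R0) by rewrite divr_gt0// mulr_gt0.
  by rewrite -lnM ?posrE// ler_ln ?posrE// mulr_gt0.
have R3 : 0 < R0 ^+ 3 by rewrite exprn_gt0.
have g3 : 0 < g ^+ 3 by rewrite exprn_gt0.
have f2 : ln (energy a c s n) <= ln (4 * R0 ^+ 3 / g ^+ 3) + ln ((\prod_(0 <= j < k.+2) growth a c s j) ^+ 2).
  have u0 : 0 < 4 * R0 ^+ 3 / g ^+ 3 by rewrite divr_gt0// mulr_gt0.
  by rewrite -lnM ?posrE// ler_ln ?posrE// mulr_gt0.
move: f1 f2; rewrite ln_prod_growth//.
have -> : ln (g / (2 * R0)) = ln g - ln (2 * R0) by rewrite ln_div ?posrE// mulr_gt0.
have -> : ln (4 * R0 ^+ 3 / g ^+ 3) = ln (4 * R0 ^+ 3) - 3 * ln g.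
  by rewrite ln_div ?posrE//; [rewrite (lnXn 3 g0) [3 * _]mulr_natl|rewrite mulr_gt0].
have n1 := ler_norm (ln (2 * R0)); have n2 := ler_norm (ln (4 * R0 ^+ 3)).
have n3 : 0 <= `|ln (2 * R0)| by [].
have n4 : 0 <= `|ln (4 * R0 ^+ 3)| by [].
have Kce : Kc = `|ln (2 * R0)| + `|ln (4 * R0 ^+ 3)| by [].
move=> f1 f2.
have -> : (K + Kc + 3 * Kg) * ln s^-1 = K * ln s^-1 + Kc * ln s^-1 + 3 * (Kg * ln s^-1).
  by move: (Kc) (Kg) => u v; ring.
move: hs; rewrite !ler_norml => /andP[h1 h2].
move: (Kg * ln s^-1) (Kc * ln s^-1) (K * ln s^-1) lg Kc1 h1 h2 => u v t lg' Kc1' h1 h2.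
clear -f1 f2 h1 h2 lg' lg0 Kc1' n1 n2 n3 n4 Kce.
apply/andP; split; lra.
Qed.

End EnergyAsymptotics.

Local Open Scope complex_scope.

(** * The Szego recursion *)

Section ComplexNorm.
Variable R : realType.
Local Notation C := R[i].
Implicit Types z w u : C.

Definition normsq z : R := complex.Re z ^+ 2 + complex.Im z ^+ 2.

Lemma normsq_ge0 z : 0 <= normsq z.
Proof. by rewrite addr_ge0// sqr_ge0. Qed.

Lemma norm_normsq z : `|z| = (Num.sqrt (normsq z))%:C.
Proof. exact: normc_def. Qed.

Lemma le_norm_normsq z w : (`|z| <= `|w|) = (normsq z <= normsq w).
Proof. by rewrite !norm_normsq lecR ler_sqrt// normsq_ge0. Qed.

Lemma norm_eq1 z : (`|z| = 1) <-> normsq z = 1.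
Proof.
rewrite norm_normsq; split => [|->]; last by rewrite sqrtr1.
move=> /complexI h; have := sqr_sqrtr (normsq_ge0 z).
by rewrite h expr1n.
Qed.

Lemma normsqM z w : normsq (z * w) = normsq z * normsq w.
Proof. by case: z w => [a b] [c d]; rewrite /normsq/=; ring. Qed.

Lemma normsqX z n : normsq (z ^+ n) = normsq z ^+ n.
Proof.
elim: n => [|n ih]; first by rewrite /normsq/= expr1n expr0n/= addr0.
by rewrite !exprS normsqM ih.
Qed.

Lemma mul_conjc z : z * conjc z = (normsq z)%:C.
Proof. by case: z => [a b]; rewrite /normsq/=; simpc; congr (_ +i* _); ring. Qed.

Lemma conjcM z w : conjc (z * w) = conjc z * conjc w.
Proof. exact: rmorphM. Qed.

Lemma conjcD z w : conjc (z + w) = conjc z + conjc w.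
Proof. exact: rmorphD. Qed.

Lemma conjcX z n : conjc (z ^+ n) = conjc z ^+ n.
Proof. exact: rmorphXn. Qed.

Lemma norm_combine (a : R) w u : 0 <= a <= 1 -> `|w| <= `|u| ->
  `|w + a%:C * u| <= `|u + a%:C * w|.
Proof.
move=> /andP[a0 a1]; rewrite !le_norm_normsq; case: w u => [w1 w2] [u1 u2].
rewrite /normsq /= !mul0r !subr0 !addr0 => h; rewrite -subr_ge0.
have -> : (u1 + a * w1) ^+ 2 + (u2 + a * w2) ^+ 2 - ((w1 + a * u1) ^+ 2 + (w2 + a * u2) ^+ 2)
  = (1 - a ^+ 2) * (u1 ^+ 2 + u2 ^+ 2 - (w1 ^+ 2 + w2 ^+ 2)) by ring.
by rewrite mulr_ge0 ?subr_ge0// expr_le1.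
Qed.

End ComplexNorm.

Section Szego.
Variable R : realType.
Local Notation C := R[i].
Variable a : nat -> R.
Hypothesis a01 : forall n, 0 < a n < 1.

(** The second component is the reversal of the first one: the value of [Psi] at
    [z] is [z ^+ n] times the conjugate of the value of [Phi] at [1 / conj z].
    Running the two recursions together avoids coefficient manipulations. *)
Fixpoint szego (n : nat) : {poly C} * {poly C} :=
  if n is m.+1 then
    let: (p, q) := szego m in
    (((rho a m)^-1)%:C *: ('X * p + (a m)%:C *: q),
     ((rho a m)^-1)%:C *: (q + (a m)%:C *: ('X * p)))
  else (1, 1).

Definition Phi n := (szego n).1.
Definition Psi n := (szego n).2.

Lemma PhiS n : Phi n.+1 = ((rho a n)^-1)%:C *: ('X * Phi n + (a n)%:C *: Psi n).
Proof. by rewrite /Phi /Psi /=; case: (szego n). Qed.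

Lemma PsiS n : Psi n.+1 = ((rho a n)^-1)%:C *: (Psi n + (a n)%:C *: ('X * Phi n)).
Proof. by rewrite /Phi /Psi /=; case: (szego n). Qed.

Lemma PhiSE n z : (Phi n.+1).[z] =
  ((rho a n)^-1)%:C * (z * (Phi n).[z] + (a n)%:C * (Psi n).[z]).
Proof. by rewrite PhiS !hornerE. Qed.

Lemma PsiSE n z : (Psi n.+1).[z] =
  ((rho a n)^-1)%:C * ((Psi n).[z] + (a n)%:C * (z * (Phi n).[z])).
Proof. by rewrite PsiS !hornerE. Qed.

Lemma szego_rev n (z : C) : z != 0 ->
  (Psi n).[z] = z ^+ n * conjc ((Phi n).[(conjc z)^-1]).
Proof.
elim: n z => [|n ih] z z0.
  by rewrite /Phi /Psi /= !hornerE conjc1.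
have zc : conjc z != 0 by rewrite conjc_eq0.
have ih2 := ih _ (invr_neq0 zc).
rewrite conjc_inv conjcK invrK in ih2.
rewrite PsiSE PhiSE ih2 !(conjcM, conjcD, conjcX, conjc_real).
rewrite !conjc_inv !conjcK (ih z z0) exprS exprVn.
have : z ^+ n != 0 by rewrite expf_neq0.
move: (z ^+ n) (conjc _) (Phi n).[z] (_%:C) (_%:C) => w A B r t w0.
by field; rewrite z0 w0.
Qed.

Lemma szego_circle n (c s : R) : c ^+ 2 + s ^+ 2 = 1 ->
  let z := c +i* s in let u := transfer a c s n in
  (Phi n).[z ^+ 2] = z ^+ n * (u.1 +i* u.2) /\
  (Psi n).[z ^+ 2] = z ^+ n * (u.1 -i* u.2).
Proof.
move=> cs z; elim: n => [|n [ih1 ih2]].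
  by rewrite /Phi /Psi /= !hornerE oppr0.
rewrite PhiSE PsiSE ih1 ih2 /=.
set u := transfer a c s n.
have e1 : z * conjc z = 1 by rewrite mul_conjc /normsq/= cs.
have r0 : rho a n != 0 by rewrite lt0r_neq0// rho_gt0.
have gen (w U V t : C) : z ^+ 2 * (w * U) + t * (w * V) = z * w * (z * U + t * (conjc z * V)).
  move: e1; move: (conjc z) => y e1.
  have -> : z * w * (z * U + t * (y * V)) = z ^+ 2 * (w * U) + (z * y) * (t * (w * V)) by ring.
  by rewrite e1 mul1r.
have gen2 (w U V t : C) : w * V + t * (z ^+ 2 * (w * U)) = z * w * (conjc z * V + t * (z * U)).
  move: e1; move: (conjc z) => y e1.
  have -> : z * w * (y * V + t * (z * U)) = (z * y) * (w * V) + t * (z ^+ 2 * (w * U)) by ring.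
  by rewrite e1 mul1r.
split.
  rewrite gen -exprS mulrCA; congr (_ * _); rewrite /z; simpc.
  by congr (_ +i* _); field.
rewrite gen2 -exprS mulrCA; congr (_ * _); rewrite /z; simpc.
by congr (_ +i* _); field.
Qed.

(** In the closed disk [z * Phi] is dominated by [Psi]; this propagates along
    the recursion by [norm_combine], and [a n < 1] then rules out
    cancellation in the recursion for [Psi]. *)
Lemma Psi_neq0 n (z : C) : `|z| <= 1 ->
  `|(Phi n).[z]| <= `|(Psi n).[z]| /\ (Psi n).[z] != 0.
Proof.
move=> z1; elim: n => [|n [ih1 ih2]].
  by rewrite /Phi /Psi /= !hornerE lexx oner_neq0.
have /andP[a0 a1] := a01 n.
have r0 : ((rho a n)^-1)%:C != 0 :> C.
  rewrite -[0]/((0 : R)%:C) (inj_eq (@complexI R)) invr_neq0// lt0r_neq0// rho_gt0//.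
have w1 : `|z * (Phi n).[z]| <= `|(Psi n).[z]|.
  by rewrite normrM (le_trans _ ih1)// ler_piMl.
rewrite PhiSE PsiSE; split.
  by rewrite !normrM ler_wpM2l// norm_combine// !ltW.
rewrite mulf_neq0//; apply/eqP => e.
have n0 : 0 < `|(Psi n).[z]| by rewrite normr_gt0.
have : `|(Psi n).[z]| <= (a n)%:C * `|(Psi n).[z]|.
  have {1}-> : (Psi n).[z] = - ((a n)%:C * (z * (Phi n).[z])) by apply/eqP; rewrite -addr_eq0 e.
  by rewrite normrN normrM ger0_norm ?ler0c ?(ltW a0)// ler_wpM2l// ler0c ltW.
have lt1 : (a n)%:C * `|(Psi n).[z]| < `|(Psi n).[z]|.
  by rewrite gtr_pMl// -[1]/((1 : R)%:C) ltcR.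
by move=> /le_lt_trans/(_ lt1); rewrite ltxx.
Qed.


End Szego.

(** * Mean values over the circle *)
Section MeanValue.
Variable R : realType.
Local Notation C := R[i].
Local Notation mu := (@lebesgue_measure R).

Lemma contD (f g : R -> R) : continuous f -> continuous g -> continuous (fun t => f t + g t).
Proof. by move=> cf cg t; exact: (@continuousD R R R f g t (cf t) (cg t)). Qed.

Lemma contN (f : R -> R) : continuous f -> continuous (fun t => - f t).
Proof. by move=> cf t; exact: (@continuousN R R R f t (cf t)). Qed.

Lemma contM (f g : R -> R) : continuous f -> continuous g -> continuous (fun t => f t * g t).
Proof. by move=> cf cg t; exact: (@continuousM R R f g t (cf t) (cg t)). Qed.

Lemma contV (f : R -> R) : (forall t, f t != 0) -> continuous f -> continuous (fun t => (f t)^-1).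
Proof. by move=> f0 cf t; exact: (@continuousV R R f t (f0 t) (cf t)). Qed.

Lemma cont_cst (k : R) : continuous (fun _ : R => k).
Proof. by move=> ?; exact: cst_continuous. Qed.

Definition cexp (t : R) : C := cos t +i* sin t.

Lemma normsq_cexp t : normsq (cexp t) = 1.
Proof. by rewrite /normsq/= cos2Dsin2. Qed.

Lemma norm_cexp t : `|cexp t| = 1.
Proof. by apply/norm_eq1; exact: normsq_cexp. Qed.

Lemma cexpD t u : cexp (t + u) = cexp t * cexp u.
Proof. by rewrite /cexp cosD sinD; simpc; congr (_ +i* _); ring. Qed.

Lemma cexpX t k : cexp t ^+ k = cexp (k%:R * t).
Proof.
elim: k => [|k ih]; first by rewrite expr0 mul0r /cexp cos0 sin0.
by rewrite exprS ih -cexpD -[k.+1%:R]natr1 mulrDl mul1r addrC.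
Qed.

Definition ccont (g : R -> C) : Prop :=
  continuous (fun t => complex.Re (g t)) /\ continuous (fun t => complex.Im (g t)).

Lemma ccont_cst c : ccont (fun=> c).
Proof. by split; exact: cst_continuous. Qed.

Lemma ccont_cexp : ccont cexp.
Proof. by split; [exact: continuous_cos|exact: continuous_sin]. Qed.

Lemma ccontD f g : ccont f -> ccont g -> ccont (fun t => f t + g t).
Proof.
move=> [f1 f2] [g1 g2]; split.
  have -> : (fun t => complex.Re (f t + g t)) = (fun t => complex.Re (f t) + complex.Re (g t)).
    by apply/funext => t; case: (f t) (g t) => [a b] [d e].
  exact: contD.
have -> : (fun t => complex.Im (f t + g t)) = (fun t => complex.Im (f t) + complex.Im (g t)).
  by apply/funext => t; case: (f t) (g t) => [a b] [d e].
exact: contD.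
Qed.

Lemma ccontM f g : ccont f -> ccont g -> ccont (fun t => f t * g t).
Proof.
move=> [f1 f2] [g1 g2]; split.
  have -> : (fun t => complex.Re (f t * g t)) =
      (fun t => complex.Re (f t) * complex.Re (g t) - complex.Im (f t) * complex.Im (g t)).
    by apply/funext => t; case: (f t) (g t) => [a b] [d e].
  by apply: contD; [exact: contM|apply: contN; exact: contM].
have -> : (fun t => complex.Im (f t * g t)) =
    (fun t => complex.Re (f t) * complex.Im (g t) + complex.Im (f t) * complex.Re (g t)).
  by apply/funext => t; case: (f t) (g t) => [a b] [d e].
by apply: contD; exact: contM.
Qed.

Lemma ccontV f : (forall t, f t != 0) -> ccont f -> ccont (fun t => (f t)^-1).
Proof.
move=> f0 [f1 f2].
have n0 t : normsq (f t) != 0.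
  move: (f0 t); case: (f t) => [x y]; rewrite eq_complex/= negb_and /normsq/=.
  rewrite paddr_eq0 ?sqr_ge0// !sqrf_eq0 negb_and //.
have cn : continuous (fun t => (normsq (f t))^-1).
  by apply: contV => //; apply: contD; apply: contM.
split.
  have -> : (fun t => complex.Re (f t)^-1) = (fun t => complex.Re (f t) * (normsq (f t))^-1).
    by apply/funext => t; case: (f t) => [x y].
  exact: contM.
have -> : (fun t => complex.Im (f t)^-1) = (fun t => - complex.Im (f t) * (normsq (f t))^-1).
  by apply/funext => t; case: (f t) => [x y] /=; rewrite mulNr.
by apply: contM => //; exact: contN.
Qed.

Lemma ccont_horner (p : {poly C}) : ccont (fun t => p.[cexp t]).
Proof.
elim/poly_ind: p => [|p c ih].
  by under eq_fun do rewrite horner0; exact: ccont_cst.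
under eq_fun do rewrite !hornerE.
by apply: ccontD; [apply: ccontM; [exact: ih|exact: ccont_cexp]|exact: ccont_cst].
Qed.

Definition turn (f : R -> R) : R := (\int[mu]_(t in `[0%R, 2 * pi]) f t)%R.

Lemma cont_integrable (f : R -> R) : continuous f ->
  mu.-integrable `[0, 2 * pi] (EFin \o f).
Proof.
move=> cf; apply: continuous_compact_integrable; first exact: segment_compact.
exact: continuous_subspaceT.
Qed.

Lemma turnD (f g : R -> R) : continuous f -> continuous g ->
  turn (fun t => f t + g t) = turn f + turn g.
Proof. by move=> cf cg; rewrite /turn RintegralD//; exact: cont_integrable. Qed.

Lemma turnZ (k : R) (f : R -> R) : continuous f -> turn (fun t => k * f t) = k * turn f.
Proof. by move=> cf; rewrite /turn RintegralZl//; exact: cont_integrable. Qed.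

Lemma turnN (f : R -> R) : continuous f -> turn (fun t => - f t) = - turn f.
Proof.
move=> cf; rewrite -[RHS]mulN1r -turnZ//; congr turn.
by apply/funext => t; rewrite mulN1r.
Qed.

Lemma turn_le (f g : R -> R) : continuous f -> continuous g -> (forall t, f t <= g t) -> turn f <= turn g.
Proof. by move=> cf cg fg; apply: le_Rintegral => //; exact: cont_integrable. Qed.

Lemma twopi_gt0 : 0 < 2 * pi :> R.
Proof. by rewrite mulr_gt0// pi_gt0. Qed.

Lemma turn_cst k : turn (fun=> k) = 2 * pi * k.
Proof.
rewrite /turn Rintegral_cst//= lebesgue_measure_itv/= lte_fin twopi_gt0.
by rewrite -EFinB subr0/= mulrC.
Qed.

Lemma turn_derive (f F : R -> R) : continuous f ->
  (forall t : R, is_derive t 1 F (f t)) -> turn f = F (2 * pi) - F 0.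
Proof.
move=> cf dF; rewrite /turn /Rintegral (@continuous_FTC2 _ f F)//.
- exact: twopi_gt0.
- exact: continuous_subspaceT.
- have cF t : {for t, continuous F}.
    apply: differentiable_continuous; apply/derivable1_diffP.
    by have /@ex_derive := dF t.
  split.
  + by move=> t _; have /@ex_derive := dF t.
  + by apply: cvg_at_right_filter; exact: cF.
  + by apply: cvg_at_left_filter; exact: cF.
- by move=> t _; rewrite derive1E; have /@derive_val := dF t.
Qed.

Lemma is_derive_mull (k t : R) : is_derive t 1 (fun t => k * t) k.
Proof.
have h := is_deriveZ k (is_derive_id t (1 : R)).
by apply: (is_derive_eq h); rewrite /GRing.scale/= mulr1.
Qed.

Lemma trig_multiple k : sin (k%:R * (2 * pi)) = 0 :> R /\ cos (k%:R * (2 * pi)) = 1 :> R.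
Proof.
elim: k => [|k [ih1 ih2]]; first by rewrite mul0r sin0 cos0.
have -> : k.+1%:R * (2 * pi) = k%:R * (2 * pi) + pi *+ 2 :> R.
  by rewrite -[pi *+ 2]mulr_natl -natr1; ring.
by rewrite sinD2pi cosD2pi.
Qed.

Lemma continuous_cosM (k : R) : continuous (fun t : R => cos (k * t)).
Proof.
move=> t; apply: (@continuous_comp R R R (fun t => k * t) cos t).
  exact: mulrl_continuous.
exact: continuous_cos.
Qed.

Lemma continuous_sinM (k : R) : continuous (fun t : R => sin (k * t)).
Proof.
move=> t; apply: (@continuous_comp R R R (fun t => k * t) sin t).
  exact: mulrl_continuous.
exact: continuous_sin.
Qed.

Lemma turn_cos k : (0 < k)%N -> turn (fun t => cos (k%:R * t)) = 0.
Proof.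
move=> k0; have kn : k%:R != 0 :> R by rewrite pnatr_eq0 -lt0n.
pose F t : R := k%:R^-1 * sin (k%:R * t).
transitivity (F (2 * pi) - F 0); last first.
  by rewrite /F (trig_multiple k).1 !mulr0 sin0 mulr0 subr0.
apply: turn_derive.
- exact: continuous_cosM.
- move=> t.
  have h := is_derive1_comp (is_derive_sin (k%:R * t)) (is_derive_mull k%:R t).
  apply: (is_derive_eq (is_deriveZ k%:R^-1 h)).
  by rewrite /GRing.scale/=; field.
Qed.

Lemma turn_sin k : turn (fun t => sin (k%:R * t)) = 0.
Proof.
have [->|k0] := posnP k.
  rewrite /turn; under eq_Rintegral do rewrite mul0r sin0.
  by rewrite Rintegral_cst// mul0r.
have kn : k%:R != 0 :> R by rewrite pnatr_eq0 -lt0n.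
pose F t : R := - k%:R^-1 * cos (k%:R * t).
transitivity (F (2 * pi) - F 0); last first.
  by rewrite /F (trig_multiple k).2 !mulr0 cos0 subrr.
apply: turn_derive.
- exact: continuous_sinM.
- move=> t.
  have h := is_derive1_comp (is_derive_cos (k%:R * t)) (is_derive_mull k%:R t).
  apply: (is_derive_eq (is_deriveZ (- k%:R^-1) h)).
  by rewrite /GRing.scale/=; field.
Qed.

Lemma turn_monomial (c : C) k :
  turn (fun t => complex.Re (c * cexp t ^+ k)) = 2 * pi * (complex.Re c *+ (k == 0)%N).
Proof.
have -> : (fun t => complex.Re (c * cexp t ^+ k)) =
    (fun t => complex.Re c * cos (k%:R * t) + - complex.Im c * sin (k%:R * t)).
  by apply/funext => t; rewrite cexpX; case: c => [x y] /=; rewrite mulNr.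
have cc := @continuous_cosM k%:R; have cs := @continuous_sinM k%:R.
rewrite turnD; [|by apply: contM => //; exact: cont_cst|by apply: contM => //; exact: cont_cst].
rewrite !turnZ// turn_sin mulr0 addr0.
have [->|k0] := posnP k; last by rewrite turn_cos// ?mulr0n !mulr0.
have -> : (fun t : R => cos (0%:R * t)) = (fun=> 1) by apply/funext => t; rewrite mul0r cos0.
by rewrite turn_cst ?eqxx mulr1n mulrC mulr1.
Qed.

Lemma ReD (x y : C) : complex.Re (x + y) = complex.Re x + complex.Re y.
Proof. by case: x y => [? ?] [? ?]. Qed.

Lemma Re_continuous_horner (p : {poly C}) : continuous (fun t => complex.Re p.[cexp t]).
Proof. by have [] := ccont_horner p. Qed.

Lemma turn_poly (p : {poly C}) :
  turn (fun t => complex.Re p.[cexp t]) = 2 * pi * complex.Re p.[0].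
Proof.
have key n (f : nat -> C) : continuous (fun t => complex.Re (\sum_(0 <= i < n.+1) f i * cexp t ^+ i)) /\
    turn (fun t => complex.Re (\sum_(0 <= i < n.+1) f i * cexp t ^+ i)) = 2 * pi * complex.Re (f 0%N).
  have cm i : continuous (fun t => complex.Re (f i * cexp t ^+ i)).
    have -> : (fun t => complex.Re (f i * cexp t ^+ i)) = (fun t => complex.Re (f i *: 'X^i).[cexp t]).
      by apply/funext => t; rewrite !hornerE.
    exact: Re_continuous_horner.
  elim: n => [|n [ih1 ih2]].
    split; first by under eq_fun do rewrite big_nat1; exact: cm.
    have -> : (fun t => complex.Re (\sum_(0 <= i < 1) f i * cexp t ^+ i)) =
       (fun t => complex.Re (f 0%N * cexp t ^+ 0)) by apply/funext => t; rewrite big_nat1.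
    by rewrite turn_monomial ?eqxx mulr1n.
  have -> : (fun t => complex.Re (\sum_(0 <= i < n.+2) f i * cexp t ^+ i)) =
     (fun t => complex.Re (\sum_(0 <= i < n.+1) f i * cexp t ^+ i) + complex.Re (f n.+1 * cexp t ^+ n.+1)).
    by apply/funext => t; rewrite big_nat_recr//= ReD.
  split; first exact: contD.
  by rewrite turnD// ih2 turn_monomial mulr0n mulr0 addr0.
have h (x : C) : p.[x] = \sum_(0 <= i < (size p).+1) p`_i * x ^+ i.
  rewrite horner_coef big_nat_recr//= nth_default// mul0r addr0 big_mkord //.
have -> : (fun t => complex.Re p.[cexp t]) =
   (fun t => complex.Re (\sum_(0 <= i < (size p).+1) p`_i * cexp t ^+ i)).
  by apply/funext => t; rewrite h.
by rewrite (key _ (fun i => p`_i)).2 horner_coef0.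
Qed.

(** [c] stands for the value at the origin of the extension of [g] to the disk.
    Uniform approximation by polynomials replaces holomorphy here: it suffices
    for the mean value property, and is stable under products and under
    inverses of polynomials without zeros in the closed disk. *)
Definition disk_alg (g : C -> C) (c : C) : Prop :=
  forall e : R, 0 < e -> exists2 p : {poly C}, p.[0] = c &
    forall z, `|z| = 1 -> `|p.[z] - g z| <= e%:C.

Lemma poly_circle_bound (p : {poly C}) : exists2 M : R, 0 <= M &
  forall z : C, `|z| = 1 -> `|p.[z]| <= M%:C.
Proof.
elim/poly_ind: p => [|p c [M M0 hM]].
  by exists 0 => // z _; rewrite horner0 normr0.
exists (M + Num.sqrt (normsq c)); first by rewrite addr_ge0// sqrtr_ge0.
move=> z z1; rewrite !hornerE; apply: (le_trans (ler_normD _ _)).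
rewrite normrM z1 mulr1 rmorphD/= lerD ?hM//.
by rewrite norm_normsq.
Qed.

Lemma disk_alg_bound g c : disk_alg g c -> exists2 M : R, 0 <= M &
  forall z : C, `|z| = 1 -> `|g z| <= M%:C.
Proof.
move=> /(_ 1 ltr01)[p _ hp]; have [M M0 hM] := poly_circle_bound p.
exists (M + 1); first by rewrite addr_ge0.
move=> z z1; have -> : g z = p.[z] - (p.[z] - g z) by ring.
by rewrite (le_trans (ler_normB _ _))// rmorphD/= lerD ?hM ?hp.
Qed.

Lemma disk_alg_poly p : disk_alg (fun z => p.[z]) p.[0].
Proof. by move=> e e0; exists p => // z _; rewrite subrr normr0 ler0c ltW. Qed.

Lemma disk_algM g h c d : disk_alg g c -> disk_alg h d ->
  disk_alg (fun z => g z * h z) (c * d).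
Proof.
move=> hg hh; have [Mg Mg0 bg] := disk_alg_bound hg.
have [Mh Mh0 bh] := disk_alg_bound hh.
move=> e e0.
pose e1 := e / (2 * (Mh + 1)); pose e2 := Num.min 1 (e / (2 * (Mg + 1))).
have Mg1 : 0 < Mg + 1 by rewrite ltr_wpDl.
have Mh1 : 0 < Mh + 1 by rewrite ltr_wpDl.
have e10 : 0 < e1 by rewrite divr_gt0// mulr_gt0.
have e20 : 0 < e2 by rewrite lt_min ltr01 divr_gt0// mulr_gt0.
pose e3 := e / (2 * (Mg + 1)).
have eE : e = e1 * (Mh + 1) + (Mg + 1) * e3 by rewrite /e1 /e3; field; rewrite !gt_eqF.
have e21 : e2 <= 1 by rewrite ge_min lexx.
have e23 : e2 <= e3 by rewrite ge_min lexx orbT.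
clearbody e1 e2 e3.
have [p p0 hp] := hg e1 e10; have [q q0 hq] := hh e2 e20.
exists (p * q); first by rewrite hornerM p0 q0.
move=> z z1; rewrite hornerM.
have -> : p.[z] * q.[z] - g z * h z = (p.[z] - g z) * q.[z] + g z * (q.[z] - h z) by ring.
apply: (le_trans (ler_normD _ _)); rewrite !normrM.
have bq : `|q.[z]| <= (Mh + 1)%:C.
  have -> : q.[z] = h z + (q.[z] - h z) by ring.
  rewrite (le_trans (ler_normD _ _))// rmorphD/= lerD ?bh//.
  by apply: (le_trans (hq _ z1)); rewrite lecR.
rewrite eE rmorphD !rmorphM/=; apply: lerD; apply: ler_pM => //.
- exact: hp.
- by apply: (le_trans (bg _ z1)); rewrite lecR lerDl.
by apply: (le_trans (hq _ z1)); rewrite lecR.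
Qed.

Lemma disk_alg_geometric (w : C) : `|w| < 1 -> disk_alg (fun z => (1 - w * z)^-1) 1.
Proof.
move=> w1 e e0; set r := Num.sqrt (normsq w).
have wr : `|w| = r%:C by exact: norm_normsq.
have r0 : 0 <= r by exact: sqrtr_ge0.
have r1 : r < 1 by move: w1; rewrite wr -[1]/((1 : R)%:C) ltcR.
have r1' : 0 < 1 - r by rewrite subr_gt0.
have [N hN] : exists N, r ^+ N <= e * (1 - r).
  have : (fun n => r ^+ n) @ \oo --> (0 : R) by apply: cvg_expr; rewrite ger0_norm.
  move=> /cvgrPdist_le/(_ (e * (1 - r)) (mulr_gt0 e0 r1'))[N _ /(_ N (leqnn N))] /=.
  by rewrite sub0r normrN ger0_norm ?exprn_ge0// => h; exists N.
have N0 : (0 < N.+1)%N by [].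
exists (\sum_(i < N.+1) (w *: 'X) ^+ i).
  rewrite horner_sum big_ord_recl big1 ?addr0; first by rewrite !hornerE.
  by move=> i _; rewrite horner_exp !hornerE ?mulr0 expr0n.
move=> z z1; have wz : `|w * z| = r%:C by rewrite normrM z1 mulr1.
have nz : 1 - w * z != 0.
  by rewrite subr_eq0; apply/eqP => h; move: wz r1; rewrite -h normr1 => /complexI <-; rewrite ltxx.
have -> : (\sum_(i < N.+1) (w *: 'X) ^+ i).[z] = \sum_(i < N.+1) (w * z) ^+ i.
  by rewrite horner_sum; apply: eq_bigr => i _; rewrite horner_exp !hornerE.
have -> : \sum_(i < N.+1) (w * z) ^+ i - (1 - w * z)^-1 = - (w * z) ^+ N.+1 / (1 - w * z).
  apply: (mulIf nz); rewrite mulrBl mulVf// divfK//.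
  have h := subrX1 (w * z) N.+1.
  set S := \sum_(i < N.+1) _ in h *.
  have -> : S * (1 - w * z) = - ((w * z - 1) * S) by ring.
  by rewrite -h; ring.
rewrite normrM normrN normrX wz normfV.
have d : (1 - r)%:C <= `|1 - w * z|.
  by rewrite rmorphB/= -wz -[X in X - _](@normr1 C); exact: lerB_dist.
have d0 : 0 < (1 - r)%:C :> C by rewrite ltcR.
rewrite ler_pdivrMr ?(lt_le_trans d0)//.
apply: (@le_trans _ _ (e%:C * (1 - r)%:C)); last by rewrite ler_wpM2l// ler0c ltW.
rewrite -rmorphXn -rmorphM/= lecR; apply: le_trans hN.
by rewrite exprS ler_piMl ?exprn_ge0// ltW.
Qed.

(** Every root of the polynomial lies outside the closed disk, so that the
    inverse of each linear factor is a geometric series. *)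
Lemma disk_alg_inv_poly (p : {poly C}) : (forall z, `|z| <= 1 -> p.[z] != 0) ->
  disk_alg (fun z => (p.[z])^-1) (p.[0])^-1.
Proof.
have [r ->] := closed_field_poly_normal p; set k := lead_coef p => h.
have k0 : k != 0.
  have := h 0; rewrite normr0 ler01 => /(_ isT); apply: contra => /eqP ->.
  by rewrite scale0r horner0.
have {}h : forall z : C, `|z| <= 1 -> (\prod_(x <- r) ('X - x%:P)).[z] != 0.
  by move=> z /h; rewrite hornerZ mulf_eq0 negb_or => /andP[].
have -> : (fun z => ((k *: \prod_(x <- r) ('X - x%:P)).[z])^-1) =
  (fun z => (k^-1%:P).[z] * ((\prod_(x <- r) ('X - x%:P)).[z])^-1).
  by apply/funext => z; rewrite hornerZ hornerC invfM.
suff H : disk_alg (fun z => ((\prod_(x <- r) ('X - x%:P)).[z])^-1) ((\prod_(x <- r) ('X - x%:P)).[0])^-1.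
  have := disk_algM (disk_alg_poly (k^-1)%:P) H.
  by rewrite hornerZ invfM (hornerC k^-1 0).
elim: r h => [|x r ih] h.
  have e (x : C) : (\prod_(y <- [::]) ('X - y%:P)).[x]^-1 = (1 : {poly C}).[x].
    by rewrite big_nil hornerC invr1.
  by rewrite (funext e) e; exact: disk_alg_poly.
have hx : 1 < `|x|.
  rewrite real_ltNge ?normr_real ?real1//; apply/negP => x1.
  have := h x x1; rewrite big_cons hornerM hornerXsubC subrr mul0r eqxx //.
have x0 : x != 0 by rewrite -normr_gt0 (lt_trans ltr01).
have -> : (fun z : C => (\prod_(j <- (x :: r)) ('X - j%:P)).[z]^-1) =
  (fun z => (((- x^-1)%:P).[z] * (1 - x^-1 * z)^-1) * ((\prod_(j <- r) ('X - j%:P)).[z])^-1).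
  apply/funext => z; rewrite big_cons hornerM invfM hornerXsubC hornerC.
  congr (_ * _); rewrite -invrN -invfM; congr (_^-1).
  by rewrite mulNr mulrBr mulr1 mulrA divff// mul1r opprB.
have -> : (\prod_(j <- (x :: r)) ('X - j%:P)).[0]^-1 =
  (((- x^-1)%:P).[0] * 1) * ((\prod_(j <- r) ('X - j%:P)).[0])^-1.
  by rewrite big_cons hornerM invfM hornerXsubC hornerC sub0r invrN mulr1.
apply: disk_algM; last first.
  by apply: ih => z /h; rewrite big_cons hornerM mulf_eq0 negb_or => /andP[].
apply: disk_algM; first exact: disk_alg_poly.
by apply: disk_alg_geometric; rewrite normfV invf_lt1// (lt_trans ltr01).
Qed.

Lemma Re_le_norm (z : C) (e : R) : `|z| <= e%:C -> `|complex.Re z| <= e.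
Proof.
rewrite norm_normsq lecR; apply: le_trans; rewrite -sqrtr_sqr ler_wsqrtr//.
by rewrite lerDl sqr_ge0.
Qed.

Lemma turn_mean g c : disk_alg g c -> ccont (fun t => g (cexp t)) ->
  turn (fun t => complex.Re (g (cexp t))) = 2 * pi * complex.Re c.
Proof.
move=> hg [cg _]; apply/eqP; rewrite -subr_eq0 -normr_le0; apply/ler_addgt0Pr => e e0.
have p0 := twopi_gt0.
have [p pc hp] := hg (e / (2 * pi)) (divr_gt0 e0 p0).
rewrite add0r -pc -turn_poly -turnN; last exact: Re_continuous_horner.
have cp := @Re_continuous_horner p.
have cpN : continuous (fun t => - complex.Re p.[cexp t]) by exact: contN.
rewrite -turnD//.
have b t : `|complex.Re (g (cexp t)) - complex.Re p.[cexp t]| <= e / (2 * pi).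
  rewrite distrC; have := Re_le_norm (hp _ (norm_cexp t)).
  by case: (p.[cexp t]) (g (cexp t)) => [? ?] [? ?].
have ce : continuous (fun t => complex.Re (g (cexp t)) - complex.Re p.[cexp t]).
  exact: contD.
have te : e = turn (fun=> e / (2 * pi)) by rewrite turn_cst mulrC divfK// gt_eqF.
have cst := cont_cst.
rewrite ler_norml; apply/andP; split.
  rewrite {1}te -turnN//; apply: turn_le => // t.
  by have := b t; rewrite ler_norml => /andP[].
rewrite [leRHS]te; apply: turn_le => // t.
by have := b t; rewrite ler_norml => /andP[].
Qed.

End MeanValue.

(** * Bernstein--Szego approximation *)
Section Plane.
Variable R : realType.
Local Notation C := R[i].

Lemma normsq_lt (z w : C) (e : R) : 0 < e -> `|z - w| < e%:C ->
  `|complex.Re z - complex.Re w| < e /\ `|complex.Im z - complex.Im w| < e.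
Proof.
move=> e0; rewrite norm_normsq ltcR => h.
have b (x : R) : x ^+ 2 <= normsq (z - w) -> `|x| < e.
  move=> xh; apply: le_lt_trans h; rewrite -sqrtr_sqr ler_wsqrtr//.
case: z w h b => [z1 z2] [w1 w2] /= _ b.
by split; apply: b; rewrite /normsq/= ?lerDl ?lerDr sqr_ge0.
Qed.

Lemma measurable_plane (f : plane R -> R) :
  (forall z (e : R), 0 < e -> exists2 d : R, 0 < d &
     forall w : C, `|(z : C) - w| < d%:C -> `|f z - f w| < e) ->
  measurable_fun setT f.
Proof.
move=> cf; apply: (measurability _ (RGenOpens.measurableE R)).
move=> _ [_ [x [y ->] <-]]; rewrite setTI; apply: sub_sigma_algebra.
rewrite openE => z /=; rewrite in_itv/= => /andP[xz zy].
pose e := Num.min (f z - x) (y - f z).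
have e0 : 0 < e by rewrite lt_min !subr_gt0 xz.
have [d d0 hd] := cf z e e0.
apply/nbhs_ballP; exists (d%:C) => /=; first by rewrite ltcR.
move=> w /= zw; have := hd w zw; rewrite lt_min ltr_norml in_itv/= => h.
by move: h; rewrite !ltr_norml => /andP[/andP[h1 h2] /andP[h3 h4]]; apply/andP; split; lra.
Qed.

Lemma measurable_Re : measurable_fun setT (fun z : plane R => complex.Re z).
Proof. by apply: measurable_plane => z e e0; exists e => // w /(normsq_lt e0)[]. Qed.

Lemma measurable_Im : measurable_fun setT (fun z : plane R => complex.Im z).
Proof. by apply: measurable_plane => z e e0; exists e => // w /(normsq_lt e0)[]. Qed.

Lemma measurable_horner (p : {poly C}) :
  measurable_fun setT (fun z : plane R => complex.Re p.[z]) /\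
  measurable_fun setT (fun z : plane R => complex.Im p.[z]).
Proof.
elim/poly_ind: p => [|p c [ih1 ih2]].
  by split; under eq_fun do rewrite horner0; exact: measurable_cst.
split.
  have -> : (fun z : plane R => complex.Re (p * 'X + c%:P).[z]) = (fun z : plane R =>
     complex.Re p.[z] * complex.Re z - complex.Im p.[z] * complex.Im z + complex.Re c).
    apply/funext => z; rewrite hornerMXaddC; move: z => [x y].
    by case: (p.[_]) c => [u v] [k l].
  apply: measurable_funD => //; apply: measurable_funB; apply: measurable_funM => //;
    [exact: measurable_Re|exact: measurable_Im].
have -> : (fun z : plane R => complex.Im (p * 'X + c%:P).[z]) = (fun z : plane R =>
     complex.Re p.[z] * complex.Im z + complex.Im p.[z] * complex.Re z + complex.Im c).
  apply/funext => z; rewrite hornerMXaddC; move: z => [x y].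
  by case: (p.[_]) c => [u v] [k l].
apply: measurable_funD => //; apply: measurable_funD; apply: measurable_funM => //;
  [exact: measurable_Im|exact: measurable_Re].
Qed.

Lemma measurable_circle : measurable (@unit_circle R).
Proof.
have -> : @unit_circle R = (fun z : plane R => normsq z) @^-1` [set 1].
  by apply/seteqP; split => z /=; rewrite /unit_circle/= => /norm_eq1.
rewrite -[X in measurable X]setTI.
have m : measurable_fun setT (fun z : plane R => normsq z).
  apply: measurable_funD; apply: measurable_funX; [exact: measurable_Re|exact: measurable_Im].
by apply: m.
Qed.

Variable mu : probability (plane R) R.
Hypothesis mu1 : mu (@unit_circle R) = 1%E.

Lemma circle_integrable (f : plane R -> R) (M : R) : measurable_fun setT f ->
  (forall z, unit_circle z -> `|f z| <= M) -> mu.-integrable (@unit_circle R) (EFin \o f).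
Proof.
move=> mf hM; apply: (@le_integrable _ _ _ mu _ measurable_circle _ (cst M%:E)).
- by apply/measurable_EFinP; apply: measurable_funS mf.
- by move=> z cz /=; rewrite lee_fin (le_trans (hM z cz))// ler_norm.
- exact: (finite_measure_integrable_cst mu M measurable_circle).
Qed.

Lemma circle_horner_integrable (p : {poly C}) :
  mu.-integrable (@unit_circle R) (EFin \o (fun z : plane R => complex.Re p.[z])) /\
  mu.-integrable (@unit_circle R) (EFin \o (fun z : plane R => complex.Im p.[z])).
Proof.
have [M M0 hM] := poly_circle_bound p; have [m1 m2] := measurable_horner p.
have b (z : C) : `|z| <= M%:C -> `|complex.Re z| <= M /\ `|complex.Im z| <= M.
  rewrite norm_normsq lecR => h; split; apply: le_trans h; rewrite -sqrtr_sqr ler_wsqrtr//.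
    by rewrite lerDl sqr_ge0.
  by rewrite lerDr sqr_ge0.
split; apply: (@circle_integrable _ M) => // z z1; by have [] := b _ (hM z z1).
Qed.

Definition cmean (p : {poly C}) : C :=
  (\int[mu]_(z in @unit_circle R) complex.Re p.[z])%R +i*
  (\int[mu]_(z in @unit_circle R) complex.Im p.[z])%R.

Lemma inner1 p : inner mu 1 p = cmean p.
Proof.
rewrite /inner /cmean; congr (_ +i* _); apply: eq_Rintegral => z _;
  by rewrite hornerC rmorph1 mul1r.
Qed.

Lemma cmeanD p q : cmean (p + q) = cmean p + cmean q.
Proof.
have [p1 p2] := circle_horner_integrable p; have [q1 q2] := circle_horner_integrable q.
rewrite /cmean; simpc; congr (_ +i* _); rewrite -RintegralD//; try exact: measurable_circle;
  apply: eq_Rintegral => z _; rewrite hornerD; by case: (p.[z]) (q.[z]) => [? ?] [? ?].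
Qed.

Lemma cmeanZ c p : cmean (c *: p) = c * cmean p.
Proof.
have [p1 p2] := circle_horner_integrable p.
have mc := measurable_circle.
case: c => [x y]; rewrite /cmean; simpc; congr (_ +i* _).
  rewrite -!RintegralZl// -RintegralB//; [|exact: (integrableZl mc x p1)|exact: (integrableZl mc y p2)].
  apply: eq_Rintegral => z _; rewrite hornerZ; by case: (p.[z]) => [? ?].
rewrite -!RintegralZl// -RintegralD//; [|exact: (integrableZl mc x p2)|exact: (integrableZl mc y p1)].
apply: eq_Rintegral => z _; rewrite hornerZ; by case: (p.[z]) => [? ?].
Qed.

Lemma cmean1 : cmean 1 = 1.
Proof.
have e : (fun z : plane R => complex.Re (1 : {poly C}).[z]) = cst 1.
  by apply/funext => z; rewrite hornerC.
have e2 : (fun z : plane R => complex.Im (1 : {poly C}).[z]) = cst 0.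
  by apply/funext => z; rewrite hornerC.
rewrite /cmean e e2 !Rintegral_cst ?mul0r; [|exact: measurable_circle|exact: measurable_circle].
by rewrite [X in fine X]mu1 mul1r.
Qed.

Local Notation phi := (orthonormal_poly mu).

Lemma phi0 : phi 0 = 1.
Proof.
rewrite /orthonormal_poly /gs_step /= big_nil subr0 expr0 /normalize inner1 cmean1.
by rewrite sqrtC1 invr1 scale1r.
Qed.

Lemma gram_schmidtE n : gram_schmidt mu n = [seq phi i | i <- iota 0 n].
Proof.
elim: n => // n ih; rewrite -[in RHS]addn1 iotaD map_cat cats1 add0n -ih.
by [].
Qed.

End Plane.

Section BernsteinSzego.
Variable R : realType.
Local Notation C := R[i].
Variable mu : probability (plane R) R.
Hypothesis mu1 : mu (@unit_circle R) = 1%E.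
Variable a : nat -> R.
Hypothesis a01 : forall n, 0 < a n < 1.
Hypothesis verb : verblunsky_coefficients mu (fun n => (- a n)%:C).
Local Notation phi := (orthonormal_poly mu).

Lemma cmean_sum (s : seq {poly C}) (k : {poly C} -> C) :
  cmean mu (\sum_(f <- s) k f *: f) = \sum_(f <- s) k f * cmean mu f.
Proof.
elim: s => [|f s ih]; last by rewrite !big_cons cmeanD// cmeanZ// ih.
by rewrite !big_nil -(scale0r (0 : {poly C})) cmeanZ// mul0r.
Qed.

(** Orthogonality to the constant polynomial, which is the one of index 0. *)
Lemma cmean_phi n : (0 < n)%N -> cmean mu (phi n) = 0.
Proof.
have [m] := ubnP n; elim: m n => // m ih n nm n0.
rewrite /orthonormal_poly /gs_step /normalize cmeanZ//.
apply/eqP; rewrite mulf_eq0; apply/orP; right; apply/eqP.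
rewrite cmeanD// -scaleN1r cmeanZ// mulN1r cmean_sum gram_schmidtE.
case: n n0 nm => // n _ nm; rewrite /= big_cons phi0// inner1 cmean1// mulr1.
rewrite big1_seq ?addr0 ?subrr// => f /andP[_ hf].
have /seq.mapP[i + ->] := hf; rewrite mem_iota => /andP[i0 hi].
by rewrite ih ?mulr0//; move: hi nm; rewrite add1n !ltnS => h1 h2; exact: leq_trans h2.
Qed.

Lemma poly_eq_neq0 (p q : {poly C}) : (forall z, z != 0 -> p.[z] = q.[z]) -> p = q.
Proof.
move=> h; apply/eqP; rewrite -subr_eq0; apply/eqP.
apply: (@roots_geq_poly_eq0 _ _ [seq (i.+1)%:R | i <- iota 0 (size (p - q)).+1]).
- apply/allP => _ /seq.mapP[i _ ->].
  have i0 : i.+1%:R != 0 :> C by rewrite pnatr_eq0.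
  by rewrite rootE hornerD hornerN (h _ i0) subrr.
- rewrite map_inj_uniq ?iota_uniq// => i j /eqP.
  by rewrite eqr_nat => /eqP [].
- by rewrite size_map size_iota.
Qed.

Lemma sqrtC_rho n : sqrtC (1 - `|(- a n)%:C| ^+ 2 : C) = (rho a n)%:C.
Proof.
have r0 : 0 <= (rho a n)%:C :> C by rewrite ler0c ltW// rho_gt0.
rewrite -[RHS]sqrCK//; congr sqrtC.
rewrite norm_normsq -!rmorphXn/= -[1]/((1 : R)%:C) -rmorphB/=; congr (_%:C).
by rewrite sqr_sqrtr ?normsq_ge0// rho_sqr// /normsq/= expr0n/= addr0 sqrrN.
Qed.

(** The recursion that defines the Verblunsky coefficients is, for real
    negative ones, the recursion of [szego]; it determines the polynomials since
    it holds at infinitely many points. *)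
Lemma phiE n : phi n = Phi a n.
Proof.
elim: n => [|n ih]; first exact: phi0.
case: verb => _ _ /(_ n) rec.
apply: poly_eq_neq0 => z z0; rewrite rec// {rec} ih sqrtC_rho PhiSE (szego_rev a)//.
rewrite -[Num.conj _]/(conjc _) -[Num.conj (Phi _ _).[_]]/(conjc _) -[Num.conj z]/(conjc z) conjc_real.
rewrite rmorphN/= mulNr opprK mulrC; congr (_ * _).
by rewrite -[RHS]/((rho a n)^-1%:C) -fmorphV.
Qed.

Lemma norm1_inv (z : C) : `|z| = 1 -> (conjc z)^-1 = z.
Proof.
move=> /norm_eq1 z1; apply: (mulIf (x := conjc z)).
  by apply/eqP => h; move: z1; have := mul_conjc z; rewrite h mulr0 => /complexI <- /esym/eqP; rewrite oner_eq0.
rewrite mulVf ?mul_conjc ?z1//.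
by apply/eqP => h; move: z1; have := mul_conjc z; rewrite h mulr0 => /complexI <- /esym/eqP; rewrite oner_eq0.
Qed.

Lemma norm1_neq0 (z : C) : `|z| = 1 -> z != 0.
Proof. by move=> z1; rewrite -normr_gt0 z1 ltr01. Qed.

Lemma Psi_circle n (z : C) : `|z| = 1 -> (Psi a n).[z] = z ^+ n * conjc (Phi a n).[z].
Proof. by move=> z1; rewrite (szego_rev a) ?norm1_neq0// norm1_inv. Qed.

Lemma Phi_circle n (z : C) : `|z| = 1 -> (Phi a n).[z] = z ^+ n * conjc (Psi a n).[z].
Proof.
move=> z1; rewrite Psi_circle// conjcM conjcK conjcX mulrA -exprMn mul_conjc.
by move/norm_eq1: z1 => ->; rewrite expr1n mul1r.
Qed.

(** The inverse of the density of the [n]-th Bernstein--Szego measure. *)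
Definition weight n (t : R) : R := normsq (Psi a n).[cexp t].

Lemma normsq_gt0 (z : C) : (0 < normsq z) = (z != 0).
Proof.
rewrite lt0r normsq_ge0 andbT; case: z => x y; rewrite /normsq/=.
by rewrite paddr_eq0 ?sqr_ge0// !sqrf_eq0 eq_complex/=.
Qed.

Lemma weight_gt0 n t : 0 < weight n t.
Proof.
rewrite /weight normsq_gt0.
by have [] := Psi_neq0 a01 n (z := cexp t) _; rewrite ?norm_cexp.
Qed.

Lemma weight_cont n : continuous (fun t => (weight n t)^-1).
Proof.
apply: contV; first by move=> t; rewrite gt_eqF// weight_gt0.
have [c1 c2] := ccont_horner (Psi a n).
by apply: contD; apply: contM.
Qed.

Definition Lambda n (p : {poly C}) : R :=
  turn (fun t => complex.Re p.[cexp t] * (weight n t)^-1).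

Lemma Lambda_cont n p : continuous (fun t => complex.Re p.[cexp t] * (weight n t)^-1).
Proof. by apply: contM; [exact: Re_continuous_horner|exact: weight_cont]. Qed.

Lemma LambdaD n p q : Lambda n (p + q) = Lambda n p + Lambda n q.
Proof.
rewrite /Lambda -turnD; try exact: Lambda_cont; congr turn; apply/funext => t.
by rewrite hornerD ReD mulrDl.
Qed.

Lemma Psi_disk_alg n : disk_alg (fun z => ((Psi a n).[z])^-1) ((Psi a n).[0])^-1.
Proof. by apply: disk_alg_inv_poly => z /(Psi_neq0 a01 n)[]. Qed.

Lemma Psi_ccont n : ccont (fun t => ((Psi a n).[cexp t])^-1).
Proof.
apply: ccontV; last exact: ccont_horner.
by move=> t; have [] := Psi_neq0 a01 n (z := cexp t) _; rewrite ?norm_cexp.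
Qed.

Lemma weight_step_identity (P v : C) (r : R) : normsq v = r * normsq P -> P != 0 -> P + v != 0 ->
  (1 - r) / normsq (P + v) - (normsq P)^-1 = 2 * complex.Re (- v / (P + v)) / normsq P.
Proof.
rewrite -!normsq_gt0; case: P v => [p1 p2] [v1 v2]; rewrite /normsq/= => h P0 Q0.
have e : (1 - r) * (p1 ^+ 2 + p2 ^+ 2) = (p1 ^+ 2 + p2 ^+ 2) - (v1 ^+ 2 + v2 ^+ 2).
  by rewrite h; ring.
have P1 := lt0r_neq0 P0; have Q1 := lt0r_neq0 Q0.
have -> : (1 - r) / ((p1 + v1) ^+ 2 + (p2 + v2) ^+ 2) =
  ((1 - r) * (p1 ^+ 2 + p2 ^+ 2)) / (p1 ^+ 2 + p2 ^+ 2) / ((p1 + v1) ^+ 2 + (p2 + v2) ^+ 2).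
  by field; rewrite P1 Q1.
by rewrite e; field; rewrite P1 Q1.
Qed.

(** On the circle, [polyrev n p] is [z ^+ n] times the conjugate of [p]; so the
    real part of [p] times that of [z ^+ n.+1 * v] is the real part of a
    polynomial times [v], up to the factor 2. *)
Definition polyrev n (p : {poly C}) : {poly C} := \poly_(i < n.+1) conjc p`_(n - i).

Lemma polyrevE n (p : {poly C}) (z : C) : (size p <= n.+1)%N -> `|z| = 1 ->
  (polyrev n p).[z] = z ^+ n * conjc p.[z].
Proof.
move=> sp z1; have zz : z * conjc z = 1 by rewrite mul_conjc; move/norm_eq1: z1 => ->.
rewrite /polyrev horner_poly (horner_coef_wide _ sp).
have -> : conjc (\sum_(i < n.+1) p`_i * z ^+ i) = \sum_(i < n.+1) conjc (p`_i * z ^+ i).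
  exact: (rmorph_sum (conjc : {rmorphism C -> C})).
rewrite (reindex_inj rev_ord_inj) /= mulr_sumr; apply: eq_bigr => i _.
have hi : (i <= n)%N by rewrite -ltnS.
have -> : (n - (n.+1 - i.+1))%N = i by rewrite subSS subKn.
have -> : z ^+ n = z ^+ (n.+1 - i.+1) * z ^+ i by rewrite -exprD subSS subnK.
have zi : z ^+ i * conjc z ^+ i = 1 by rewrite -exprMn zz expr1n.
rewrite conjcM conjcX; move: zi; move: (conjc p`_i) (z ^+ _) (z ^+ i) (conjc z ^+ i) => u x y v yv.
have -> : x * y * (u * v) = u * x * (y * v) by ring.
by rewrite yv mulr1.
Qed.

(** The difference of two successive densities is the real part of a function
    that is analytic in the disk and vanishes at the origin to order
    [n.+1]. *)
Lemma weight_step n t :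
  (weight n.+1 t)^-1 - (weight n t)^-1 =
  2 * complex.Re ((- (a n / rho a n))%:C * cexp t ^+ n.+1 *
     ((Psi a n.+1).[cexp t])^-1 * ((Psi a n).[cexp t])^-1).
Proof.
set z := cexp t; have z1 : `|z| = 1 := norm_cexp t.
have nz : normsq z = 1 by apply/norm_eq1.
rewrite /weight -/z PsiSE.
have Pn0 : (Psi a n).[z] != 0 by have [] := Psi_neq0 a01 n (z := z) _; rewrite ?z1.
have := Psi_neq0 a01 n.+1 (z := z) _; rewrite z1 lexx => /(_ isT)[_].
rewrite PsiSE => Pn1.
set P := (Psi a n).[z] in Pn0 Pn1 *; set F := (Phi a n).[z] in Pn1 *.
have FP : F = z ^+ n * conjc P by exact: Phi_circle.
have r0 := rho_gt0 a01 n; have rn := lt0r_neq0 r0.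
have rc : (rho a n)%:C != 0 :> C by rewrite -[0]/((0 : R)%:C) (inj_eq (@complexI R)).
set v := (a n)%:C * (z * F) in Pn1 *.
have Pv : P + v != 0 by move: Pn1; rewrite mulf_eq0 negb_or => /andP[].
have nv : normsq v = a n ^+ 2 * normsq P.
  rewrite /v !normsqM nz mul1r FP normsqM normsqX nz expr1n mul1r.
  by congr (_ * _); rewrite /normsq; case: (P) => [x y] /=; rewrite ?expr0n ?addr0//=; ring.
have nr : normsq ((rho a n)^-1)%:C = (1 - a n ^+ 2)^-1.
  by rewrite /normsq/= expr0n/= addr0 exprVn rho_sqr.
have -> : (normsq ((rho a n)^-1%:C * (P + v)))^-1 = (1 - a n ^+ 2) / normsq (P + v).
  by rewrite normsqM nr invfM invrK.
rewrite weight_step_identity//.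
have cP : conjc P != 0 by rewrite conjc_eq0.
have -> : (- (a n / rho a n))%:C * z ^+ n.+1 * ((rho a n)^-1%:C * (P + v))^-1 * P^-1 =
  (- v / (P + v)) * ((normsq P)^-1)%:C.
  have -> : ((normsq P)^-1)%:C = (P * conjc P)^-1 by rewrite mul_conjc fmorphV.
  rewrite rmorphN rmorphM/= !fmorphV /v FP exprS; move: Pv; rewrite /v FP.
  move: (conjc P) cP => Q Q0; move: rc; set rr := (rho a n)%:C; set aa := (a n)%:C.
  set zn := z ^+ n => rr0 Pv.
  by field; rewrite rr0 Pn0 Q0 Pv.
rewrite -mulrA; congr (_ * _); case: (- v / (P + v)) => [x y] /=.
by rewrite mulr0 subr0.
Qed.

(** The difference of the two sides is the mean over the circle of a function
    that is analytic in the disk and vanishes at the origin. *)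
Lemma Lambda_step n (p : {poly C}) : (size p <= n.+1)%N -> Lambda n.+1 p = Lambda n p.
Proof.
move=> sp; apply/eqP; rewrite -subr_eq0 /Lambda.
have cN := contN (@Lambda_cont n p); have c1 := @Lambda_cont n.+1 p.
rewrite -turnN ?Lambda_cont//; last exact: Lambda_cont.
rewrite -turnD//.
pose q : {poly C} := (- (a n / rho a n))%:C *: (p * 'X^(n.+1) + 'X * polyrev n p).
pose g (z : C) := q.[z] * ((Psi a n.+1).[z])^-1 * ((Psi a n).[z])^-1.
have -> : (fun t => complex.Re p.[cexp t] * (weight n.+1 t)^-1 +
    - (complex.Re p.[cexp t] * (weight n t)^-1)) = (fun t => complex.Re (g (cexp t))).
  apply/funext => t; rewrite -mulrBr weight_step /g /q hornerZ hornerD !hornerM hornerXn hornerX.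
  rewrite polyrevE ?norm_cexp//.
  set z := cexp t; set k := (_)%:C; set u := (Psi a n.+1).[z]^-1; set w := (Psi a n).[z]^-1.
  have -> : k * (p.[z] * z ^+ n.+1 + z * (z ^+ n * conjc p.[z])) * u * w =
    (p.[z] + conjc p.[z]) * (k * z ^+ n.+1 * u * w) by rewrite exprS; ring.
  case: (p.[z]) (k * _ * _ * _) => [x y] [x' y'] /=; ring.
have q0 : q.[0] = 0 by rewrite /q hornerZ hornerD !hornerM hornerXn hornerX expr0n/= mulr0 mul0r addr0 mulr0.
have dg : disk_alg g (q.[0] * ((Psi a n.+1).[0])^-1 * ((Psi a n).[0])^-1).
  by apply: disk_algM; [apply: disk_algM; [exact: disk_alg_poly|]|]; exact: Psi_disk_alg.
rewrite (turn_mean dg); last first.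
  by apply: ccontM; [apply: ccontM; [exact: ccont_horner|]|]; exact: Psi_ccont.
by rewrite q0 !mul0r/= mulr0.
Qed.

Lemma Lambda_stable n N (p : {poly C}) : (size p <= n.+1)%N -> (n <= N)%N -> Lambda N p = Lambda n p.
Proof.
move=> sp; elim: N => [|N ih]; first by rewrite leqn0 => /eqP ->.
rewrite leq_eqVlt => /predU1P[->//|]; rewrite ltnS => nN.
by rewrite Lambda_step ?ih// (leq_trans sp).
Qed.

Lemma szego_size n : (size (Phi a n) <= n.+1)%N /\ (size (Psi a n) <= n.+1)%N.
Proof.
elim: n => [|n [ih1 ih2]]; first by rewrite size_poly1.
have sX : (size ('X * Phi a n)%R <= n.+2)%N.
  by rewrite (leq_trans (size_polyMleq _ _))// size_polyX addSn/= add1n.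
split.
  rewrite PhiS (leq_trans (size_scale_leq _ _))// (leq_trans (size_polyD _ _))// geq_max sX/=.
  by rewrite (leq_trans (size_scale_leq _ _))// (leq_trans ih2).
rewrite PsiS (leq_trans (size_scale_leq _ _))// (leq_trans (size_polyD _ _))// geq_max.
by rewrite (leq_trans ih2)//= (leq_trans (size_scale_leq _ _)).
Qed.

Lemma Phi_lead n : (Phi a n)`_n != 0.
Proof.
elim: n => [|n ih]; first by rewrite coef1 oner_neq0.
rewrite PhiS coefZ coefD coefXM/= coefZ.
have [_ s2] := szego_size n; rewrite (nth_default _ s2) mulr0 addr0 mulf_neq0//.
by rewrite -[0]/((0 : R)%:C) (inj_eq (@complexI R)) invr_neq0// gt_eqF// rho_gt0.
Qed.

(** On the circle [Phi a k / weight k] is [z ^+ k / Psi a k], whose mean is its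
    value at the origin, namely [0] unless [k = 0]; on the side of [mu] this is
    orthogonality. *)
Lemma Lambda_Phi c k N : (k <= N)%N ->
  Lambda N (c *: Phi a k) = 2 * pi * complex.Re (cmean mu (c *: Phi a k)).
Proof.
move=> kN; rewrite (@Lambda_stable k)//; last first.
  by rewrite (leq_trans (size_scale_leq _ _))//; case: (szego_size k).
rewrite cmeanZ// -phiE.
have -> : Lambda k (c *: phi k) = turn (fun t => complex.Re ((c *: 'X^k).[cexp t] * ((Psi a k).[cexp t])^-1)).
  congr turn; apply/funext => t; rewrite phiE !hornerZ hornerXn Phi_circle ?norm_cexp//.
  have P0 : (Psi a k).[cexp t] != 0.
    by have [] := Psi_neq0 a01 k (z := cexp t) _; rewrite ?norm_cexp.
  rewrite /weight; move: P0; set P := (Psi a k).[_] => P0.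
  have -> : P^-1 = conjc P * ((normsq P)^-1)%:C.
    have -> : ((normsq P)^-1)%:C = (P * conjc P)^-1 by rewrite mul_conjc fmorphV.
    have cP : conjc P != 0 by rewrite conjc_eq0.
    by rewrite invfM mulrCA mulfV// mulr1.
  rewrite !mulrA; case: (_ * _ * conjc P) => [x y] /=; by rewrite mulr0 subr0.
have dg : disk_alg (fun z => (c *: 'X^k).[z] * ((Psi a k).[z])^-1) ((c *: 'X^k).[0] * ((Psi a k).[0])^-1).
  by apply: disk_algM; [exact: disk_alg_poly|exact: Psi_disk_alg].
rewrite (turn_mean dg); last by apply: ccontM; [exact: ccont_horner|exact: Psi_ccont].
congr (_ * complex.Re _); have [->|k0] := posnP k.
  by rewrite phi0// cmean1// hornerZ hornerXn expr0 divr1.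
by rewrite cmean_phi// hornerZ hornerXn expr0n gtn_eqF//= !mulr0 mul0r.
Qed.

(** Both sides are linear in [p], and [p] is a combination of the orthonormal
    polynomials of index at most [n]. *)
Lemma bernstein_szego n N (p : {poly C}) : (size p <= n.+1)%N -> (n <= N)%N ->
  turn (fun t => complex.Re p.[cexp t] * (weight N t)^-1) =
  2 * pi * (\int[mu]_(z in @unit_circle R) complex.Re p.[z])%R.
Proof.
rewrite -/(Lambda N p) -[X in _ * X]/(complex.Re (cmean mu p)).
elim: n p => [|n ih] p sp nN.
  have -> : p = p`_0 *: Phi a 0 by rewrite {1}(size1_polyC sp) /Phi/= alg_polyC.
  exact: Lambda_Phi.
pose k := p`_n.+1 / (Phi a n.+1)`_n.+1.
have -> : p = (p - k *: Phi a n.+1) + k *: Phi a n.+1 by rewrite subrK.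
rewrite LambdaD cmeanD// ReD mulrDr Lambda_Phi// ih ?(ltnW nN)//.
apply/leq_sizeP => j; rewrite leq_eqVlt => /predU1P[<-|nj].
  by rewrite coefB coefZ /k divfK ?Phi_lead// subrr.
have [s1 _] := szego_size n.+1.
by rewrite coefB coefZ !nth_default ?mulr0 ?subr0// (leq_trans _ nj)// ?s1 ?sp.
Qed.

End BernsteinSzego.

(** * Measures of arcs *)
Section Bump.
Variable R : realType.
Local Notation C := R[i].

Lemma bernoulli (y : R) N : 0 <= y <= 1 ->
  1 - N%:R * y <= (1 - y) ^+ N /\ (1 - y) ^+ N * (1 + N%:R * y) <= 1.
Proof.
move=> /andP[y0 y1]; elim: N => [|N [ih1 ih2]].
  by rewrite expr0 mul0r subr0 addr0 mulr1.
have N0 : 0 <= N%:R :> R by rewrite ler0n.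
have q0 : 0 <= (1 - y) ^+ N by rewrite exprn_ge0// subr_ge0.
rewrite exprS -natr1; split.
  have : (1 - y) * (1 - N%:R * y) <= (1 - y) * (1 - y) ^+ N by rewrite ler_wpM2l// subr_ge0.
  have : 0 <= N%:R * (y * y) by rewrite !mulr_ge0.
  nra.
apply: le_trans ih2; rewrite [(1 - y) * _]mulrC -mulrA ler_wpM2l//.
have : 0 <= N%:R * (y * y) by rewrite !mulr_ge0.
have : 0 <= y * y by rewrite mulr_ge0.
lra.
Qed.

Lemma exists_small_expr (r e : R) : 0 <= r < 1 -> 0 < e -> exists n, r ^+ n <= e.
Proof.
move=> /andP[r0 r1] e0.
have /cvgr0Pnorm_le/(_ e e0)[n _ /(_ n (leqnn n))] : (GRing.exp r) @ \oo --> 0.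
  by apply: cvg_expr; rewrite ger0_norm.
by rewrite /= ger0_norm ?exprn_ge0//; exists n.
Qed.

(** Take [Q = (1 - p ^+ n) ^+ N] with [p = (1 - x) / 2], which equals
    [p1 < p2] at [x1] and [x2]. By Bernoulli's inequality [Q] is at least
    [1 - N * p1 ^+ n] for [x1 <= x], and at most [(N * p2 ^+ n)^-1] for
    [x <= x2]; with [N] close to [1 / (e * p2 ^+ n)] the second bound is [e],
    and [N * p1 ^+ n] is about [(p1 / p2) ^+ n / e], small for large [n]. *)
Lemma bump_poly (x2 x1 e : R) : -1 <= x2 -> x2 < x1 -> x1 <= 1 -> 0 < e ->
  exists Q : {poly R}, forall x, -1 <= x <= 1 ->
    [/\ 0 <= Q.[x], Q.[x] <= 1, x1 <= x -> 1 - e <= Q.[x] & x <= x2 -> Q.[x] <= e].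
Proof.
move=> x2m x21 x11 e0.
pose p1 := (1 - x1) / 2; pose p2 := (1 - x2) / 2.
have p10 : 0 <= p1 by rewrite /p1; lra.
have p12 : p1 < p2 by rewrite /p1 /p2; lra.
have p20 : 0 < p2 by exact: le_lt_trans p12.
have p21 : p2 <= 1 by rewrite /p2; lra.
have ei0 : 0 < e^-1 + 1 by rewrite addr_gt0// invr_gt0.
have [n hn] : exists n, (p1 / p2) ^+ n <= e / (e^-1 + 1).
  apply: exists_small_expr; last by rewrite divr_gt0.
  by rewrite divr_ge0 ?(ltW p20)//= ltr_pdivrMr// mul1r.
have q20 : 0 < p2 ^+ n by rewrite exprn_gt0.
have q21 : p2 ^+ n <= 1 by rewrite exprn_ile1// ltW.
pose N := (Num.truncn (e * p2 ^+ n)^-1).+1.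
have ep0 : 0 < e * p2 ^+ n by rewrite mulr_gt0.
have ei : 0 <= (e * p2 ^+ n)^-1 by rewrite invr_ge0 ltW.
have /andP[N1 N2] := truncn_itv ei.
have M2 : N%:R * p2 ^+ n <= e^-1 + 1.
  have : N%:R * p2 ^+ n <= ((e * p2 ^+ n)^-1 + 1) * p2 ^+ n.
    by rewrite ler_wpM2r ?(ltW q20)// /N -natr1 lerD2r.
  move=> /le_trans; apply; rewrite mulrDl mul1r invfM -mulrA mulVf ?mulr1 ?gt_eqF//.
  by rewrite lerD2l.
have M1 : e^-1 <= N%:R * p2 ^+ n.
  by rewrite -ler_pdivrMr// -invfM ltW.
have M3 : N%:R * p1 ^+ n <= e.
  have -> : N%:R * p1 ^+ n = N%:R * p2 ^+ n * (p1 / p2) ^+ n.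
    by rewrite [(p1 / p2) ^+ n]expr_div_n -mulrA [p2 ^+ n * _]mulrC divfK ?gt_eqF.
  apply: (@le_trans _ _ ((e^-1 + 1) * (e / (e^-1 + 1)))).
    apply: ler_pM => //; first by rewrite mulr_ge0// ltW.
    by rewrite exprn_ge0// divr_ge0// ltW.
  by rewrite mulrC divfK// gt_eqF.
exists ((1 - ((2^-1)%:P * (1 - 'X)) ^+ n) ^+ N) => x /andP[xm xp].
have -> : ((1 - ((2^-1)%:P * (1 - 'X)) ^+ n) ^+ N).[x] = (1 - ((1 - x) / 2) ^+ n) ^+ N.
  by rewrite !hornerE [_ / 2]mulrC.
set p := (1 - x) / 2.
have p0 : 0 <= p by rewrite /p; lra.
have pl1 : p <= 1 by rewrite /p; lra.
have q0 : 0 <= p ^+ n by rewrite exprn_ge0.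
have q1 : p ^+ n <= 1 by rewrite exprn_ile1.
have [|b1 b2] := @bernoulli (p ^+ n) N; first by rewrite q0.
split.
- by rewrite exprn_ge0// subr_ge0.
- by rewrite exprn_ile1 ?subr_ge0// gerBl.
- move=> hx; apply: le_trans b1; rewrite lerB//; apply: le_trans M3.
  by rewrite ler_wpM2l// lerXn2r// ?nnegrE// /p /p1; lra.
- move=> hx.
  have h : e^-1 <= 1 + N%:R * p ^+ n.
    apply: (le_trans M1); rewrite -[leLHS]add0r lerD// ler_wpM2l// lerXn2r ?nnegrE ?(ltW p20)//.
    by rewrite /p /p2; lra.
  have g0 : 0 <= (1 - p ^+ n) ^+ N by rewrite exprn_ge0// subr_ge0.
  rewrite -[leRHS]mul1r -ler_pdivrMr//; apply: le_trans b2.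
  by rewrite ler_wpM2l.
Qed.

(** The product of the real parts of [p] and [w * z] is half the real part of
    [p * (w * z) + p * conj (w * z)]. On the circle multiplication by [conj z]
    lowers the degree of [p * 'X]; the constant term [c] gives
    [c * conj (w * z)], which has the real part of [conj c * (w * z)]. *)
Lemma Re_mul_Re (w : C) (p : {poly C}) : exists q : {poly C}, forall z : C, `|z| = 1 ->
  complex.Re p.[z] * complex.Re (w * z) = complex.Re q.[z].
Proof.
elim/poly_ind: p => [|p c _].
  by exists 0 => z _; rewrite !horner0 mul0r.
exists ((2^-1)%:C *: ((p * 'X + c%:P) * (w *: 'X) + conjc w *: p + (conjc c * w) *: 'X)) => z z1.
rewrite !hornerE; move/norm_eq1: z1.
move: (p.[z]) => u; case: u c w z => [p1 p2] [c1 c2] [w1 w2] [z1 z2]; rewrite /normsq/= => zz.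
have e : w1 * p1 + w2 * p2 = (p1 * z1 - p2 * z2) * (w1 * z1 - w2 * z2) +
    (p1 * z2 + p2 * z1) * (w1 * z2 + w2 * z1).
  by transitivity ((w1 * p1 + w2 * p2) * (z1 ^+ 2 + z2 ^+ 2)); [rewrite zz mulr1|ring].
transitivity (2^-1 * (((p1 * z1 - p2 * z2) + c1) * (w1 * z1 - w2 * z2) -
  ((p1 * z2 + p2 * z1) + c2) * (w1 * z2 + w2 * z1) + (w1 * p1 + w2 * p2) +
  ((c1 * w1 + c2 * w2) * z1 - (c1 * w2 - c2 * w1) * z2))).
  by rewrite e; field.
by field.
Qed.

Lemma Re_horner_Re (w : C) (Q : {poly R}) : exists q : {poly C}, forall z : C, `|z| = 1 ->
  Q.[complex.Re (w * z)] = complex.Re q.[z].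
Proof.
elim/poly_ind: Q => [|Q c [q hq]].
  by exists 0 => z _; rewrite !horner0.
have [r hr] := Re_mul_Re w q.
exists (r + (c%:C)%:P) => z z1; rewrite !hornerE hq// hr//.
by case: (r.[z]).
Qed.

End Bump.

Section ArcLemmas.
Variable R : realType.
Local Notation C := R[i].
Local Notation leb := (@lebesgue_measure R).

(** The arc centered at [cexp theta] whose half-width has cosine [x]. *)
Definition arc (theta x : R) : set (plane R) :=
  @unit_circle R `&` [set z : plane R | x <= complex.Re (conjc (cexp theta) * z)].

Lemma measurable_arc (theta x : R) : measurable (arc theta x).
Proof.
apply: measurableI; first exact: measurable_circle.
have [m _] := measurable_horner (conjc (cexp theta) *: 'X).
have -> : [set z : plane R | x <= complex.Re (conjc (cexp theta) * z)] =
  (fun z : plane R => complex.Re (conjc (cexp theta) *: 'X).[z]) @^-1` `[x, +oo[.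
  by apply/seteqP; split => z /=; rewrite in_itv/= andbT hornerZ hornerX.
by rewrite -[X in measurable X]setTI; exact: m.
Qed.

Lemma Re_arc (theta t : R) : complex.Re (conjc (cexp theta) * cexp t) = cos (t - theta).
Proof. by rewrite cosB /=; ring. Qed.

Lemma Re_arc_bound (theta : R) (z : C) : `|z| = 1 -> -1 <= complex.Re (conjc (cexp theta) * z) <= 1.
Proof.
move=> /norm_eq1 z1; set v := _ * z.
have : normsq v = 1 by rewrite normsqM z1 mulr1 /normsq/= sqrrN cos2Dsin2.
case: v => [x y]; rewrite /normsq/= => h.
rewrite -ler_norml -[leRHS]normr1 -ler_sqr ?nnegrE ?normr_ge0// !real_normK ?num_real// expr1n -h.
by rewrite lerDl sqr_ge0.
Qed.

Lemma cos_arc (d u : R) : 0 <= d -> d <= pi -> `|u| < 2 * pi - d -> (cos d <= cos u) = (`|u| <= d).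
Proof.
move=> d0 dp ud; rewrite -(cos_norm u); have u0 := normr_ge0 u; move: ud u0.
move: `|u| => v ud v0.
have mono x : 0 <= x <= pi -> (cos d <= cos x) = (x <= d).
  by move=> hx; rewrite leNgt ltr_cos -?leNgt// in_itv/= ?d0.
have [vp|vp] := leP v pi; first by rewrite mono// v0.
(* beyond the antipode the distance to the center decreases again *)
have -> : cos v = cos (2 * pi - v).
  by rewrite mulrC mulr_natr addrC cosD2pi cosN.
rewrite mono; last by apply/andP; split; lra.
by apply/idP/idP; lra.
Qed.

Lemma turn_indic (k a b : R) : 0 <= a -> a <= b -> b <= 2 * pi ->
  leb.-integrable `[0, 2 * pi] (EFin \o (fun t => k * \1_(`[a, b] : set R) t)) /\
  turn (fun t => k * \1_(`[a, b] : set R) t) = k * (b - a).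
Proof.
move=> a0 ab b1.
have i1 : leb.-integrable `[0, 2 * pi] (EFin \o (\1_(`[a, b] : set R) : R -> R)).
  by apply: integrableS (integrable_indic_itv a b true false).
split.
  have -> : EFin \o (fun t => k * \1_(`[a, b] : set R) t) = (fun t => k%:E * (\1_(`[a, b] : set R) t)%:E)%E.
    by apply/funext => t /=; rewrite EFinM.
  exact: integrableZl.
rewrite /turn RintegralZl//; congr (_ * _).
rewrite /Rintegral integral_indic//= setIidl; last first.
  move=> t /=; rewrite !in_itv/= => /andP[h1 h2].
  by rewrite (le_trans a0 h1) (le_trans h2 b1).
rewrite lebesgue_measure_itv/= lte_fin; move: ab; rewrite le_eqVlt => /predU1P[->|->//].
by rewrite ltxx subrr.
Qed.

Lemma trig_bump (theta x2 x1 e : R) : -1 <= x2 -> x2 < x1 -> x1 <= 1 -> 0 < e ->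
  exists q : {poly C}, forall z : C, `|z| = 1 ->
    let x := complex.Re (conjc (cexp theta) * z) in
    [/\ 0 <= complex.Re q.[z], complex.Re q.[z] <= 1,
        x1 <= x -> 1 - e <= complex.Re q.[z] & x <= x2 -> complex.Re q.[z] <= e].
Proof.
move=> h1 h2 h3 e0; have [Q hQ] := bump_poly h1 h2 h3 e0.
have [q hq] := Re_horner_Re (conjc (cexp theta)) Q.
by exists q => z z1 /=; rewrite -hq//; apply: hQ; exact: Re_arc_bound.
Qed.

End ArcLemmas.

Section ArcMeasure.
Variable R : realType.
Local Notation C := R[i].
Local Notation leb := (@lebesgue_measure R).
Variable mu : probability (plane R) R.
Hypothesis mu1 : mu (@unit_circle R) = 1%E.
Variable a : nat -> R.
Hypothesis a01 : forall n, 0 < a n < 1.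
Hypothesis verb : verblunsky_coefficients mu (fun n => (- a n)%:C).

Lemma circle_indic (A : set (plane R)) : measurable A -> A `<=` @unit_circle R ->
  mu.-integrable (@unit_circle R) (EFin \o (\1_A : plane R -> R)) /\
  (\int[mu]_(z in @unit_circle R) (\1_A z : R))%R = fine (mu A).
Proof.
move=> mA Ac; split.
  have mc := @measurable_circle R.
  by apply: (integrableS measurableT mc (@subsetT _ _)); exact: integrable_indic.
by rewrite /Rintegral integral_indic ?setIidl//; exact: measurable_circle.
Qed.

Lemma circle_cst (k : R) : mu.-integrable (@unit_circle R) (EFin \o cst k) /\
  (\int[mu]_(z in @unit_circle R) k)%R = k.
Proof.
split; last by rewrite (Rintegral_cst mu (@measurable_circle R)) [X in fine X]mu1 mulr1.
by apply: (@circle_integrable _ _ _ `|k|) => //.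
Qed.

Lemma turn_weight n : turn (fun t => (weight a n t)^-1) = 2 * pi.
Proof.
have := bernstein_szego mu1 a01 verb (n := 0) (N := n) (p := 1) _ isT.
rewrite size_poly1 => /(_ isT).
have -> : (fun t => complex.Re (1 : {poly C}).[cexp t] * (weight a n t)^-1) = (fun t => (weight a n t)^-1).
  by apply/funext => t; rewrite hornerC mul1r.
move=> ->.
under eq_Rintegral do rewrite hornerC/=.
by rewrite (circle_cst 1).2 mulr1.
Qed.

Variable theta : R.

Lemma absorb_half (P m k x e : R) : 0 < P ->
  2 * P * (m - e / 2) <= k * (2 * x) + 2 * P * (e / 2) -> m <= k * x / P + e.
Proof.
move=> P0; have -> : k * (2 * x) = 2 * P * (k * x / P) by field; exact: lt0r_neq0.
by rewrite -mulrDr ler_pM2l ?mulr_gt0//; lra.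
Qed.

Lemma absorb_half' (P m k x e : R) : 0 < P ->
  k * (2 * x) - 2 * P * (e / 2) <= 2 * P * (m + e / 2) -> k * x / P <= m + e.
Proof.
move=> P0; have -> : k * (2 * x) = 2 * P * (k * x / P) by field; exact: lt0r_neq0.
by rewrite -mulrBr ler_pM2l ?mulr_gt0//; lra.
Qed.

(** Integrate against [mu] a bump that is close to 1 on the arc and close to 0
    outside of a slightly larger one; by [bernstein_szego] the integral can be
    computed from the density [(weight a n)^-1]. *)
Lemma arc_upper (d d' hi : R) (n1 : nat) : 0 <= d -> d < d' -> 0 < theta - d' -> theta + d' < 2 * pi ->
  (forall n t, (n1 <= n)%N -> `|t - theta| <= d' -> (weight a n t)^-1 <= hi) ->
  fine (mu (arc theta (cos d))) <= hi * d' / pi.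
Proof.
move=> d0 dd t0 t1 hw; have p0 := pi_gt0 R.
have d'p : d' <= pi by lra.
apply/ler_addgt0Pr => e2 e20; pose e := e2 / 2; have e0 : 0 < e by rewrite divr_gt0.
have cc : cos d' < cos d by rewrite ltr_cos// in_itv/=; apply/andP; split; lra.
have [q hq] := @trig_bump R theta (cos d') (cos d) e (cos_geN1 _) cc (cos_le1 _) e0.
pose n := maxn n1 (size q).
have := bernstein_szego mu1 a01 verb (n := (size q)) (N := n) (p := q) (leqnSn _) (leq_maxr _ _).
set I1 := turn _; set I2 := (\int[_]_(_ in _) _)%R => I12.
have [mA iA] := circle_indic (@measurable_arc R theta (cos d)) (@subIsetl _ _ _).
have [mk ik] := circle_cst (- e).
have b2 : fine (mu (arc theta (cos d))) - e <= I2.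
  rewrite -iA -ik -RintegralD//; last exact: measurable_circle.
  apply: le_Rintegral => //; first exact: measurable_circle.
  - exact: (integrableD (@measurable_circle R) mA mk).
  - by have [] := circle_horner_integrable mu q.
  move=> z z1; have [q0 _ q1 _] := hq z z1.
  rewrite indicE; case: (boolP (z \in _)) => [/set_mem[_ /= /q1]|_] /=; first lra.
  by rewrite add0r; lra.
have [mI iI] := @turn_indic R hi (theta - d') (theta + d') (ltW t0) ltac:(lra) (ltW t1).
have cw := @weight_cont _ a a01 n.
have ce : leb.-integrable `[0, 2 * pi] (EFin \o (fun t => e * (weight a n t)^-1)).
  by apply: cont_integrable; apply: contM => //; exact: cont_cst.
have b1 : I1 <= hi * (2 * d') + 2 * pi * e.
  have -> : hi * (2 * d') = hi * (theta + d' - (theta - d')) by congr (_ * _); ring.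
  have -> : 2 * pi * e = turn (fun t => e * (weight a n t)^-1).
    by rewrite turnZ// turn_weight mulrC.
  rewrite -iI /turn -RintegralD//.
  apply: le_Rintegral => //; [| |].
  - by apply: cont_integrable; apply: contM => //; exact: Re_continuous_horner.
  - have mD : measurable (`[0, 2 * pi] : set R) by exact: measurable_itv.
    exact: (@integrableD _ _ _ leb _ mD _ _ mI ce).
  move=> t /=; rewrite in_itv/= => /andP[tl tr].
  have w0 : 0 < (weight a n t)^-1 by rewrite invr_gt0 weight_gt0.
  have [q0 q1 _ q2] := hq (cexp t) (norm_cexp t).
  rewrite Re_arc in q2; rewrite indicE.
  have tb : `|t - theta| < 2 * pi - d'.
    by clear -t0 t1 tl tr; rewrite ltr_norml; apply/andP; split; lra.
  have ca := cos_arc (ltW (le_lt_trans d0 dd)) d'p tb.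
  have [h|h] := leP `|t - theta| d'.
    have -> : (t \in `[theta - d', theta + d']%classic) = true.
      by apply/mem_set; rewrite /= in_itv/= -ler_distl.
    rewrite mulr1 -[leLHS]addr0 lerD//; last by rewrite mulr_ge0// ltW.
    by apply: (@le_trans _ _ (weight a n t)^-1); [rewrite ler_piMl// ltW|apply: hw => //; exact: leq_maxl].
  have -> : (t \in `[theta - d', theta + d']%classic) = false.
    by apply/negbTE/negP => /set_mem /=; rewrite in_itv/= -ler_distl leNgt h.
  rewrite mulr0 add0r ler_wpM2r ?(ltW w0)// q2//.
  by apply: ltW; rewrite ltNge ca -ltNge.
have : 2 * pi * (fine (mu (arc theta (cos d))) - e) <= hi * (2 * d') + 2 * pi * e.
  by apply: le_trans b1; rewrite I12 ler_wpM2l// mulr_ge0// ltW.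
exact: absorb_half.
Qed.

Lemma arc_lower (d d' lo : R) (n1 : nat) : 0 <= d -> d < d' -> 0 < theta - d' -> theta + d' < 2 * pi ->
  (forall n t, (n1 <= n)%N -> `|t - theta| <= d -> lo <= (weight a n t)^-1) ->
  lo * d / pi <= fine (mu (arc theta (cos d'))).
Proof.
move=> d0 dd t0 t1 hw; have p0 := pi_gt0 R.
have d'p : d' <= pi by lra.
apply/ler_addgt0Pr => e2 e20; pose e := e2 / 2; have e0 : 0 < e by rewrite divr_gt0.
have cc : cos d' < cos d by rewrite ltr_cos// in_itv/=; apply/andP; split; lra.
have [q hq] := @trig_bump R theta (cos d') (cos d) e (cos_geN1 _) cc (cos_le1 _) e0.
pose n := maxn n1 (size q).
have := bernstein_szego mu1 a01 verb (n := (size q)) (N := n) (p := q) (leqnSn _) (leq_maxr _ _).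
set I1 := turn _; set I2 := (\int[_]_(_ in _) _)%R => I12.
have [mA iA] := circle_indic (@measurable_arc R theta (cos d')) (@subIsetl _ _ _).
have [mk ik] := circle_cst e.
have b2 : I2 <= fine (mu (arc theta (cos d'))) + e.
  rewrite -iA -ik -RintegralD//; last exact: measurable_circle.
  apply: le_Rintegral => //; first exact: measurable_circle.
  - by have [] := circle_horner_integrable mu q.
  - exact: (integrableD (@measurable_circle R) mA mk).
  move=> z z1; have [q0 q1 _ q2] := hq z z1.
  rewrite indicE; case: (boolP (z \in _)) => [_|/negP hz] /=; first lra.
  rewrite add0r q2// leNgt; apply/negP => h; apply: hz; apply/mem_set; split => //=.
  exact: ltW.
have [u1 u2 u3] : [/\ 0 <= theta - d, theta - d <= theta + d & theta + d <= 2 * pi].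
  by clear -d0 dd t0 t1; split; lra.
have [mI iI] := turn_indic lo u1 u2 u3.
have cw := @weight_cont _ a a01 n.
have ce : leb.-integrable `[0, 2 * pi] (EFin \o (fun t => - e * (weight a n t)^-1)).
  by apply: cont_integrable; apply: contM => //; exact: cont_cst.
have b1 : lo * (2 * d) - 2 * pi * e <= I1.
  have -> : lo * (2 * d) = lo * (theta + d - (theta - d)) by congr (_ * _); ring.
  have -> : - (2 * pi * e) = turn (fun t => - e * (weight a n t)^-1).
    by rewrite turnZ// turn_weight mulNr mulrC.
  rewrite -iI /turn -RintegralD//.
  apply: le_Rintegral => //; [| |].
  - have mD : measurable (`[0, 2 * pi] : set R) by exact: measurable_itv.
    exact: (@integrableD _ _ _ leb _ mD _ _ mI ce).
  - by apply: cont_integrable; apply: contM => //; exact: Re_continuous_horner.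
  move=> t /=; rewrite in_itv/= => /andP[tl tr].
  have w0 : 0 < (weight a n t)^-1 by rewrite invr_gt0 weight_gt0.
  have [q0 _ q1 _] := hq (cexp t) (norm_cexp t).
  rewrite Re_arc in q1; rewrite indicE.
  case: (boolP (t \in _)) => [/set_mem/=|_]; last first.
    rewrite mulr0 add0r; apply: (@le_trans _ _ 0); last by rewrite mulr_ge0// ltW.
    by rewrite mulNr oppr_le0 mulr_ge0// ltW.
  rewrite in_itv/= => ht.
  have h : `|t - theta| <= d by rewrite ler_distl.
  have [dp dt] : d <= pi /\ `|t - theta| < 2 * pi - d by clear -h dd d'p p0 t0 t1; lra.
  have ca := cos_arc d0 dp dt.
  have := q1; rewrite ca h => /(_ isT) q3.
  rewrite mulr1; apply: (@le_trans _ _ ((1 - e) * (weight a n t)^-1)); last by rewrite ler_wpM2r// ltW.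
  by rewrite mulrBl mul1r mulNr lerD2r hw// leq_maxl.
have : lo * (2 * d) - 2 * pi * e <= 2 * pi * (fine (mu (arc theta (cos d'))) + e).
  by apply: (le_trans b1); rewrite I12 ler_wpM2l// mulr_ge0// ltW.
exact: absorb_half'.
Qed.

End ArcMeasure.

(** * From arcs to the density *)
Section Circle.
Variable R : realType.
Local Notation C := R[i].
Local Notation leb := (@lebesgue_measure R).

(** Lebesgue measure is built as an outer measure from half-open intervals. *)
Lemma null_cover (E : set R) (e : R) : leb E = 0%E -> 0 < e ->
  exists a b : nat -> R, [/\ forall n, a n <= b n,
    forall t, E t -> exists n, a n < t <= b n &
    (\sum_(n <oo) (b n - a n)%:E <= e%:E)%E].
Proof.
move=> E0 e0.
have /ereal_inf_lt[z [/= M covE sMz ze]] : (leb E < e%:E)%E by rewrite E0 lte_fin.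
have hM n : exists ab : R * R, [/\ ab.1 <= ab.2, M n = `]ab.1, ab.2]%classic &
    wlength idfun (M n) = (ab.2 - ab.1)%:E].
  have /ocitvP[M0|[[a b] /= ab Mab]] : ocitv (M n) by case: covE => /(_ n).
    exists (0, 0); split => //; first by rewrite M0 set_itvoc0.
    by rewrite M0 wlength0 /= subrr.
  exists (a, b); split => //=; first exact: ltW.
  by rewrite Mab wlength_itv/= lte_fin ab.
have [ab hab] := choice hM.
exists (fun n => (ab n).1), (fun n => (ab n).2); split.
- by move=> n; case: (hab n).
- move=> t Et; have [_ /(_ t Et)[n _ Mt]] := covE.
  by exists n; have [_ h _] := hab n; move: Mt; rewrite h /= in_itv.
- apply: ltW; apply: le_lt_trans ze; rewrite -sMz lee_nneseries// => n _.
    by rewrite lee_fin subr_ge0; case: (hab n).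
  by have [_ _ <-] := hab n.
Qed.

Lemma circle_angle (z : C) : `|z| = 1 -> exists2 t, 0 <= t < 2 * pi & z = cexp t.
Proof.
move=> /norm_eq1; case: z => x y; rewrite /normsq/= => h.
have p0 := pi_gt0 R.
have x1 : -1 <= x <= 1.
  rewrite -ler_norml -[leRHS]normr1 -ler_sqr ?nnegrE ?normr_ge0// !real_normK ?num_real// expr1n -h.
  by rewrite lerDl sqr_ge0.
have [/andP[a0 ap] ac] := acos_def x1.
have sy : sin (acos x) = `|y|.
  rewrite sin_acos// -sqrtr_sqr; congr (Num.sqrt _); rewrite -h; ring.
have [y0|y0] := leP 0 y.
  exists (acos x); last by rewrite /cexp ac sy ger0_norm.
  by apply/andP; split => //; lra.
exists (2 * pi - acos x).
  apply/andP; split; first lra.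
  rewrite ltrBlDr ltrDl lt0r a0 andbT; apply/eqP => a00.
  by move: sy; rewrite a00 sin0 => /esym/normr0_eq0; lra.
by rewrite /cexp mulrC mulr_natr addrC cosD2pi cosN ac sinD2pi sinN sy ltr0_norm// opprK.
Qed.

Lemma arc_preimage (theta d : R) : 0 <= d -> 0 < theta - d -> theta + d < 2 * pi ->
  `[0, 2 * pi[ `&` @expi R @^-1` arc theta (cos d) = `[theta - d, theta + d]%classic.
Proof.
move=> d0 h1 h2; have p0 := pi_gt0 R; have dp : d <= pi by lra.
apply/seteqP; split => t /=; rewrite !in_itv/=.
  move=> [/andP[t0 t1] [_ hx]].
  have : cos d <= cos (t - theta) by rewrite -Re_arc; exact: hx.
  rewrite cos_arc//.
    by rewrite ler_norml => /andP[]; lra.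
  by rewrite ltr_norml; apply/andP; split; lra.
move=> /andP[t0 t1]; split; first by apply/andP; split; lra.
split; first exact: norm_cexp.
suff : cos d <= cos (t - theta) by rewrite -Re_arc.
rewrite cos_arc//; first by rewrite ler_norml; apply/andP; split; lra.
by rewrite ltr_norml; apply/andP; split; lra.
Qed.

Lemma le_right_limit (P m k d eta : R) : 0 < P -> 0 <= k -> 0 < eta ->
  (forall x, d < x < d + eta -> m <= k * x / P) -> m <= k * d / P.
Proof.
move=> P0 k0 eta0 h; apply/ler_addgt0Pr => e e0.
pose g := Num.min (eta / 2) (e * P / (k + 1)).
have k1 : 0 < k + 1 by lra.
have g0 : 0 < g by rewrite lt_min !divr_gt0 ?mulr_gt0.
have g1 : g <= eta / 2 by rewrite ge_min lexx.
have g2 : g <= e * P / (k + 1) by rewrite ge_min lexx orbT.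
apply: le_trans (h (d + g) _) _; first by apply/andP; split; lra.
rewrite mulrDr mulrDl lerD2l ler_pdivrMr//; move: g2; rewrite ler_pdivlMr//; lra.
Qed.

Lemma ge_left_limit (P m k d eta : R) : 0 < P -> 0 <= k -> 0 < eta ->
  (forall x, d - eta < x < d -> k * x / P <= m) -> k * d / P <= m.
Proof.
move=> P0 k0 eta0 h; apply/ler_addgt0Pr => e e0.
pose g := Num.min (eta / 2) (e * P / (k + 1)).
have k1 : 0 < k + 1 by lra.
have g0 : 0 < g by rewrite lt_min !divr_gt0 ?mulr_gt0.
have g1 : g <= eta / 2 by rewrite ge_min lexx.
have g2 : g <= e * P / (k + 1) by rewrite ge_min lexx orbT.
rewrite -lerBlDr; apply: le_trans (h (d - g) _); last by apply/andP; split; lra.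
rewrite mulrBr mulrBl lerD2l lerN2 ler_pdivrMr//; move: g2; rewrite ler_pdivlMr//; lra.
Qed.

End Circle.

Section DensityBounds.
Variable R : realType.
Local Notation C := R[i].
Local Notation leb := (@lebesgue_measure R).
Variable mu : probability (plane R) R.
Hypothesis mu1 : mu (@unit_circle R) = 1%E.
Variable a : nat -> R.
Hypothesis a01 : forall n, 0 < a n < 1.
Hypothesis verb : verblunsky_coefficients mu (fun n => (- a n)%:C).
Variables (l r lo hi : R) (n1 : nat).
Hypotheses (l0 : 0 < l) (r2 : r < 2 * pi) (lo0 : 0 < lo).
Hypothesis hw : forall n t, (n1 <= n)%N -> l < t < r -> lo <= (weight a n t)^-1 <= hi.

Lemma hi_gt0 t : l < t < r -> 0 < hi.
Proof. by move=> /(hw (leqnn n1))/andP[h1 h2]; apply: lt_le_trans h2; apply: lt_le_trans h1. Qed.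

Lemma arc_le (theta d : R) : 0 <= d -> l < theta - d -> theta + d < r ->
  fine (mu (arc theta (cos d))) <= hi * d / pi.
Proof.
move=> d0 h1 h2; have l0' := l0; have r2' := r2.
have hi0 : 0 <= hi by apply/ltW/(@hi_gt0 theta); apply/andP; split; lra.
pose eta := Num.min (theta - d - l) (r - (theta + d)).
have e0 : 0 < eta by rewrite lt_min; apply/andP; split; lra.
have e1 : eta <= theta - d - l by rewrite ge_min lexx.
have e2 : eta <= r - (theta + d) by rewrite ge_min lexx orbT.
apply: (le_right_limit (pi_gt0 R) hi0 e0) => x /andP[x1 x2].
apply: (arc_upper mu1 a01 verb (n1 := n1) d0 x1); [lra|lra|] => n t nn ht.
suff /(hw nn)/andP[] : l < t < r by [].
by move: ht; rewrite ler_norml => /andP[? ?]; apply/andP; split; lra.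
Qed.

Lemma arc_ge (theta d : R) : 0 < d -> l < theta - d -> theta + d < r ->
  lo * d / pi <= fine (mu (arc theta (cos d))).
Proof.
move=> d0 h1 h2; have l0' := l0; have r2' := r2.
apply: (ge_left_limit (pi_gt0 R) (ltW lo0) d0) => x; rewrite subrr => /andP[x1 x2].
apply: (arc_lower mu1 a01 verb (n1 := n1) (ltW x1) x2); [lra|lra|] => n t nn ht.
suff /(hw nn)/andP[] : l < t < r by [].
by move: ht; rewrite ler_norml => /andP[? ?]; apply/andP; split; lra.
Qed.

Variables (w : R -> R) (mus : {measure set (plane R) -> \bar R}) (N : set (plane R)).
Hypothesis w0 : forall theta : R, theta \in `[0, 2 * pi[ -> 0 <= w theta.
Hypothesis mN : measurable N.
Hypothesis musN : mus (~` N) = 0%E.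
Hypothesis lebN : lebesgue_measure (`[0, 2 * pi[ `&` @expi R @^-1` N) = 0%E.
Hypothesis muE : forall A : set (plane R), measurable A ->
  mu A = (\int[@lebesgue_measure R]_(theta in `[0%R, (2 * pi)%R[ `&` @expi R @^-1` A)
                     (w theta / (2 * pi))%:E + mus A)%E.

Lemma singular_le A : measurable A -> (mus A <= mu A)%E.
Proof.
move=> mA; rewrite muE// leeDr//; apply: integral_ge0 => t [/= ht _].
by rewrite lee_fin divr_ge0 ?w0// ltW// twopi_gt0.
Qed.

(** By [arc_le] the measure [mu], hence its singular part, is at most a constant
    times the length on subarcs. Cover the null set that carries the singular
    part by intervals of small total length. *)
Lemma singular_arc (theta d : R) : 0 <= d -> l < theta - d -> theta + d < r ->
  mus (arc theta (cos d)) = 0%E.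
Proof.
move=> d0 h1 h2; have p2 := twopi_gt0 R; have l0' := l0; have r2' := r2.
have hi0 : 0 < hi by apply: (@hi_gt0 theta); apply/andP; split; lra.
have mA := @measurable_arc R theta (cos d).
apply/eqP; rewrite eq_le measure_ge0 andbT; apply/lee_addgt0Pr => e e0; rewrite add0e.
have [] := null_cover (e := e * (2 * pi) / hi) lebN; first by rewrite !divr_gt0// mulr_gt0.
move=> x [y [xy cov sum]].
(* the part of the n-th interval that meets the arc, itself an arc or empty *)
pose x' n := Num.max (x n) (theta - d); pose y' n := Num.min (y n) (theta + d).
pose A n := if x' n <= y' n then arc ((x' n + y' n) / 2) (cos ((y' n - x' n) / 2)) else set0.
have mAn n : measurable (A n).
  by rewrite /A; case: ifP => // _; exact: measurable_arc.
have muA n : (mus (A n) <= (hi / (2 * pi))%:E * (y n - x n)%:E)%E.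
  rewrite -EFinM /A; case: ifP => [xy'|_]; last first.
    by rewrite measure0 lee_fin mulr_ge0 ?subr_ge0// divr_ge0// ltW.
  have hx : theta - d <= x' n by rewrite le_max lexx orbT.
  have hy : y' n <= theta + d by rewrite ge_min lexx orbT.
  have hx2 : x n <= x' n by rewrite le_max lexx.
  have hy2 : y' n <= y n by rewrite ge_min lexx.
  apply: le_trans (singular_le (measurable_arc _ _)) _.
  rewrite -[leLHS]fineK ?fin_num_measure//; last exact: measurable_arc.
  rewrite lee_fin; apply: le_trans (arc_le _ _ _) _; [lra|lra|lra|].
  have -> : hi * ((y' n - x' n) / 2) / pi = hi / (2 * pi) * (y' n - x' n).
    by move: (pi_gt0 R); move: (@pi R) => P P0; field; exact: lt0r_neq0.
  by rewrite ler_wpM2l ?divr_ge0 ?(ltW hi0) ?(ltW p2)//; lra.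
have sub : arc theta (cos d) `&` N `<=` \bigcup_n A n.
  move=> z [Az Nz]; have [z1 _] := Az.
  have [t t02 zt] := circle_angle z1.
  have /cov[n /andP[xt ty]] : (`[0, 2 * pi[ `&` @expi R @^-1` N) t.
    by split; rewrite /= ?in_itv//= -[expi t]/(cexp t) -zt.
  have : (`[0, 2 * pi[ `&` @expi R @^-1` arc theta (cos d)) t.
    by split; rewrite /= ?in_itv//= -[expi t]/(cexp t) -zt.
  rewrite arc_preimage//; [|lra|lra] => /=; rewrite in_itv/= => /andP[t1 t2].
  have hx' : x' n <= t by rewrite ge_max (ltW xt).
  have hy' : t <= y' n by rewrite le_min ty.
  have hx : theta - d <= x' n by rewrite le_max lexx orbT.
  have hy : y' n <= theta + d by rewrite ge_min lexx orbT.
  exists n => //; rewrite /A (le_trans hx' hy').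
  have : (`[0, 2 * pi[ `&` @expi R @^-1` arc ((x' n + y' n) / 2) (cos ((y' n - x' n) / 2))) t.
    rewrite arc_preimage; [|lra|lra|lra].
    by rewrite /= in_itv/=; apply/andP; split; lra.
  by move=> [_]; rewrite /= -[expi t]/(cexp t) -zt.
have mAN : measurable (arc theta (cos d) `&` N) by exact: measurableI.
have AN : (mus (arc theta (cos d)) <= mus (arc theta (cos d) `&` N))%E.
  rewrite -[leRHS]adde0 -musN; apply: le_trans (measureU2 _ mAN (measurableC mN)).
  apply: le_measure; rewrite ?inE//; first by apply: measurableU => //; exact: measurableC.
  by move=> z Az; case: (pselect (N z)) => ?; [left|right].
apply: (le_trans AN).
have sA := @measure_sigma_subadditive _ _ _ mus _ _ mAn mAN sub; apply: (le_trans sA).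
apply: (@le_trans _ _ (\sum_(n <oo) (hi / (2 * pi))%:E * (y n - x n)%:E)%E).
  by apply: lee_nneseries.
rewrite nneseriesZl; last by move=> n _; rewrite lee_fin subr_ge0.
have -> : e = hi / (2 * pi) * (e * (2 * pi) / hi).
  by move: (pi_gt0 R); move: (@pi R) => P P0; field; rewrite !lt0r_neq0.
by rewrite [X in (_ <= X)%E]EFinM lee_wpmul2l// lee_fin divr_ge0// ltW.
Qed.

(** On a short arc around [theta] the measure is the integral of [w], which is
    nearly constant there, and lies between [lo] and [hi] times the normalized
    length. *)
Lemma density_bounds theta : {in `]0, 2 * pi[, continuous w} -> l < theta < r ->
  lo <= w theta <= hi.
Proof.
move=> cw /andP[th1 th2]; have l0' := l0; have r2' := r2; have p0 := pi_gt0 R.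
have hth : theta \in `]0, 2 * pi[ by rewrite in_itv/=; apply/andP; split; lra.
suff key e : 0 < e -> w theta - e <= hi /\ lo <= w theta + e.
  by apply/andP; split; apply/ler_addgt0Pr => e /key[]; lra.
move=> e0; have /cvgrPdist_le/(_ e e0) := cw theta hth.
move=> /nbhs_ballP[d1 /= d10 hd1].
pose d := Num.min (d1 / 2) (Num.min ((theta - l) / 2) ((r - theta) / 2)).
have d0 : 0 < d by rewrite !lt_min; apply/and3P; split; lra.
have dd1 : d <= d1 / 2 by rewrite ge_min lexx.
have dl : d <= (theta - l) / 2 by rewrite !ge_min lexx !orbT.
have dr : d <= (r - theta) / 2 by rewrite !ge_min lexx !orbT.
have hd t : theta - d <= t <= theta + d -> w theta - e <= w t <= w theta + e.
  move=> /andP[t1 t2]; have : ball theta d1 t.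
    by rewrite /ball/= ltr_norml; apply/andP; split; lra.
  by move=> /hd1 /=; rewrite ler_norml => /andP[? ?]; apply/andP; split; lra.
have h1 : l < theta - d by lra.
have h2 : theta + d < r by lra.
have mA := @measurable_arc R theta (cos d).
have := muE mA; rewrite singular_arc ?(ltW d0)// adde0 arc_preimage ?(ltW d0)//; [|lra|lra].
have mD : measurable (`[theta - d, theta + d] : set R) by exact: measurable_itv.
have iw : leb.-integrable `[theta - d, theta + d] (EFin \o (fun t => w t / (2 * pi))).
  apply: continuous_compact_integrable; first exact: segment_compact.
  apply: continuous_in_subspaceT => t /set_mem /=; rewrite in_itv/= => /andP[t1 t2].
  apply: (@continuousM R R w (fun=> (2 * pi)^-1)); last exact: cst_continuous.
  by apply: cw; rewrite in_itv/=; apply/andP; split; lra.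
have ic k : leb.-integrable `[theta - d, theta + d] (EFin \o (fun _ : R => k)).
  by apply: continuous_compact_integrable; [exact: segment_compact|move=> ?; exact: cst_continuous].
have vol k : (\int[leb]_(t in `[(theta - d)%R, (theta + d)%R]) (k / (2 * pi)))%R = k * d / pi.
  rewrite Rintegral_cst//= lebesgue_measure_itv/= lte_fin ifT; last by lra.
  rewrite -EFinB/=; move: p0; move: (@pi R) => P P0; field; exact: lt0r_neq0.
move=> /(congr1 fine); rewrite -[RHS]/(\int[leb]_(t in `[(theta - d)%R, (theta + d)%R]) (w t / (2 * pi)))%R => mE.
have s1 := arc_le (ltW d0) h1 h2; have s2 := arc_ge d0 h1 h2; rewrite mE in s1 s2.
have pd : 0 < d / pi by rewrite divr_gt0.
have tp := ltW (twopi_gt0 R).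
have u1 : (w theta - e) * d / pi <= (\int[leb]_(t in `[(theta - d)%R, (theta + d)%R]) (w t / (2 * pi)))%R.
  rewrite -vol; apply: le_Rintegral => // t /=; rewrite in_itv/= => /hd /andP[? _].
  by rewrite ler_wpM2r// invr_ge0.
have u2 : (\int[leb]_(t in `[(theta - d)%R, (theta + d)%R]) (w t / (2 * pi)))%R <= (w theta + e) * d / pi.
  rewrite -vol; apply: le_Rintegral => // t /=; rewrite in_itv/= => /hd /andP[_ ?].
  by rewrite ler_wpM2r// invr_ge0.
by split; rewrite -(ler_pM2r pd) !mulrA; [apply: le_trans s1|apply: le_trans u2].
Qed.

End DensityBounds.

(** * The logarithm of the density near the point 1 *)
Section Density.
Variable R : realType.
Local Opaque Gamma eGamma.

(** Changing the sign of [c] amounts, up to sign, to reflecting the second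
    coordinate. *)
Lemma energyN (a : nat -> R) c s n : energy a (- c) s n = energy a c s n.
Proof.
suff [k k2 [e1 e2]] : exists2 k : R, k ^+ 2 = 1 &
    (transfer a (- c) s n).1 = k * (transfer a c s n).1 /\
    (transfer a (- c) s n).2 = - (k * (transfer a c s n).2).
  by rewrite /energy e1 e2 sqrrN !exprMn k2 !mul1r.
elim: n => [|n [k k2 [e1 e2]]]; first by exists 1; rewrite ?expr1n//= mulr1 mulr0 oppr0.
exists (- k); first by rewrite sqrrN.
by rewrite /= e1 e2; split; ring.
Qed.

Lemma energy_norm (a : nat -> R) c s n : energy a `|c| s n = energy a c s n.
Proof. by case: (ger0P c) => // _; exact: energyN. Qed.

Lemma weight_energy (a : nat -> R) n t : (forall n, 0 < a n < 1) ->
  weight a n t = energy a `|cos (t / 2)| (sin (t / 2)) n.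
Proof.
move=> a01; rewrite energy_norm /weight.
have -> : cexp t = cexp (t / 2) ^+ 2 by rewrite expr2 -cexpD; congr cexp; field.
have [_ ->] := szego_circle a01 n (cos2Dsin2 (t / 2)).
by rewrite normsqM normsqX normsq_cexp expr1n mul1r /normsq/= sqrrN.
Qed.

Lemma main_term_continuous (D tau s : R) : 0 < s -> {for s, continuous (main_term D tau)}.
Proof.
move=> s0; rewrite /main_term; elim: `|_|%N => [|n ih].
  have -> : (fun x : R => \sum_(0 <= i < 0) main_coef D tau i * x `^ (- tau^-1 + 1 + 2 * i%:R)) = cst 0.
    by apply/funext => x; rewrite big_geq.
  exact: cst_continuous.
have -> : (fun x : R => \sum_(0 <= i < n.+1) main_coef D tau i * x `^ (- tau^-1 + 1 + 2 * i%:R)) =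
  (fun x : R => \sum_(0 <= i < n) main_coef D tau i * x `^ (- tau^-1 + 1 + 2 * i%:R) +
     main_coef D tau n * x `^ (- tau^-1 + 1 + 2 * n%:R)).
  by apply/funext => x; rewrite big_nat_recr.
apply: (@continuousD R R R _ (fun x => main_coef D tau n * x `^ _)) => //.
apply: (@continuousM R R (fun=> main_coef D tau n) (fun x => x `^ _)); first exact: cst_continuous.
by apply: powR_continuous; rewrite in_itv/= andbT.
Qed.

Lemma half_sin_continuous : continuous (fun t : R => sin (t / 2)).
Proof.
move=> t; apply: (continuous_comp (f := fun t : R => t / 2) (g := sin)); last exact: continuous_sin.
exact: mulrr_continuous.
Qed.

Lemma sin_ge_half : exists2 d : R, 0 < d & forall x, 0 < x < d -> x / 2 <= sin x.
Proof.
have : cos (0 : R) > 2^-1 by rewrite cos0; lra.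
move=> /(cvgr_gt (cos (0 : R)) (@continuous_cos R 0)) /nbhs_ballP[d /= d0 hd].
exists d => // x /andP[x0 xd].
have dS y : y \in `]0, x[ -> is_derive y 1 (@sin R) (cos y) by move=> _; exact: is_derive_sin.
have cS : {within `[0, x], continuous (@sin R)} by exact/continuous_subspaceT/continuous_sin.
have [c] := MVT x0 dS cS; rewrite in_itv/= sin0 !subr0 => /andP[c0 cx] ->.
rewrite mulrC ler_wpM2r ?(ltW x0)//; apply/ltW/hd.
by rewrite /ball/= sub0r normrN gtr0_norm// (lt_trans cx).
Qed.

Variables (tau n0 D : R) (mu : probability (plane R) R) (w : R -> R).
Hypotheses (tau0 : 0 < tau) (tau1 : tau < 1) (n00 : 0 < n0)
  (D0 : 0 < D) (Dn0 : D < n0 `^ tau).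
Hypothesis mu1 : mu (@unit_circle R) = 1%E.
Hypothesis verb : verblunsky_coefficients mu (fun n => (- coef D tau n0 n)%:C).
Hypothesis dens : ac_density mu w.
Hypothesis cw : {in `]0, 2 * pi[, continuous w}.
Let a := coef D tau n0.

Let a01 n : 0 < a n < 1.
Proof. exact: coef01. Qed.

(** Near [theta] all the weights of large index lie, by [energy_asymptotics],
    between continuous functions of the angle. These functions are within [e] of
    their values at [theta] on a neighborhood, where [density_bounds] applies;
    [n1] is chosen there uniformly, because [S] stays above [S theta / 2]. *)
Lemma density_estimate : exists K s1, 0 < s1 < 1 /\
  forall theta, theta \in `]0, 2 * pi[ -> 0 < sin (theta / 2) < s1 ->
    `|ln (w theta) + main_term D tau (sin (theta / 2))| <= K * ln (sin (theta / 2))^-1.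
Proof.
have [K [s1 [s11 hE]]] := energy_asymptotics tau0 tau1 n00 D0 Dn0.
exists K, s1; split=> // theta hth /andP[sp sl].
have [_ w0 [mus [[N [mN musN lebN]] muE]]] := dens.
pose S t : R := sin (t / 2).
pose Gm t := - main_term D tau (S t) - K * ln (S t)^-1.
pose Gp t := - main_term D tau (S t) + K * ln (S t)^-1.
have cM : {for theta, continuous (fun t => main_term D tau (S t))}.
  by apply: (continuous_comp (f := S)); [exact: half_sin_continuous|exact: main_term_continuous].
have cL : {for theta, continuous (fun t => K * ln (S t)^-1)}.
  apply: (@continuousM R R (fun=> K)); first exact: cst_continuous.
  apply: (continuous_comp (f := fun t => (S t)^-1) (g := @ln R)).
    by apply: (@continuousV R R S); [rewrite gt_eqF|exact: half_sin_continuous].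
  by apply: continuous_ln; rewrite invr_gt0.
have cGm : {for theta, continuous Gm}.
  by apply: (@continuousB R R R (fun t => - main_term D tau (S t))) => //; exact: continuousN.
have cGp : {for theta, continuous Gp}.
  by apply: (@continuousD R R R (fun t => - main_term D tau (S t))) => //; exact: continuousN.
suff key e : 0 < e -> Gm theta - e <= ln (w theta) <= Gp theta + e.
  rewrite ler_norml; apply/andP; split.
    rewrite -lerBlDr; suff : Gm theta <= ln (w theta) by rewrite /Gm /S; lra.
    by apply/ler_addgt0Pr => e /key/andP[]; lra.
  suff : ln (w theta) <= Gp theta by rewrite /Gp /S; lra.
  by apply/ler_addgt0Pr => e /key/andP[].
move=> e0.
have : \forall t \near theta, [/\ Gm theta - e <= Gm t, Gp t <= Gp theta + e, S theta / 2 < S t & S t < s1].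
  near=> t; split; near: t.
  - by apply: (cvgr_ge _ cGm); rewrite ltrBlDr ltrDl.
  - by apply: (cvgr_le _ cGp); rewrite ltrDl.
  - by apply: (cvgr_gt _ (@half_sin_continuous theta)); rewrite /S; lra.
  - exact: (cvgr_lt _ (@half_sin_continuous theta)).
move=> /nbhs_ballP[d /= d0 hd].
have /andP[th0 th2] : 0 < theta < 2 * pi by move: hth; rewrite in_itv.
pose l := Num.max (theta - d) (theta / 2); pose r := Num.min (theta + d) ((theta + 2 * pi) / 2).
have l0 : 0 < l by rewrite lt_max divr_gt0// orbT.
have r2 : r < 2 * pi by rewrite gt_min; apply/orP; right; lra.
have lr : l < theta < r by rewrite gt_max lt_min; apply/andP; split; apply/andP; split; lra.
pose x := (D / (S theta / 2)) `^ tau^-1 + 3.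
have x0 : 0 <= x by rewrite addr_ge0// powR_ge0.
pose n1 := (Num.truncn x).+1.
have xn : x <= n1%:R by apply/ltW; have /andP[] := truncn_itv x0.
have hw n t : (n1 <= n)%N -> l < t < r ->
    expR (Gm theta - e) <= (weight a n t)^-1 <= expR (Gp theta + e).
  move=> nn /andP[]; rewrite gt_max lt_min => /andP[t1 _] /andP[t2 _].
  have [|h1 h2 h3 h4] := hd t; first by rewrite /ball/= ltr_norml; apply/andP; split; lra.
  have S0 : 0 < S t by apply: lt_trans h3; rewrite divr_gt0.
  have cs : `|cos (t / 2)| ^+ 2 + S t ^+ 2 = 1 by rewrite real_normK ?num_real// cos2Dsin2.
  have c0 : 0 < `|cos (t / 2)|.
    rewrite normr_gt0; apply/eqP => c0; move: cs; rewrite c0 normr0 expr0n add0r => /eqP.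
    have /andP[_ s1l] := s11.
    by rewrite lt_eqF// exprn_ilt1// ?(ltW S0)// (lt_trans h4).
  have hn : (D / S t) `^ tau^-1 + 3 <= n%:R.
    apply: (@le_trans _ _ x); last by apply: (le_trans xn); rewrite ler_nat.
    rewrite lerD2r ge0_ler_powR ?nnegrE ?invr_ge0 ?(ltW tau0) ?divr_ge0 ?(ltW D0) ?(ltW S0)//.
      by rewrite ltW// divr_gt0.
    by rewrite ler_pM2l// lef_pV2 ?posrE ?divr_gt0// ltW.
  have /(_ _) := hE (S t) _ n _ c0 cs hn; rewrite S0 h4 => /(_ isT).
  rewrite -/a weight_energy// -/(S t); have E0 := weight_gt0 a01 n t.
  rewrite weight_energy// in E0; move: E0; rewrite -/(S t); set E := energy _ _ _ _ => E0 hEt.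
  have -> : E^-1 = expR (- ln E) by rewrite expRN lnK.
  by rewrite !ler_expR; move: hEt h1 h2; rewrite ler_norml /Gm /Gp => /andP[]; lra.
have /andP[b1 b2] := density_bounds mu1 a01 verb l0 r2 (expR_gt0 _) hw w0 mN musN lebN muE cw lr.
have wp : 0 < w theta := lt_le_trans (expR_gt0 _) b1.
have we : w theta = expR (ln (w theta)) by rewrite lnK.
by apply/andP; split; rewrite -ler_expR -we.
Unshelve. all: by end_near. Qed.

Hypothesis per : forall theta, w (theta + 2 * pi) = w theta.

Lemma log_density_near : exists2 k, 0 < k & \forall theta \near 0^',
  `|ln (w theta) + main_term D tau `|sin (theta / 2)| | <= k * `|ln `|theta| |.
Proof.
have [K [s1 [/andP[s10 s11] hK]]] := density_estimate.
have [d1 d10 hd1] := sin_ge_half.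
have : s1 > sin ((0 : R) / 2) by rewrite mul0r sin0.
move=> /(cvgr_lt _ (@half_sin_continuous 0)) /nbhs_ballP[d2 /= d20 hd2].
have p0 := pi_gt0 R.
(* by periodicity the value of w at - x is the one at 2 * pi - x, which has the same half-angle sine *)
have main x : 0 < x -> x < d1 -> x < d2 -> x < 4^-1 -> x < pi ->
    `|ln (w x) + main_term D tau (sin (x / 2))| <= (2 * `|K| + 1) * - ln x /\
    `|ln (w (- x)) + main_term D tau (sin (x / 2))| <= (2 * `|K| + 1) * - ln x /\
    0 < sin (x / 2).
  move=> x0 x1 x2 x3 xp.
  have sx : x / 4 <= sin (x / 2).
    by apply: le_trans (hd1 (x / 2) _); [lra|apply/andP; split; lra].
  have sp : 0 < sin (x / 2) by apply: lt_le_trans sx; rewrite divr_gt0.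
  have sl : sin (x / 2) < s1.
    by apply: (hd2 x); rewrite /ball/= sub0r normrN gtr0_norm.
  have lx : 0 <= - ln x by rewrite oppr_ge0 ln_le0//; lra.
  have ls : ln (sin (x / 2))^-1 <= 2 * - ln x.
    rewrite lnV ?posrE// mulrN lerN2 mulr_natl -lnXn// ler_ln ?posrE ?exprn_gt0//.
    by apply: le_trans sx; rewrite expr2; nra.
  have ls0 : 0 <= ln (sin (x / 2))^-1.
    by rewrite lnV ?posrE// oppr_ge0 ln_le0// sin_le1.
  have kb : K * ln (sin (x / 2))^-1 <= (2 * `|K| + 1) * - ln x.
    apply: (@le_trans _ _ (`|K| * (2 * - ln x))).
      by apply: (@le_trans _ _ (`|K| * ln (sin (x / 2))^-1)); [rewrite ler_wpM2r// ler_norm|rewrite ler_wpM2l].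
    lra.
  split; first by apply: le_trans kb; apply: hK; [rewrite in_itv/=; apply/andP; split; lra|rewrite sp].
  split=> //; apply: le_trans kb; rewrite -per.
  have e : sin ((- x + 2 * pi) / 2) = sin (x / 2).
    have -> : (- x + 2 * pi) / 2 = - (x / 2) + pi by field.
    by rewrite sinDpi sinN opprK.
  by rewrite -e; apply: hK; [rewrite in_itv/=; apply/andP; split; lra|rewrite e sp].
exists (2 * `|K| + 1); first by rewrite ltr_wpDl// mulr_ge0.
pose d := Num.min (Num.min d1 d2) (Num.min 4^-1 pi).
have d0 : 0 < d by rewrite !lt_min d10 d20 p0 invr_gt0 ltr0n.
apply/nbhs_ballP; exists d => //= theta; rewrite /ball/= sub0r normrN => hth /= th0.
have x0 : 0 < `|theta| by rewrite normr_gt0.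
move: hth; rewrite !lt_min => /andP[/andP[h1 h2] /andP[h3 h4]].
have [m1 [m2 sp]] := main _ x0 h1 h2 h3 h4.
have lx : `|ln `|theta| | = - ln `|theta| by rewrite ler0_norm// ln_le0//; lra.
rewrite lx; move: m1 m2 sp; case: (ltrP 0 theta) => th.
  by rewrite (gtr0_norm th) => m1 _ sp; rewrite (gtr0_norm sp).
rewrite (ler0_norm th) opprK => _ m2 sp.
suff -> : `|sin (theta / 2)| = sin (- theta / 2) by [].
by move: sp; rewrite mulNr sinN oppr_gt0 => /ltr0_norm.
Qed.

Lemma log_density_bigO : (fun theta => ln (w theta)) =
  (fun theta => - main_term D tau `|sin (theta / 2)|) +O_ (0^') (fun theta => ln `|theta|).
Proof.
apply/eqaddOP/bigO_exP; have [k k0 h] := log_density_near; exists k => //.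
by apply: filterS h => theta; rewrite -[X in _ <= _ -> X <= _]/(`|ln (w theta) - - main_term D tau `|sin (theta / 2)| |) opprK.
Qed.

End Density.

Theorem theorem6 (R : realType) (tau n0 D : R)
    (mu : probability (plane R) R) (w : R -> R) :
  0 < tau < 1 -> 0 < n0 -> 0 < D < n0 `^ tau ->
  mu (@unit_circle R) = 1%E ->
  verblunsky_coefficients mu (fun n => (- (D / (n%:R + n0) `^ tau))%:C) ->
  ac_density mu w ->
  {in `]0, 2 * pi[, continuous w} ->
  (forall theta, w (theta + 2 * pi) = w theta) ->
  let L := `|Num.ceil ((2 * tau)^-1 - 2^-1)|%N in
  let P (n : nat) := D `^ tau^-1 * (Gamma (n%:R + 2^-1) / Gamma (2 * tau)^-1)
      * \sum_(0 <= l < n.+1)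
          Gamma ((2 * tau)^-1 - l%:R - 2^-1) / ((n - l)`!)%:R in
  forall theta : R,
    ln (w theta) =
      (- \sum_(0 <= n < L)
          P n * `|sin (theta / 2)| `^ (- tau^-1 + 1 + 2 * n%:R))
      +O_(theta \near 0^') (ln `|theta|).
Proof.
move=> /andP[tau0 tau1] n00 /andP[D0 Dn0] mu1 verb dens cw per L P theta.
have H := log_density_bigO tau0 tau1 n00 D0 Dn0 mu1 verb dens cw per.
exact: (congr1 (fun f : R -> R => f theta) H).
Qed.
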